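(* Let $0<s<t$ and $p\ge2$. If $\alpha>\min\{1/2,2/p\}$, then $\mathcal A_t^s$ is not bounded from $L^p(\mathbb R^3)$ to $L^p_\alpha(\mathbb R^3)$.
   Context: For $0<s<t$ set $\Phi_t^s(\theta,\phi)=\big((t+s\cos\theta)\cos\phi,\,(t+s\cos\theta)\sin\phi,\,s\sin\theta\big)$, a parametrization of the torus $\mathbb T_t^s\subset\mathbb R^3$. The measure $\sigma_t^s$ is defined by $\langle f,\sigma_t^s\rangle=\int_{[0,2\pi)^2}f(\Phi_t^s(\theta,\phi))\,d\theta\,d\phi$, and $\mathcal A_t^sf=f*\sigma_t^s$, i.e. $\mathcal A_t^sf(x)=\int_{[0,2\pi)^2}f(x-\Phi_t^s(\theta,\phi))\,d\theta\,d\phi$. $L^p_\alpha(\mathbb R^3)$ is the $L^p$ Sobolev (Bessel potential) space of order $\alpha$, with norm $\|\mathcal F^{-1}((1+|\xi|^2)^{\alpha/2}\mathcal Ff)\|_{L^p}$. *)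

(* Defs.v *)
From HB Require Import structures.
From mathcomp Require Import all_boot all_order all_algebra.
From mathcomp Require Import all_classical all_reals all_analysis.
From mathcomp Require Import complex.
Set Implicit Arguments.
Unset Strict Implicit.
Unset Printing Implicit Defensive.
Import Order.TTheory GRing.Theory Num.Theory.
Import numFieldNormedType.Exports.
Local Open Scope classical_set_scope.
Local Open Scope ring_scope.
Local Open Scope complex_scope.

Notation space3 R := (R * R * R)%type.

Notation leb1 R := (@lebesgue_measure R).
Notation leb2 R := (leb1 R \x leb1 R)%E.
Notation leb3 R := (leb1 R \x leb1 R \x leb1 R)%E.

Definition cintegral {d} {T : measurableType d} {R : realType}
    (mu : {measure set T -> \bar R}) (D : set T) (f : T -> R[i]) : R[i] :=
  (\int[mu]_(x in D) complex.Re (f x)) +i* (\int[mu]_(x in D) complex.Im (f x)).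

Definition dot3 {R : realType} (x y : space3 R) : R :=
  x.1.1 * y.1.1 + x.1.2 * y.1.2 + x.2 * y.2.

Definition cexpi {R : realType} (r : R) : R[i] := cos r +i* sin r.

(* Normalisation: fourier f xi = \int e^{-i x.xi} f(x) dx, inverted by
   (2 pi)^{-3} \int e^{i x.xi} g(xi) dxi. *)
Definition fourier {R : realType} (f : space3 R -> R[i]) (xi : space3 R) : R[i] :=
  cintegral (leb3 R) setT (fun x => cexpi (- dot3 x xi) * f x).

Definition inv_fourier {R : realType} (g : space3 R -> R[i]) (x : space3 R) :
    R[i] :=
  ((2 * pi) ^- 3)%:C *
    cintegral (leb3 R) setT (fun xi => cexpi (dot3 x xi) * g xi).

Definition basis3 {R : realType} (j : 'I_3) : space3 R :=
  ((j == 0%N :> nat)%:R, (j == 1%N :> nat)%:R, (j == 2%N :> nat)%:R).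

Fixpoint partials {R : realType} (l : seq 'I_3) (f : space3 R -> R) :
    space3 R -> R :=
  if l is j :: l' then 'D_(basis3 j) (partials l' f) else f.

(* All iterated partial derivatives exist everywhere and are rapidly decreasing;
   since they are all bounded, f is automatically C^infinity. *)
Definition real_schwartz {R : realType} (f : space3 R -> R) : Prop :=
  (forall (l : seq 'I_3) (j : 'I_3) (x : space3 R),
     derivable (partials l f) x (basis3 j)) /\
  (forall (l : seq 'I_3) (k : nat), exists M : R, forall x : space3 R,
     (1 + dot3 x x) ^+ k * `|partials l f x| <= M).

Definition schwartz {R : realType} (f : space3 R -> R[i]) : Prop :=
  real_schwartz (fun x => complex.Re (f x)) /\
  real_schwartz (fun x => complex.Im (f x)).

Definition Lp_norm {R : realType} (p : R) (f : space3 R -> R[i]) : \bar R :=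
  'N[leb3 R]_(p%:E)[EFin \o (@Normc.normc R \o f)]%E.

Definition in_Lp {R : realType} (p : R) (f : space3 R -> R[i]) : Prop :=
  [/\ measurable_fun [set: space3 R] (fun x => complex.Re (f x)),
      measurable_fun [set: space3 R] (fun x => complex.Im (f x)) &
      (Lp_norm p f < +oo)%E].

Definition pairing {R : realType} (u phi : space3 R -> R[i]) : R[i] :=
  cintegral (leb3 R) setT (fun x => u x * phi x).

Definition bessel_symbol {R : realType} (alpha : R) (xi : space3 R) : R :=
  (1 + dot3 xi xi) `^ (alpha / 2).

(* g = F^{-1}((1+|xi|^2)^{alpha/2} F u) as tempered distributions. By definition
   <F v, phi> = <v, F phi> and <F^{-1} v, phi> = <v, F^{-1} phi>, so the right-hand
   side maps phi to <u, F((1+|xi|^2)^{alpha/2} F^{-1} phi)>. *)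
Definition is_bessel_derivative {R : realType} (alpha : R)
    (u g : space3 R -> R[i]) : Prop :=
  forall phi : space3 R -> R[i], schwartz phi ->
    pairing g phi =
    pairing u
      (fourier (fun xi => (bessel_symbol alpha xi)%:C * inv_fourier phi xi)).

(* For alpha >= 0 the space L^p_alpha consists of functions and is contained in
   L^p. For alpha < 0 this is only the part of L^p_alpha lying in L^p. *)
Definition in_Sobolev {R : realType} (p alpha : R) (u : space3 R -> R[i]) :
    Prop :=
  in_Lp p u /\ exists2 g, in_Lp p g & is_bessel_derivative alpha u g.

(* The infimum runs over the versions of one function, which is unique almost
   everywhere; it is +oo when there is none. *)
Definition Sobolev_norm {R : realType} (p alpha : R) (u : space3 R -> R[i]) :
    \bar R :=
  ereal_inf [set Lp_norm p g | g in
               [set g | in_Lp p g /\ is_bessel_derivative alpha u g]].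

Definition bounded_Lp_Sobolev {R : realType} (p alpha : R)
    (A : (space3 R -> R[i]) -> (space3 R -> R[i])) : Prop :=
  exists C : R, forall f : space3 R -> R[i], in_Lp p f ->
    in_Sobolev p alpha (A f) /\
    (Sobolev_norm p alpha (A f) <= C%:E * Lp_norm p f)%E.

Definition torus {R : realType} (s t : R) (w : R * R) : space3 R :=
  ((t + s * cos w.1) * cos w.2, (t + s * cos w.1) * sin w.2, s * sin w.1).

Definition torus_average {R : realType} (s t : R) (f : space3 R -> R[i])
    (x : space3 R) : R[i] :=
  cintegral (leb2 R) (`[0, 2 * pi[ `*` `[0, 2 * pi[)
    (fun w => f (x - torus s t w)).

(* Main.v *)
(** If the average were bounded, testing the Bessel derivative of [A f] against a
    Gaussian wave packet of width [a^(-1/2)] and frequency [l e_3] would give, by Plancherel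
    and duality,
      [\int <xi>^alpha |packet^(xi)|^2 m(xi) dxi <= C |f|_p |packet|_q]
    whenever [A f] is a superposition [\int k(v) packet(x - Psi v) dmu(v)] of translates of
    that packet, with multiplier [m(xi) = \int k(v) cos(Psi v . xi) dmu(v)].

    Taking [f] to be one packet and letting [a -> 0] localises [xi] at [l e_3], so the
    Fourier transform of the torus on the axis is [O(l^(-alpha))].  The points
    [theta = +-pi/2], where the torus is tangent to horizontal planes along whole circles,
    force its Gaussian means to be of size [l^(-1/2)], hence [alpha <= 1/2].

    Taking [f] to be the torus measure smoothed at scale [a^(-1/2)], one has [f = O(1/a)]
    and [|f|_1 ~ a^(-3/2)], while [m] is the squared modulus of the Fourier transform of the
    torus.  Two-sided bounds for the number of pairs of points of the torus at distance
    [a^(-1/2)] show that a fixed proportion of the energy of [m] below frequency [a^(1/2)]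
    lies at frequencies [~ a^(1/2)].  This gives [a^(alpha/2) <= B a^(1/p)] for all large [a],
    hence [alpha <= 2/p]. *)

From HB Require Import structures.
Require Import Defs.
From mathcomp Require Import all_boot all_order all_algebra.
From mathcomp Require Import all_classical all_reals all_analysis.
From mathcomp Require Import measurable_realfun complex ring lra.
Set Implicit Arguments.
Unset Strict Implicit.
Unset Printing Implicit Defensive.
Import Order.TTheory GRing.Theory Num.Theory.
Import numFieldNormedType.Exports.
Local Open Scope classical_set_scope.
Local Open Scope ring_scope.

(** * Integrability and Fubini for real-valued integrals *)

(** A Bessel derivative is accessible only through its pairings with Schwartz functions, so
    everything must be read off one explicit family. Modulated Gaussians serve: their transforms,
    and those of integrable superpositions of their translates, follow from Fubini, so that neither
    a general Plancherel theorem nor Fourier inversion enters. Packets being real and even, only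
    cosine integrals of the superpositions are needed.

    On the axis, stationary phase is avoided. Integrated over [l] against a Gaussian of width [2^n],
    the product of the axial transform with [cos (l * s)] becomes, by Fubini, an integral of
    positive Gaussians in the distance from the height [s sin theta] to [s] and [-s]. Quadratic
    tangency makes it at least of order [2^(n/2)], whereas decay like [l^(-beta)] allows only
    [2^(n (1 - beta))].

    For the smoothed torus, the sup bound and the mass are interpolated to control the [L^p] norm.
    Once the common normalisation cancels, an energy of order [a^(alpha/2 - 1)] faces a bound of
    order [a^(1/p - 1)]. *)

Section product_sigma_finite.
Context d1 d2 (T1 : measurableType d1) (T2 : measurableType d2) (R : realType).
Variable m1 : {sigma_finite_measure set T1 -> \bar R}.
Variable m2 : {sigma_finite_measure set T2 -> \bar R}.

Lemma sigma_finite_product : sigma_finite setT (m1 \x m2)%E.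
Proof.
have /sigma_finiteP[F [FT ndF mF]] := sigma_finiteT m1.
have /sigma_finiteP[G [GT ndG mG]] := sigma_finiteT m2.
exists (fun n => F n `*` G n).
  rewrite -setXTT FT GT predeqE => -[x y]; split.
    move=> [/= [n _ Fnx] [k _ Gky]]; exists (maxn n k) => //; split.
    - by move: x Fnx; exact/subsetPset/ndF/leq_maxl.
    - by move: y Gky; exact/subsetPset/ndG/leq_maxr.
  by move=> [n _ []/= ? ?]; split; exists n.
move=> n; have [mFn Fn] := mF n; have [mGn Gn] := mG n.
split; first exact: measurableX.
by rewrite product_measure1E// lte_mul_pinfty// ge0_fin_numE.
Qed.

Let product_sfin := @Measure_isSigmaFinite.Build _ _ _ (m1 \x m2)%E
  sigma_finite_product.

(** Bundling the product with its sigma-finiteness allows products to be iterated: the plane, space,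
    pairs of angles, and space times an arbitrary parameter space. *)
Definition sigma_finite_prod :
    {sigma_finite_measure set (T1 * T2)%type -> \bar R} :=
  HB.pack (m1 \x m2)%E product_sfin.

End product_sigma_finite.

Notation "mu '.-intg' f" := (mu.-integrable setT (EFin \o f)) (at level 2, format "mu .-intg  f").

Section integrability.
Context d (T : measurableType d) (R : realType) (mu : {measure set T -> \bar R}).
Implicit Types f g : T -> R.

Lemma intg_dominated f g : measurable_fun setT f -> mu.-intg g ->
  (forall x, `|f x| <= g x) -> mu.-intg f.
Proof.
move=> mf ig fg; apply: (le_integrable _ _ _ ig) => //.
  exact/measurable_EFinP.
by move=> x _ /=; rewrite lee_fin (le_trans (fg x))// ler_norm.
Qed.

Lemma intg_measurable f : mu.-intg f -> measurable_fun setT f.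
Proof. by move=> /(measurable_int mu)/measurable_EFinP. Qed.

Lemma intgZl k f : mu.-intg f -> mu.-intg (fun x => k * f x).
Proof. by move=> /(integrableZl measurableT k); apply: eq_integrable. Qed.

Lemma intgZr k f : mu.-intg f -> mu.-intg (fun x => f x * k).
Proof.
by move=> /(intgZl k); apply: eq_integrable => // x _ /=; rewrite mulrC.
Qed.

Lemma intgD f g : mu.-intg f -> mu.-intg g -> mu.-intg (fun x => f x + g x).
Proof. by move=> If Ig; have := integrableD measurableT If Ig; apply: eq_integrable. Qed.

Lemma intgN f : mu.-intg f -> mu.-intg (fun x => - f x).
Proof. by move=> /(intgZl (-1)); apply: eq_integrable => // x _ /=; rewrite mulN1r. Qed.

Lemma intgB f g : mu.-intg f -> mu.-intg g -> mu.-intg (fun x => f x - g x).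
Proof. by move=> If Ig; apply: intgD => //; exact: intgN. Qed.

Lemma intg_norm f : mu.-intg f -> mu.-intg (fun x => `|f x|).
Proof.
move=> If; apply: (le_integrable _ _ _ If) => //.
  by apply/measurable_EFinP/measurableT_comp => //; exact: intg_measurable.
by move=> x _ /=; rewrite normr_id.
Qed.

Lemma eq_intg f g : f =1 g -> mu.-intg f -> mu.-intg g.
Proof. by move=> /funext ->. Qed.

Lemma Rint_le f g : mu.-intg f -> mu.-intg g -> (forall x, f x <= g x) ->
  \int[mu]_x f x <= \int[mu]_x g x.
Proof. by move=> If Ig fg; apply: le_Rintegral. Qed.

Lemma Rint_norm_le f g : measurable_fun setT f -> mu.-intg g ->
  (forall x, `|f x| <= g x) -> `|\int[mu]_x f x| <= \int[mu]_x g x.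
Proof.
move=> mf Ig fg; have If := intg_dominated mf Ig fg.
apply: le_trans (le_normr_Rintegral measurableT If) _.
by apply: Rint_le => //; exact: intg_norm.
Qed.

End integrability.

Section fubini.
Context d1 d2 (T1 : measurableType d1) (T2 : measurableType d2) (R : realType).
Variable m1 : {sigma_finite_measure set T1 -> \bar R}.
Variable m2 : {sigma_finite_measure set T2 -> \bar R}.
Local Notation m12 := (sigma_finite_prod m1 m2).
Implicit Type f : T1 * T2 -> R.

(** Every slice is asked to be integrable, not just almost every one: the real integral applies
    [fine], which sends infinite values to 0, and slicewise integrability makes this harmless. *)
Lemma Rintegral_prod12 f : m12.-intg f -> (forall x, m2.-intg (fun y => f (x, y))) ->
  \int[m12]_z f z = \int[m1]_x \int[m2]_y f (x, y).
Proof.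
move=> If If2; rewrite /Rintegral.
have <- := integral12_prod_meas1 If.
congr fine; apply: eq_integral => x _ /=.
by rewrite /fubini_F fineK//; exact: (integrable_fin_num _ (If2 x)).
Qed.

Lemma Rintegral_prod21 f : m12.-intg f -> (forall y, m1.-intg (fun x => f (x, y))) ->
  \int[m12]_z f z = \int[m2]_y \int[m1]_x f (x, y).
Proof.
move=> If If2; rewrite /Rintegral.
have <- := integral21_prod_meas1 If.
congr fine; apply: eq_integral => x _ /=.
by rewrite /fubini_G fineK//; exact: (integrable_fin_num _ (If2 x)).
Qed.

Lemma intg_prod12 f : measurable_fun setT f ->
  (forall x, m2.-intg (fun y => f (x, y))) ->
  m1.-intg (fun x => \int[m2]_y `|f (x, y)|) -> m12.-intg f.
Proof.
move=> mf If2 If1.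
have mEf : measurable_fun setT (EFin \o f) by exact/measurable_EFinP.
apply/(integrable12ltyP m1 m2 mEf).
have /integrableP[_] := If1; apply: le_lt_trans.
rewrite le_eqVlt; apply/orP; left; apply/eqP.
apply: eq_integral => x _ /=.
rewrite ger0_norm; last by apply: Rintegral_ge0.
by rewrite /Rintegral fineK//; apply: (integrable_fin_num _ (intg_norm (If2 x))).
Qed.

Lemma intg_prod21 f : measurable_fun setT f ->
  (forall y, m1.-intg (fun x => f (x, y))) ->
  m2.-intg (fun y => \int[m1]_x `|f (x, y)|) -> m12.-intg f.
Proof.
move=> mf If2 If1.
have mEf : measurable_fun setT (EFin \o f) by exact/measurable_EFinP.
apply/(integrable21ltyP m1 m2 mEf).
have /integrableP[_] := If1; apply: le_lt_trans.
rewrite le_eqVlt; apply/orP; left; apply/eqP.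
apply: eq_integral => x _ /=.
rewrite ger0_norm; last by apply: Rintegral_ge0.
by rewrite /Rintegral fineK//; apply: (integrable_fin_num _ (intg_norm (If2 x))).
Qed.

Lemma intg_tensor (f : T1 -> R) (g : T2 -> R) : m1.-intg f -> m2.-intg g ->
  m12.-intg (fun z => f z.1 * g z.2).
Proof.
move=> If Ig; apply: intg_prod12.
- apply: measurable_funM.
    by apply: (measurableT_comp (intg_measurable If)).
  by apply: (measurableT_comp (intg_measurable Ig)).
- by move=> x /=; exact: (intgZl (f x) Ig).
- have := intgZr (\int[m2]_y `|g y|) (intg_norm If).
  apply: eq_intg => x /=; under [RHS]eq_Rintegral do rewrite normrM.
  by rewrite RintegralZl//; exact: intg_norm.
Qed.

(** Tonelli gives measurability for nonnegative integrands, so [f] is split into its positive part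
    [(f + |f|)/2] and negative part [(|f| - f)/2]. *)
Lemma measurable_Rintegral2 f : measurable_fun setT f ->
  (forall x, m2.-intg (fun y => f (x, y))) ->
  measurable_fun setT (fun x => \int[m2]_y f (x, y)).
Proof.
move=> mf If.
have mpart (g : T1 * T2 -> R) : measurable_fun setT g -> (forall x, 0 <= g x) ->
    measurable_fun setT (fun x => \int[m2]_y g (x, y)).
  move=> mg g0.
  rewrite /Rintegral; apply: measurableT_comp => //.
  apply: (measurable_fun_fubini_tonelli_F (EFin \o g)) => //.
    exact/measurable_EFinP.
have mp : measurable_fun setT (fun z => (f z + `|f z|) / 2).
  by apply: measurable_funM => //; apply: measurable_funD => //; apply: measurableT_comp.
have mn : measurable_fun setT (fun z => (`|f z| - f z) / 2).
  by apply: measurable_funM => //; apply: measurable_funB => //; apply: measurableT_comp.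
rewrite (_ : (fun x => _) = (fun x => \int[m2]_y ((f (x, y) + `|f (x, y)|) / 2) -
   \int[m2]_y ((`|f (x, y)| - f (x, y)) / 2))); last first.
  apply/funext => x; rewrite -RintegralB//.
  - by apply: eq_Rintegral => y _; lra.
  - by apply: intgZr; apply: intgD => //; apply: intg_norm.
  - by apply: intgZr; apply: intgB => //; apply: intg_norm.
apply: measurable_funB; [apply: (mpart _ mp)|apply: (mpart _ mn)] => z.
- by have := ler_norm (- f z); rewrite normrN; lra.
- by have := ler_norm (f z); lra.
Qed.

Lemma intg_Rintegral2 f : m12.-intg f -> (forall x, m2.-intg (fun y => f (x, y))) ->
  m1.-intg (fun x => \int[m2]_y f (x, y)).
Proof.
move=> If If2; have := integrable_fubini_F If.
apply: eq_integrable => // x _ /=.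
by rewrite /Rintegral fineK//; exact: (integrable_fin_num _ (If2 x)).
Qed.

End fubini.

(** * Gaussians and their Fourier transforms *)

Section gauss1.
Context {R : realType}.
Local Notation mR := (measurableTypeR R).
Definition L1 : {sigma_finite_measure set mR -> \bar R} := lebesgue_measure.

Definition gauss1 (a v x : R) : R := expR (- (a * (x - v) ^+ 2)).

Lemma gauss1_ge0 a v x : 0 <= gauss1 a v x. Proof. exact: expR_ge0. Qed.

Lemma measurable_gauss1 a v : measurable_fun setT (gauss1 a v).
Proof.
apply: measurableT_comp => //; apply: measurableT_comp => //.
by apply: measurable_funM => //; apply: measurable_funX; apply: measurable_funB.
Qed.

(** A multiple of the normal density of variance [1/(2a)]; integrability and total mass are imported
    through this identity. *)
Lemma gauss1_normal (a v : R) : 0 < a -> gauss1 a v =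
  (fun x => Num.sqrt (pi / a) * normal_pdf v (Num.sqrt (2 * a)^-1) x).
Proof.
move=> a0; apply/funext => x.
have a20 : 0 < (2 * a)^-1 by rewrite invr_gt0 mulr_gt0.
rewrite normal_pdfE; last by rewrite gt_eqF// sqrtr_gt0.
rewrite /normal_peak /normal_fun sqr_sqrtr ?ltW// mulrA.
have -> : (2 * a)^-1 * pi *+ 2 = pi / a by field; rewrite gt_eqF.
rewrite divff ?mul1r; last by rewrite gt_eqF// sqrtr_gt0 divr_gt0 ?pi_gt0.
by rewrite /gauss1; congr expR; field; rewrite gt_eqF.
Qed.

Lemma intg_gauss1 a v : 0 < a -> L1.-intg (gauss1 a v).
Proof.
move=> a0; rewrite gauss1_normal//; apply: intgZl.
exact: integrable_normal_pdf.
Qed.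

Lemma Rintegral_gauss1 a v : 0 < a ->
  \int[L1]_x gauss1 a v x = Num.sqrt (pi / a).
Proof.
move=> a0; rewrite gauss1_normal// RintegralZl//; last first.
  exact: integrable_normal_pdf.
by rewrite /Rintegral integral_normal_pdf/= mulr1.
Qed.

Lemma intg_gauss1M (a v : R) (f : R -> R) : 0 < a -> measurable_fun setT f ->
  (forall x : R, `|f x| <= 1) -> L1.-intg (fun x => gauss1 a v x * f x).
Proof.
move=> a0 mf f1; apply: (intg_dominated _ (intg_gauss1 v a0)).
  by apply: measurable_funM => //; exact: measurable_gauss1.
by move=> x; rewrite normrM ger0_norm ?gauss1_ge0// ler_piMr ?gauss1_ge0.
Qed.

(** On [[-(n+1), n+1]] the integral of [f] is a difference of boundary values of [F], which is
    [O(1/n)]; dominated convergence lets the interval exhaust the line. *)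
Lemma Rintegral_derive0 (F f : R -> R) (K : R) :
  (forall x : R, is_derive x 1 F (f x)) -> continuous f -> L1.-intg f ->
  (forall n, `|F n.+1%:R| <= K / n.+1%:R) ->
  (forall n, `|F (- n.+1%:R)| <= K / n.+1%:R) ->
  \int[L1]_x f x = 0.
Proof.
move=> dF cf If FK FNK.
have FTC n : (\int[L1]_(x in `[(- n.+1%:R)%R, n.+1%:R]) (f x)%:E)%E =
    ((F n.+1%:R)%:E - (F (- n.+1%:R))%:E)%E.
  apply: continuous_FTC2.
  - by rewrite (@lt_trans _ _ 0)// ?oppr_lt0 ltr0n.
  - exact: continuous_subspaceT.
  - split.
    + by move=> x _; have [] := dF x.
    + apply: cvg_at_right_filter; apply: differentiable_continuous.
      by apply/derivable1_diffP; have [] := dF (- n.+1%:R).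
    + apply: cvg_at_left_filter; apply: differentiable_continuous.
      by apply/derivable1_diffP; have [] := dF n.+1%:R.
  - by move=> x _; rewrite derive1E; have [_ ->] := dF x.
pose f_ n : R -> \bar R := (EFin \o f) \_ `[(- n.+1%:R)%R, n.+1%:R].
have mf : measurable_fun setT (EFin \o f) by apply/measurable_EFinP; apply: intg_measurable If.
have [|||||_ _ ] := @dominated_convergence _ _ _ L1 setT measurableT f_ (EFin \o f) (EFin \o (fun x => `|f x|)).
- move=> n; apply/(measurable_restrictT _ _).1 => //.
  by apply: measurable_funTS.
- exact: mf.
- apply: aeW => x _.
  apply: cvg_near_cst.
  near=> n.
  rewrite /f_ patchE mem_set//=.
  rewrite in_itv/= -ler_norml.
  have : `|x| <= n%:R by near: n; exact: nbhs_infty_ger.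
  by move=> /le_trans; apply; rewrite ler_nat.
- exact: intg_norm.
- apply: aeW => x n _; rewrite /f_ patchE; case: ifP => _ //=.
  by rewrite normr0 lee_fin.
have -> : (fun n => \int[L1]_(x in [set: R]) f_ n x)%E = EFin \o (fun n => F n.+1%:R - F (- n.+1%:R)).
  apply/funext => n /=; rewrite -integral_mkcond FTC. by rewrite -EFinB.
have Fcvg : (fun n => F n.+1%:R - F (- n.+1%:R)) @ \oo --> (0 : R).
  have Kcvg : (fun n => 2 * K * harmonic n) @ \oo --> (0 : R).
    rewrite -[X in _ --> X](mulr0 (2 * K)); apply: cvgMr; exact: cvg_harmonic.
  apply: norm_cvg0; apply: (squeeze_cvgr _ (cvg_cst 0) Kcvg).
  apply: nearW => n; rewrite normr_ge0/=.
  apply: le_trans (ler_normB _ _) _.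
  have -> : 2 * K * harmonic n = K / n.+1%:R + K / n.+1%:R by rewrite /harmonic/=; ring.
  exact: lerD.
move=> /cvg_lim cvgI; rewrite /Rintegral -[(\int[L1]_x _)%E]cvgI//.
have /cvg_lim -> // : (EFin \o (fun n => F n.+1%:R - F (- n.+1%:R))) @ \oo --> 0%:E.
by apply: cvg_EFin => //; apply: nearW.
Unshelve. all: end_near. Qed.
End gauss1.

Section gauss1_fourier.
Context {R : realType}.
Local Notation L1 := (@L1 R).

Lemma expRN_le (x : R) : 0 <= x -> expR (- x) <= (1 + x)^-1.
Proof.
move=> x0; rewrite expRN lef_pV2 ?expR_ge1Dx// posrE ?expR_gt0//.
by rewrite ltr_pwDl.
Qed.

(** Half of the exponent absorbs the linear factor, through [e^(-h) <= 1/(1 + h)]. The bound is free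
    of the frequency and so dominates the derivative of the cosine transform. *)
Lemma abs_gauss1_le (a v x : R) : 0 < a ->
  `|x - v| * gauss1 a v x <= (1 + 2 / a) * gauss1 (a / 2) v x.
Proof.
move=> a0; set y := x - v.
have -> : gauss1 a v x = gauss1 (a / 2) v x * gauss1 (a / 2) v x.
  by rewrite /gauss1 -expRD; congr expR; field.
rewrite mulrA ler_pM2r ?expR_gt0//.
have h : 0 <= a / 2 * y ^+ 2 by rewrite mulr_ge0 ?sqr_ge0// divr_ge0// ltW.
apply: (@le_trans _ _ (`|y| * (1 + a / 2 * y ^+ 2)^-1)).
  by rewrite ler_wpM2l// expRN_le.
rewrite ler_pdivrMr ?ltr_pwDl//.
have -> : y ^+ 2 = `|y| ^+ 2 by rewrite real_normK// num_real.
set z := `|y|.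
have z0 : 0 <= z by exact: normr_ge0.
have -> : (1 + 2 / a) * (1 + a / 2 * z ^+ 2) = 1 + z ^+ 2 + 2 / a + a / 2 * z ^+ 2.
  by field; rewrite gt_eqF.
have : 0 <= 2 / a by rewrite divr_ge0 ?ltW.
have : 0 <= a / 2 * z ^+ 2 by rewrite mulr_ge0 ?sqr_ge0// divr_ge0// ltW.
have := sqr_ge0 (z - 1/2); rewrite sqrrB; nra.
Qed.

Lemma intg_absM_gauss1 (a v : R) (f : R -> R) : 0 < a -> measurable_fun setT f ->
  (forall x : R, `|f x| <= 1) -> L1.-intg (fun x => (x - v) * gauss1 a v x * f x).
Proof.
move=> a0 mf f1.
have a20 : 0 < a / 2 by rewrite divr_gt0.
apply: (intg_dominated _ (intgZl (1 + 2 / a) (intg_gauss1 v a20))).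
  apply: measurable_funM => //; apply: measurable_funM; last exact: measurable_gauss1.
  exact: measurable_funB.
move=> x; rewrite !normrM (ger0_norm (gauss1_ge0 _ _ _)).
apply: le_trans (abs_gauss1_le v x a0).
by rewrite ler_piMr ?mulr_ge0 ?gauss1_ge0.
Qed.

Lemma cos_norm_le1 (x : R) : `|cos x| <= 1.
Proof. by rewrite ler_norml cos_geN1 cos_le1. Qed.
Lemma sin_norm_le1 (x : R) : `|sin x| <= 1.
Proof. by rewrite ler_norml sin_geN1 sin_le1. Qed.

Variables (a v : R).
Hypothesis a0 : 0 < a.

(** The phase [c] covers sine and cosine together, and lets the three-dimensional transform be
    computed one coordinate at a time, the other coordinates being stored in the phase. *)
Let J c xi := \int[L1]_x (gauss1 a v x * cos ((x - v) * xi + c)).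
Let K c xi := \int[L1]_x ((x - v) * gauss1 a v x * sin ((x - v) * xi + c)).

Let mlin xi c : measurable_fun setT (fun x : R => (x - v) * xi + c).
Proof. by apply: measurable_funD => //; apply: measurable_funM => //; exact: measurable_funB. Qed.

Let mcos xi c : measurable_fun setT (fun x : R => cos ((x - v) * xi + c)).
Proof. apply: measurableT_comp => //. apply: continuous_measurable_fun. exact: continuous_cos. Qed.

Let msin xi c : measurable_fun setT (fun x : R => sin ((x - v) * xi + c)).
Proof. apply: measurableT_comp => //. apply: continuous_measurable_fun. exact: continuous_sin. Qed.

Let dcos (x xi c : R) : is_derive xi 1 (fun xi : R => gauss1 a v x * cos ((x - v) * xi + c))
   (- ((x - v) * gauss1 a v x * sin ((x - v) * xi + c))).
Proof.
by apply: is_derive_eq; rewrite /GRing.scale/=; ring.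
Qed.

Let intgJ c xi : L1.-intg (fun x : R => gauss1 a v x * cos ((x - v) * xi + c)).
Proof. by apply: intg_gauss1M => // x; exact: cos_norm_le1. Qed.

Let intgK c xi : L1.-intg (fun x : R => (x - v) * gauss1 a v x * sin ((x - v) * xi + c)).
Proof. by apply: intg_absM_gauss1 => // x; exact: sin_norm_le1. Qed.

Let derivJ c (xi : R) : is_derive xi 1 (J c) (- K c xi).
Proof.
pose f (xi x : R) := gauss1 a v x * cos ((x - v) * xi + c).
have d1 (x y : R) : partial1of2 f x y = - ((y - v) * gauss1 a v y * sin ((y - v) * x + c)).
  by rewrite /partial1of2 derive1E; have [_ ->] := dcos y x c.
have Ixi : `]xi - 1, xi + 1[%classic xi by rewrite /= in_itv/=; apply/andP; split; lra.
have a20 : 0 < a / 2 by rewrite divr_gt0.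
have If (x : R) : `]xi - 1, xi + 1[%classic x -> L1.-integrable setT (EFin \o f x).
  by move=> _; exact: intgJ.
have df (x : R) (y : R) : `]xi - 1, xi + 1[%classic x -> [set: R] y -> derivable (f ^~ y) x 1.
  by move=> _ _; have [] := dcos y x c.
have G0 y : 0 <= (1 + 2 / a) * gauss1 (a / 2) v y.
  by rewrite mulr_ge0 ?gauss1_ge0// addr_ge0// divr_ge0// ltW.
have IG := intgZl (1 + 2 / a) (intg_gauss1 v a20).
have Gub (x y : R) : `]xi - 1, xi + 1[%classic x -> [set: R] y ->
    `|partial1of2 f x y| <= (1 + 2 / a) * gauss1 (a / 2) v y.
  move=> _ _; rewrite d1 normrN !normrM (ger0_norm (gauss1_ge0 _ _ _)).
  apply: le_trans (abs_gauss1_le v y a0).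
  by rewrite ler_piMr ?mulr_ge0 ?gauss1_ge0// sin_norm_le1.
have D := @derivable_under_integral _ _ _ L1 f setT measurableT xi (xi - 1) (xi + 1) Ixi If df _ G0 IG Gub.
have E := @differentiation_under_integral _ _ _ L1 f setT measurableT xi (xi - 1) (xi + 1) Ixi If df _ G0 IG Gub.
split; first exact: D.
rewrite -derive1E; etransitivity; first exact: E.
under eq_Rintegral do rewrite d1 -mulN1r.
by rewrite RintegralZl//= mulN1r.
Qed.

Let by_parts c (xi : R) : 2 * a * K c xi = xi * J c xi.
Proof.
pose F (x : R) := gauss1 a v x * sin ((x - v) * xi + c).
pose f (x : R) := xi * (gauss1 a v x * cos ((x - v) * xi + c)) -
  (2 * a) * ((x - v) * gauss1 a v x * sin ((x - v) * xi + c)).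
have dF (x : R) : is_derive x 1 F (f x).
  rewrite /F /gauss1; apply: is_derive_eq; rewrite /f /gauss1 /GRing.scale/=.
  by rewrite expr2; ring.
have cg : continuous (gauss1 a v).
  move=> x; apply: differentiable_continuous; apply/derivable1_diffP.
  rewrite /gauss1; exact: ex_derive.
have cf : continuous f.
  move=> x; apply: differentiable_continuous; apply/derivable1_diffP.
  rewrite /f /gauss1; exact: ex_derive.
have If : L1.-intg f by apply: intgB; apply: intgZl.
have gle n (y : R) : `|y| = n.+1%:R -> `|F y| <= expR (a * v ^+ 2) * (2 / a) / n.+1%:R.
  move=> yn.
  have y1 : 1 <= `|y| by rewrite yn ler1n.
  apply: (@le_trans _ _ (gauss1 a v y)).
    by rewrite normrM ger0_norm ?gauss1_ge0// ler_piMr ?gauss1_ge0// sin_norm_le1.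
  (* This is [(y - v)^2 >= y^2/2 - v^2]; the difference of the two sides is [(y - 2v)^2/2]. *)
  apply: (@le_trans _ _ (expR (a * v ^+ 2) * expR (- (a / 2 * `|y| ^+ 2)))).
    rewrite -expRD /gauss1 ler_expR real_normK ?num_real//.
    have : 0 <= a * (y - 2 * v) ^+ 2 by rewrite mulr_ge0 ?sqr_ge0// ltW.
    by rewrite !sqrrB; lra.
  rewrite -(mulrA (expR (a * v ^+ 2))) ler_wpM2l ?expR_ge0// -yn.
  have h : 0 <= a / 2 * `|y| ^+ 2 by rewrite mulr_ge0 ?sqr_ge0// divr_ge0// ltW.
  apply: le_trans (expRN_le h) _.
  have y0 : 0 < `|y| by apply: lt_le_trans y1.
  have -> : 2 / a / `|y| = (a / 2 * `|y|)^-1 by field; rewrite !gt_eqF.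
  rewrite lef_pV2 ?posrE ?mulr_gt0 ?ltr_pwDl ?divr_gt0//.
  have : a / 2 * `|y| <= a / 2 * `|y| ^+ 2.
    by rewrite ler_pM2l ?divr_gt0// expr2 ler_peMl.
  lra.
have := @Rintegral_derive0 _ F f (expR (a * v ^+ 2) * (2 / a)) dF cf If.
have -> : \int[L1]_x f x = xi * J c xi - 2 * a * K c xi.
  by rewrite /f RintegralB ?RintegralZl//; apply: intgZl.
move=> H; apply/esym/eqP; rewrite -subr_eq0; apply/eqP/H => n; apply: gle.
  by rewrite ger0_norm.
by rewrite normrN ger0_norm.
Qed.

(** Differentiation under the integral gives [J' = -K] and integration by parts gives [2aK = xi J].
    Hence [J] solves [J' = -(xi/(2a)) J], and its product with [exp(xi^2/(4a))] is constant. *)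
Let J_eq c xi : J c xi = Num.sqrt (pi / a) * expR (- (xi ^+ 2 / (4 * a))) * cos c.
Proof.
pose H (xi : R) := J c xi * expR (xi ^+ 2 / (4 * a)).
have dH (x : R) : is_derive x 1 H 0.
  rewrite /H; have := derivJ c x => dJ; apply: is_derive_eq.
  have := by_parts c x => bp.
  have -> : K c x = x * J c x / (2 * a) by rewrite -bp; field; rewrite gt_eqF.
  by rewrite /GRing.scale/=; field; rewrite gt_eqF.
have H0 : H 0 = Num.sqrt (pi / a) * cos c.
  rewrite /H expr0n mul0r expR0 mulr1 /J.
  under eq_Rintegral do rewrite mulr0 add0r mulrC.
  rewrite RintegralZl//; last exact: intg_gauss1.
  by rewrite Rintegral_gauss1// mulrC.
have : H xi = H 0 by exact: is_derive_0_is_cst.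
rewrite H0 /H => /(congr1 (fun z => z * expR (- (xi ^+ 2 / (4 * a))))).
rewrite /= -(mulrA (J c xi)) -expRD subrr expR0 mulr1 => ->.
by rewrite mulrAC.
Qed.

Lemma intg_gauss1_cos xi c : L1.-intg (fun x : R => gauss1 a v x * cos (x * xi + c)).
Proof.
have := intgJ (v * xi + c) xi; apply: eq_intg => x.
by congr (_ * cos _); ring.
Qed.

Lemma Rintegral_gauss1_cos xi c :
  \int[L1]_x (gauss1 a v x * cos (x * xi + c)) =
  Num.sqrt (pi / a) * expR (- (xi ^+ 2 / (4 * a))) * cos (v * xi + c).
Proof.
rewrite -J_eq; apply: eq_Rintegral => x _.
by congr (_ * cos _); ring.
Qed.

End gauss1_fourier.

Section gauss3.
Context {R : realType}.
Local Notation L1 := (@L1 R).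
Definition L2 := sigma_finite_prod L1 L1.
Definition L3 := sigma_finite_prod L2 L1.

Definition gauss3 (a : R) (v x : space3 R) : R :=
  gauss1 a v.1.1 x.1.1 * gauss1 a v.1.2 x.1.2 * gauss1 a v.2 x.2.

Lemma gauss3_ge0 a v x : 0 <= gauss3 a v x.
Proof. by rewrite !mulr_ge0 ?gauss1_ge0. Qed.

Lemma gauss3E (a : R) (v x : space3 R) :
  gauss3 a v x = expR (- (a * dot3 (x - v) (x - v))).
Proof.
by rewrite /gauss3 /gauss1 -!expRD; congr expR; rewrite /dot3/=; ring.
Qed.

Lemma intg_gauss3 a v : 0 < a -> L3.-intg (gauss3 a v).
Proof.
move=> a0; apply: (@intg_tensor _ _ _ _ _ L2 L1 (fun z : R * R => gauss1 a v.1.1 z.1 * gauss1 a v.1.2 z.2)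
   (gauss1 a v.2)); last exact: intg_gauss1.
apply: (@intg_tensor _ _ _ _ _ L1 L1); exact: intg_gauss1.
Qed.

Lemma intg_gauss3M (a : R) v (f : space3 R -> R) : 0 < a -> measurable_fun setT f ->
  (forall x, `|f x| <= 1) -> L3.-intg (fun x => gauss3 a v x * f x).
Proof.
move=> a0 mf f1; apply: (intg_dominated _ (intg_gauss3 v a0)).
  by apply: measurable_funM => //; exact: intg_measurable (intg_gauss3 v a0).
by move=> x; rewrite normrM ger0_norm ?gauss3_ge0// ler_piMr ?gauss3_ge0.
Qed.

Lemma measurable_dot3 (xi : space3 R) : measurable_fun setT (fun x : space3 R => dot3 x xi).
Proof.
rewrite /dot3; apply: measurable_funD; last first.
  by apply: measurable_funM => //; exact: measurable_snd.
apply: measurable_funD; apply: measurable_funM => //.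
  by apply: (measurableT_comp measurable_fst measurable_fst).
by apply: (measurableT_comp measurable_snd measurable_fst).
Qed.

Lemma intg_gauss3_cos a v xi c : 0 < a ->
  L3.-intg (fun x => gauss3 a v x * cos (dot3 x xi + c)).
Proof.
move=> a0; apply: intg_gauss3M => // [|x]; last exact: cos_norm_le1.
apply: measurableT_comp; first by apply: continuous_measurable_fun; exact: continuous_cos.
by apply: measurable_funD => //; exact: measurable_dot3.
Qed.

Lemma Rintegral_gauss3_cos a v xi c : 0 < a ->
  \int[L3]_x (gauss3 a v x * cos (dot3 x xi + c)) =
  Num.sqrt (pi / a) ^+ 3 * gauss3 (4 * a)^-1 0 xi * cos (dot3 v xi + c).
Proof.
move=> a0.
have m3 (z : R * R) : L1.-intg (fun y => gauss3 a v (z, y) * cos (dot3 (z, y) xi + c)).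
  have := intgZl (gauss1 a v.1.1 z.1 * gauss1 a v.1.2 z.2)
     (intg_gauss1_cos v.2 a0 xi.2 (z.1 * xi.1.1 + z.2 * xi.1.2 + c)).
  by apply: eq_intg => y; rewrite /gauss3/= -!mulrA; congr (_ * (_ * (_ * cos _))); rewrite /dot3/=; ring.
rewrite (@Rintegral_prod12 _ _ _ _ _ L2 L1)//; last exact: intg_gauss3_cos.
pose G := fun xi : R => expR (- (xi ^+ 2 / (4 * a))).
pose S := Num.sqrt (pi / a).
have GE x : G x = gauss1 (4 * a)^-1 0 x by rewrite /G /gauss1 subr0 mulrC.
transitivity (\int[L2]_z ((S * G xi.2) * (gauss1 a v.1.1 z.1 * gauss1 a v.1.2 z.2 *
     cos (z.1 * xi.1.1 + z.2 * xi.1.2 + (v.2 * xi.2 + c))))).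
  apply: eq_Rintegral => z _.
  rewrite (_ : (fun y => _) = (fun y => gauss1 a v.1.1 z.1 * gauss1 a v.1.2 z.2 *
     (gauss1 a v.2 y * cos (y * xi.2 + (z.1 * xi.1.1 + z.2 * xi.1.2 + c))))); last first.
    by apply/funext => y; rewrite /gauss3/= -!mulrA; congr (_ * (_ * (_ * cos _))); rewrite /dot3/=; ring.
  rewrite RintegralZl//; last exact: intg_gauss1_cos.
  rewrite Rintegral_gauss1_cos//.
  rewrite -/(G xi.2) -/S (_ : v.2 * xi.2 + (z.1 * xi.1.1 + z.2 * xi.1.2 + c) =
    z.1 * xi.1.1 + z.2 * xi.1.2 + (v.2 * xi.2 + c)); last by ring.
  by ring.
have m2 (x c' : R) : L1.-intg (fun y => gauss1 a v.1.1 x * gauss1 a v.1.2 y * cos (x * xi.1.1 + y * xi.1.2 + c')).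
  have := intgZl (gauss1 a v.1.1 x)
     (intg_gauss1_cos v.1.2 a0 xi.1.2 (x * xi.1.1 + c')).
  by apply: eq_intg => y; rewrite -!mulrA; congr (_ * (_ * cos _)); ring.
have mm2 c' : L2.-intg (fun z : R * R => gauss1 a v.1.1 z.1 * gauss1 a v.1.2 z.2 *
     cos (z.1 * xi.1.1 + z.2 * xi.1.2 + c')).
  have I2 : L2.-intg (fun z : R * R => gauss1 a v.1.1 z.1 * gauss1 a v.1.2 z.2).
    apply: (@intg_tensor _ _ _ _ _ L1 L1); exact: intg_gauss1.
  apply: (intg_dominated _ I2).
    apply: measurable_funM; first exact: intg_measurable I2.
    apply: measurableT_comp; first by apply: continuous_measurable_fun; exact: continuous_cos.
    by do 2 (apply: measurable_funD => //); apply: measurable_funM => //.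
  move=> z; rewrite normrM ger0_norm ?mulr_ge0 ?gauss1_ge0//.
  by rewrite ler_piMr ?cos_norm_le1// mulr_ge0 ?gauss1_ge0.
rewrite RintegralZl//.
rewrite (@Rintegral_prod12 _ _ _ _ _ L1 L1); [|exact: mm2|by move=> x; exact: m2].
transitivity (S * G xi.2 * \int[L1]_x ((S * G xi.1.2) * (gauss1 a v.1.1 x * cos (x * xi.1.1 + (v.1.2 * xi.1.2 + (v.2 * xi.2 + c)))))).
  congr (_ * _); apply: eq_Rintegral => x _ /=.
  rewrite (_ : (fun y => _) = (fun y => gauss1 a v.1.1 x *
     (gauss1 a v.1.2 y * cos (y * xi.1.2 + (x * xi.1.1 + (v.2 * xi.2 + c)))))); last first.
    by apply/funext => y; rewrite -!mulrA; congr (_ * (_ * cos _)); ring.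
  rewrite RintegralZl//; last exact: intg_gauss1_cos.
  rewrite Rintegral_gauss1_cos//.
  rewrite -/(G xi.1.2) -/S (_ : v.1.2 * xi.1.2 + (x * xi.1.1 + (v.2 * xi.2 + c)) =
    x * xi.1.1 + (v.1.2 * xi.1.2 + (v.2 * xi.2 + c))); last by ring.
  by ring.
rewrite RintegralZl//; last exact: intg_gauss1_cos.
rewrite Rintegral_gauss1_cos// -/S /gauss3/= -!GE.
rewrite (_ : v.1.1 * _ + _ = dot3 v xi + c); last by rewrite /dot3; ring.
by rewrite /G; ring.
Qed.

Lemma Rintegral_gauss3 a v : 0 < a ->
  \int[L3]_x gauss3 a v x = Num.sqrt (pi / a) ^+ 3.
Proof.
move=> a0; have := @Rintegral_gauss3_cos a v 0 0 a0.
have d0 x : dot3 x 0 + 0 = 0 :> R by rewrite /dot3/= !mulr0 !addr0.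
rewrite d0 cos0 mulr1 (_ : gauss3 _ 0 0 = 1) ?mulr1 => [<-|]; last first.
  by rewrite gauss3E subrr (_ : dot3 0 0 = 0) ?mulr0 ?oppr0 ?expR0// /dot3/= !mulr0 !addr0.
by apply: eq_Rintegral => x _; rewrite d0 cos0 mulr1.
Qed.

(** [L3] only repackages Lebesgue measure, so the two integrals are convertible. *)
Lemma Rintegral_leb3 (f : space3 R -> R) : \int[leb3 R]_x f x = \int[L3]_x f x.
Proof. by []. Qed.

End gauss3.

(** * Superpositions of wave packets *)

Section packets.
Context {R : realType}.
Local Notation L3 := (@L3 R).

Lemma dot3C (x y : space3 R) : dot3 x y = dot3 y x.
Proof. by rewrite /dot3; ring. Qed.

Lemma dot3_ge0 (x : space3 R) : 0 <= dot3 x x.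
Proof. by rewrite /dot3 -!expr2 !addr_ge0 ?sqr_ge0. Qed.

Lemma measurable_cosT : measurable_fun setT (@cos R).
Proof. by apply: continuous_measurable_fun; exact: continuous_cos. Qed.

Definition packet (a l : R) (x : space3 R) : R := gauss3 a 0 x * cos (l * x.2).

(** The Fourier transform of the packet, real because the packet is even: the modulation splits one
    Gaussian into bumps at [l e_3] and [-l e_3], of width of order [a^(1/2)]. *)
Definition packet_hat (a l : R) (xi : space3 R) : R :=
  Num.sqrt (pi / a) ^+ 3 *
  ((gauss3 (4 * a)^-1 (0, 0, l) xi + gauss3 (4 * a)^-1 (0, 0, - l) xi) / 2).

Lemma gauss3_shift a (v w x : space3 R) : gauss3 a v (x - w) = gauss3 a (v + w) x.
Proof. by rewrite !gauss3E; congr (expR (- (_ * _))); rewrite /dot3/=; ring. Qed.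

Lemma packet_shift a l (v x : space3 R) :
  packet a l (x - v) = gauss3 a v x * cos (l * x.2 - l * v.2).
Proof. by rewrite /packet gauss3_shift add0r/= mulrBr. Qed.

Lemma packet_le a l x : `|packet a l x| <= gauss3 a 0 x.
Proof.
by rewrite normrM ger0_norm ?gauss3_ge0// ler_piMr ?gauss3_ge0// cos_norm_le1.
Qed.

Lemma packet_prod a l (v xi : space3 R) c x :
  packet a l (x - v) * cos (dot3 x xi + c) =
  2^-1 * (gauss3 a v x * cos (dot3 x (xi + (0, 0, l)) + (c - l * v.2))) +
  2^-1 * (gauss3 a v x * cos (dot3 x (xi - (0, 0, l)) + (c + l * v.2))).
Proof.
rewrite packet_shift.
rewrite (_ : dot3 x (xi + _) + _ = (dot3 x xi + c) + (l * x.2 - l * v.2)); last first.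
  by rewrite /dot3/=; ring.
rewrite (_ : dot3 x (xi - _) + _ = (dot3 x xi + c) - (l * x.2 - l * v.2)); last first.
  by rewrite /dot3/=; ring.
set A := dot3 x xi + c; set B := l * x.2 - l * v.2.
by rewrite cosB cosD; field.
Qed.

Lemma intg_packet_cos a l v xi c : 0 < a ->
  L3.-intg (fun x => packet a l (x - v) * cos (dot3 x xi + c)).
Proof.
move=> a0.
have := intgD (intgZl 2^-1 (intg_gauss3_cos v (xi + (0, 0, l)) (c - l * v.2) a0))
  (intgZl 2^-1 (intg_gauss3_cos v (xi - (0, 0, l)) (c + l * v.2) a0)).
by apply: eq_intg => x; rewrite packet_prod.
Qed.

Lemma Rintegral_packet_cos a l v xi c : 0 < a ->
  \int[L3]_x (packet a l (x - v) * cos (dot3 x xi + c)) =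
  packet_hat a l xi * cos (dot3 v xi + c).
Proof.
move=> a0; under eq_Rintegral do rewrite packet_prod.
rewrite RintegralD//; [|by apply: intgZl; exact: intg_gauss3_cos..].
rewrite !RintegralZl//; [|exact: intg_gauss3_cos..].
rewrite !Rintegral_gauss3_cos//.
rewrite (_ : dot3 v (xi + _) + _ = dot3 v xi + c); last by rewrite /dot3/=; ring.
rewrite (_ : dot3 v (xi - _) + _ = dot3 v xi + c); last by rewrite /dot3/=; ring.
rewrite /packet_hat.
have -> : gauss3 (4 * a)^-1 0 (xi + (0, 0, l)) = gauss3 (4 * a)^-1 (0, 0, - l) xi.
  rewrite -[l in LHS]opprK (_ : (0, 0, - - l) = - (0, 0, - l) :> space3 R).
    by rewrite gauss3_shift add0r.
  by rewrite -[RHS]/(- 0, - 0, - - l) !oppr0.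
by rewrite gauss3_shift add0r; field.
Qed.

Lemma intg_packet a l v : 0 < a -> L3.-intg (fun x => packet a l (x - v)).
Proof.
move=> a0; have := @intg_packet_cos a l v 0 0 a0; apply: eq_intg => x.
by rewrite (_ : dot3 x 0 + 0 = 0) ?cos0 ?mulr1// /dot3/= !mulr0 !addr0.
Qed.

Section superposition.
Context d (V : measurableType d) (mu : {sigma_finite_measure set V -> \bar R}).
Variables (k : V -> R) (Psi : V -> space3 R) (a l : R).
Hypotheses (Ik : mu.-intg k) (mPsi : measurable_fun setT Psi) (a0 : 0 < a).

(** The parameter space is kept abstract because three superpositions occur: the torus average of
    one packet, the smoothed torus, and the torus average of the latter, indexed by pairs of
    points. *)
Definition superpos (x : space3 R) := \int[mu]_v (k v * packet a l (x - Psi v)).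
(** The cosine part of the Fourier transform of the image of [k mu] under [Psi]; pairings with even
    functions of the frequency see nothing else. *)
Definition multiplier (xi : space3 R) := \int[mu]_v (k v * cos (dot3 (Psi v) xi)).

Let mPsiZ : measurable_fun setT (fun z : space3 R * V => Psi z.2).
Proof. exact: (measurableT_comp mPsi measurable_snd). Qed.

Let mgauss : measurable_fun setT (fun z : space3 R * V => gauss3 a (Psi z.2) z.1).
Proof.
rewrite /gauss3 /gauss1.
apply: measurable_funM; [apply: measurable_funM|];
  (apply: measurableT_comp => //; apply: measurableT_comp => //;
  apply: measurable_funM => //; apply: measurable_funX; apply: measurable_funB);
  repeat first [exact: mPsiZ | exact: measurable_fst | apply: (measurableT_comp measurable_fst) |
  apply: (measurableT_comp measurable_snd)].
Qed.

Let mpacket : measurable_fun setT (fun z : space3 R * V => packet a l (z.1 - Psi z.2)).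
Proof.
under eq_fun do rewrite packet_shift.
apply: measurable_funM => //; apply: (measurableT_comp measurable_cosT).
apply: measurable_funB; apply: measurable_funM => //.
  by apply: (measurableT_comp measurable_snd).
exact: (measurableT_comp measurable_snd mPsiZ).
Qed.

Let mk : measurable_fun setT k := intg_measurable Ik.

Let intg_joint : (sigma_finite_prod L3 mu).-intg (fun z => `|k z.2| * gauss3 a (Psi z.2) z.1).
Proof.
apply: intg_prod21.
- apply: measurable_funM => //; apply: measurableT_comp => //.
  exact: (measurableT_comp mk).
- by move=> v /=; apply: intgZl; exact: intg_gauss3.
- have := intgZr (Num.sqrt (pi / a) ^+ 3) (intg_norm Ik).
  apply: eq_intg => v /=.
  under [RHS]eq_Rintegral do rewrite normrM normr_id (ger0_norm (gauss3_ge0 _ _ _)).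
  by rewrite RintegralZl//; [rewrite Rintegral_gauss3|exact: intg_gauss3].
Qed.

Let intg_v x : mu.-intg (fun v => k v * packet a l (x - Psi v)).
Proof.
have c : mu.-intg (fun v => `|k v|) by exact: intg_norm.
apply: (intg_dominated _ c).
  apply: measurable_funM => //.
  have mp1 : measurable_fun setT (fun v : V => (x, v)) by exact: pair1_measurable.
  exact: (measurableT_comp mpacket mp1).
move=> v; rewrite normrM ler_piMr//.
apply: le_trans (packet_le _ _ _) _.
by rewrite gauss3E -[leRHS]expR0 ler_expR oppr_le0 mulr_ge0 ?dot3_ge0 ?ltW.
Qed.

Let gauss3_ge_packet z : `|packet a l (z.1 - Psi z.2)| <= gauss3 a (Psi z.2) z.1.
Proof. by apply: le_trans (packet_le _ _ _) _; rewrite gauss3_shift add0r. Qed.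

Let intg_f : (sigma_finite_prod L3 mu).-intg (fun z => k z.2 * packet a l (z.1 - Psi z.2)).
Proof.
apply: (intg_dominated _ intg_joint).
  by apply: measurable_funM => //; exact: (measurableT_comp mk).
by move=> z; rewrite normrM ler_wpM2l.
Qed.

Lemma intg_superpos : L3.-intg superpos.
Proof. exact: (@intg_Rintegral2 _ _ _ _ _ L3 mu _ intg_f). Qed.

Lemma superpos_fourier xi :
  \int[L3]_x (superpos x * cos (dot3 x xi)) = packet_hat a l xi * multiplier xi.
Proof.
pose F (z : space3 R * V) := k z.2 * packet a l (z.1 - Psi z.2) * cos (dot3 z.1 xi).
have mc : measurable_fun setT (fun z : space3 R * V => cos (dot3 z.1 xi)).
  by apply: (measurableT_comp measurable_cosT); exact: (measurableT_comp (measurable_dot3 xi)).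
have IF : (sigma_finite_prod L3 mu).-intg F.
  apply: (intg_dominated _ (intg_norm intg_f)).
    apply: measurable_funM => //; exact: intg_measurable intg_f.
  by move=> z; rewrite [leLHS]normrM ler_piMr// cos_norm_le1.
have e0 x : dot3 x xi = dot3 x xi + 0 by rewrite addr0.
transitivity (\int[sigma_finite_prod L3 mu]_z F z).
  rewrite Rintegral_prod12//; last first.
    by move=> x; exact: (intgZr (cos (dot3 x xi)) (intg_v x)).
  by apply: eq_Rintegral => x _; rewrite -RintegralZr.
have IFx v : L3.-intg (fun x => F (x, v)).
  have := intgZl (k v) (intg_packet_cos l (Psi v) xi 0 a0).
  by apply: eq_intg => x; rewrite /F/= mulrA addr0.
rewrite Rintegral_prod21// /multiplier -RintegralZl//; last first.
  apply: (intg_dominated _ (intg_norm Ik)).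
    apply: measurable_funM => //; apply: (measurableT_comp measurable_cosT).
    exact: (measurableT_comp (measurable_dot3 xi)).
  by move=> v; rewrite normrM ler_piMr// cos_norm_le1.
apply: eq_Rintegral => v _.
transitivity (\int[L3]_x (k v * (packet a l (x - Psi v) * cos (dot3 x xi + 0)))).
  by apply: eq_Rintegral => x _; rewrite /F/= mulrA addr0.
rewrite RintegralZl//; last exact: intg_packet_cos.
by rewrite Rintegral_packet_cos// addr0 mulrCA.
Qed.

(** This replaces Plancherel. Both sides are iterated forms of the double integral of
    [superpos x * W xi * cos (x . xi)], absolutely convergent since [superpos] and [W] are
    integrable. *)
Lemma superpos_pairing (W : space3 R -> R) : L3.-intg W ->
  \int[L3]_x (superpos x * \int[L3]_xi (W xi * cos (dot3 xi x))) =
  \int[L3]_xi (W xi * packet_hat a l xi * multiplier xi).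
Proof.
move=> IW; pose F (z : space3 R * space3 R) := superpos z.1 * W z.2 * cos (dot3 z.2 z.1).
have mc : measurable_fun setT (fun z : space3 R * space3 R => cos (dot3 z.2 z.1)).
  apply: (measurableT_comp measurable_cosT); rewrite /dot3.
  apply: measurable_funD; [apply: measurable_funD|]; apply: measurable_funM;
  repeat first [exact: measurable_snd | exact: measurable_fst | apply: (measurableT_comp measurable_fst) |
  apply: (measurableT_comp measurable_snd)].
have mcx x : measurable_fun setT (fun y : space3 R => cos (dot3 y x)).
  exact: (measurableT_comp measurable_cosT (measurable_dot3 x)).
have I2 := @intg_tensor _ _ _ _ _ L3 L3 _ _ intg_superpos IW.
have IF : (sigma_finite_prod L3 L3).-intg F.
  apply: (intg_dominated _ (intg_norm I2)).
    apply: measurable_funM => //; exact: intg_measurable I2.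
  by move=> z; rewrite [leLHS]normrM ler_piMr// cos_norm_le1.
have IWc x : L3.-intg (fun y => W y * cos (dot3 y x)).
  apply: (intg_dominated _ (intg_norm IW)).
    by apply: measurable_funM; [exact: intg_measurable IW|exact: mcx].
  by move=> z; rewrite [leLHS]normrM ler_piMr// cos_norm_le1.
have IUc x : L3.-intg (fun y => superpos y * cos (dot3 y x)).
  apply: (intg_dominated _ (intg_norm intg_superpos)).
    by apply: measurable_funM; [exact: intg_measurable intg_superpos|exact: mcx].
  by move=> z; rewrite [leLHS]normrM ler_piMr// cos_norm_le1.
transitivity (\int[sigma_finite_prod L3 L3]_z F z).
  rewrite Rintegral_prod12//; last first.
    by move=> x; have := intgZl (superpos x) (IWc x); apply: eq_intg => y; rewrite /F/= mulrA.
  apply: eq_Rintegral => x _; rewrite -RintegralZl//.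
  by apply: eq_Rintegral => y _; rewrite /F/= mulrA.
rewrite Rintegral_prod21//; last first.
  move=> y; have := intgZl (W y) (IUc y); apply: eq_intg => x.
  by rewrite /F/= dot3C mulrCA mulrA.
apply: eq_Rintegral => y _; rewrite -mulrA -superpos_fourier -RintegralZl//.
by apply: eq_Rintegral => x _; rewrite /F/= dot3C mulrCA mulrA.
Qed.

Lemma intg_mult xi : mu.-intg (fun v => k v * cos (dot3 (Psi v) xi)).
Proof.
apply: (intg_dominated _ (intg_norm Ik)).
  apply: measurable_funM => //; apply: (measurableT_comp measurable_cosT).
  exact: (measurableT_comp (measurable_dot3 xi)).
by move=> v; rewrite normrM ler_piMr// cos_norm_le1.
Qed.

Lemma measurable_multiplier : measurable_fun setT multiplier.
Proof.
apply: (@measurable_Rintegral2 _ _ _ _ _ mu (fun z => k z.2 * cos (dot3 (Psi z.2) z.1))); last exact: intg_mult.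
apply: measurable_funM; first exact: (measurableT_comp mk).
apply: (measurableT_comp measurable_cosT); rewrite /dot3.
have m1 := measurableT_comp measurable_fst mPsiZ.
have m2 := measurableT_comp measurable_snd mPsiZ.
apply: measurable_funD; [apply: measurable_funD|]; apply: measurable_funM => //.
- exact: (measurableT_comp measurable_fst m1).
- by apply: (measurableT_comp measurable_fst); apply: (measurableT_comp measurable_fst).
- exact: (measurableT_comp measurable_snd m1).
- by apply: (measurableT_comp measurable_snd); apply: (measurableT_comp measurable_fst).
- by apply: (measurableT_comp measurable_snd).
Qed.

Lemma multiplier_le xi : `|multiplier xi| <= \int[mu]_v `|k v|.
Proof.
apply: Rint_norm_le (intg_measurable (intg_mult xi)) (intg_norm Ik) _ => v.
by rewrite normrM ler_piMr// cos_norm_le1.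
Qed.

End superposition.
End packets.

(** * Packets as Schwartz test functions *)

Section schwartz_packet.
Context {R : realType}.

(** A directional derivative is an ordinary derivative along a line, so the automatic
    differentiation rules for functions of one real variable become usable in space. *)
Lemma is_derive_line (V : normedModType R) (f : V -> R) (x v : V) (df : R) :
  is_derive (0 : R) 1 (fun h : R => f (h *: v + x)) df -> is_derive x v f df.
Proof.
move=> [D E]; have eq1 : (fun h : R => h^-1 *: (f (h *: v + x) - f x)) =
   (fun h : R => h^-1 *: (((fun h : R => f (h *: v + x)) (h *: (1 : R) + 0)) - (fun h : R => f (h *: v + x)) 0)).
  by apply/funext => h; rewrite /= scale0r add0r addr0 /GRing.scale/= mulr1.
split.
  by rewrite /derivable; move: D; rewrite /derivable /= -eq1.
by rewrite -E /derive /= -eq1.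
Qed.

Variables a l : R.
Hypothesis a0 : 0 < a.

(* Contains the packets and is stable under all partial derivatives. *)
Inductive packet_class : (space3 R -> R) -> Prop :=
| packet_class_cos : packet_class (fun x => gauss3 a 0 x * cos (l * x.2))
| packet_class_sin : packet_class (fun x => gauss3 a 0 x * sin (l * x.2))
| packet_class_X1 f : packet_class f -> packet_class (fun x => x.1.1 * f x)
| packet_class_X2 f : packet_class f -> packet_class (fun x => x.1.2 * f x)
| packet_class_X3 f : packet_class f -> packet_class (fun x => x.2 * f x)
| packet_class_Z k f : packet_class f -> packet_class (fun x => k * f x)
| packet_class_D f g : packet_class f -> packet_class g ->
    packet_class (fun x => f x + g x).

Lemma is_derive_X1 (x v : space3 R) : is_derive x v (fun x : space3 R => x.1.1) v.1.1.
Proof.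
apply: is_derive_line; rewrite /= /GRing.scale/=.
by apply: is_derive_eq; rewrite /GRing.scale/=; ring.
Qed.

Lemma is_derive_X2 (x v : space3 R) : is_derive x v (fun x : space3 R => x.1.2) v.1.2.
Proof.
apply: is_derive_line; rewrite /= /GRing.scale/=.
by apply: is_derive_eq; rewrite /GRing.scale/=; ring.
Qed.

Lemma is_derive_X3 (x v : space3 R) : is_derive x v (fun x : space3 R => x.2) v.2.
Proof.
apply: is_derive_line; rewrite /= /GRing.scale/=.
by apply: is_derive_eq; rewrite /GRing.scale/=; ring.
Qed.

Lemma packet_class_derive f (v : space3 R) : packet_class f ->
  exists2 g, packet_class g & forall x : space3 R, is_derive x v f (g x).
Proof.
elim=> {f}.
- exists (fun x => (- (2 * a)) * (v.1.1 * (x.1.1 * (gauss3 a 0 x * cos (l * x.2))) +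
     v.1.2 * (x.1.2 * (gauss3 a 0 x * cos (l * x.2))) +
     v.2 * (x.2 * (gauss3 a 0 x * cos (l * x.2)))) +
     (- (l * v.2)) * (gauss3 a 0 x * sin (l * x.2))).
    by repeat constructor.
  move=> x; apply: is_derive_line; rewrite /gauss3 /gauss1 /= /GRing.scale/=.
  apply: is_derive_eq; rewrite /GRing.scale/= !mul0r !add0r; ring.
- exists (fun x => (- (2 * a)) * (v.1.1 * (x.1.1 * (gauss3 a 0 x * sin (l * x.2))) +
     v.1.2 * (x.1.2 * (gauss3 a 0 x * sin (l * x.2))) +
     v.2 * (x.2 * (gauss3 a 0 x * sin (l * x.2)))) +
     (l * v.2) * (gauss3 a 0 x * cos (l * x.2))).
    by repeat constructor.
  move=> x; apply: is_derive_line; rewrite /gauss3 /gauss1 /= /GRing.scale/=.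
  apply: is_derive_eq; rewrite /GRing.scale/= !mul0r !add0r; ring.
- move=> f Sf [g Sg dg]; exists (fun x => v.1.1 * f x + x.1.1 * g x).
    by repeat constructor.
  move=> x; have d1 := is_derive_X1 x v; have d2 := dg x.
  by apply: is_derive_eq; rewrite /GRing.scale/=; ring.
- move=> f Sf [g Sg dg]; exists (fun x => v.1.2 * f x + x.1.2 * g x).
    by repeat constructor.
  move=> x; have d1 := is_derive_X2 x v; have d2 := dg x.
  by apply: is_derive_eq; rewrite /GRing.scale/=; ring.
- move=> f Sf [g Sg dg]; exists (fun x => v.2 * f x + x.2 * g x).
    by repeat constructor.
  move=> x; have d1 := is_derive_X3 x v; have d2 := dg x.
  by apply: is_derive_eq; rewrite /GRing.scale/=; ring.
- move=> k f Sf [g Sg dg]; exists (fun x => k * g x); first by repeat constructor.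
  by move=> x; have d2 := dg x; apply: is_derive_eq.
- move=> f1 f2 Sf1 [g1 Sg1 dg1] Sf2 [g2 Sg2 dg2]; exists (fun x => g1 x + g2 x).
    by repeat constructor.
  by move=> x; have d1 := dg1 x; have d2 := dg2 x; apply: is_derive_eq.
Qed.

Lemma packet_class_partials s f : packet_class f -> packet_class (partials s f).
Proof.
move=> Sf; elim: s => //= j s /(packet_class_derive (basis3 j)) [g Sg dg].
have -> // : 'D_(basis3 j) (partials s f) = g.
by apply/funext => x; have [_ ->] := dg x.
Qed.

Lemma add1_expR_le (b r : R) : 0 < b -> 0 <= r -> 1 + r <= (1 + b^-1) * expR (b * r).
Proof.
move=> b0 r0; apply: (@le_trans _ _ ((1 + b^-1) * (1 + b * r))).
  have : 0 <= b^-1 by rewrite invr_ge0 ltW.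
  have : 0 <= b * r by rewrite mulr_ge0 // ltW.
  have -> : (1 + b^-1) * (1 + b * r) = 1 + b * r + b^-1 + r by field; rewrite gt_eqF.
  lra.
rewrite ler_wpM2l ?expR_ge1Dx//.
by rewrite addr_ge0// invr_ge0 ltW.
Qed.

Lemma gauss3_rapid (k : nat) : exists M, forall x : space3 R,
  (1 + dot3 x x) ^+ k * gauss3 a 0 x <= M.
Proof.
(* With rate [b = a/(k+1)], the [k]-th power of [exp(b |x|^2)] costs less than the exponent
   [a |x|^2] of the Gaussian; [k+1] also covers [k = 0]. *)
have b0 : 0 < a / k.+1%:R by rewrite divr_gt0.
exists ((1 + (a / k.+1%:R)^-1) ^+ k) => x.
have r0 := dot3_ge0 x.
have h : 0 <= 1 + (a / k.+1%:R)^-1 by rewrite addr_ge0// invr_ge0 ltW.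
apply: (@le_trans _ _ (((1 + (a / k.+1%:R)^-1) * expR (a / k.+1%:R * dot3 x x)) ^+ k * gauss3 a 0 x)).
  rewrite ler_wpM2r ?gauss3_ge0// lerXn2r ?nnegrE//.
  - exact: addr_ge0.
  - by apply: mulr_ge0 => //; exact: expR_ge0.
  exact: add1_expR_le.
rewrite exprMn -[leLHS]mulrA ler_piMr ?exprn_ge0// gauss3E subr0 -expRM_natl -expRD.
rewrite -[leRHS]expR0 ler_expR subr_le0 mulrA ler_wpM2r//.
rewrite mulrA ler_pdivrMr// mulrC ler_pM2l//.
by rewrite ler_nat.
Qed.

Lemma add1_dot3_ge0 (x : space3 R) : 0 <= 1 + dot3 x x.
Proof. exact: (addr_ge0 ler01 (dot3_ge0 x)). Qed.

Lemma abs_coord_le (y r : R) : y ^+ 2 <= r -> `|y| <= 1 + r.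
Proof.
rewrite -normr_id -real_normK ?num_real// => h.
have := sqr_ge0 (`|y| - 1); rewrite normr_id sqrrB; nra.
Qed.

(** A coordinate is at most [1 + |x|^2] in absolute value, so each coordinate factor uses up one
    power of the weight; the induction therefore carries all [k] at once. *)
Lemma packet_class_rapid f : packet_class f -> forall k : nat, exists M, forall x : space3 R,
  (1 + dot3 x x) ^+ k * `|f x| <= M.
Proof.
have base g k : (forall x, `|g x| <= 1) -> exists M, forall x : space3 R,
    (1 + dot3 x x) ^+ k * `|gauss3 a 0 x * g x| <= M.
  move=> g1; have [M HM] := gauss3_rapid k; exists M => x.
  apply: le_trans (HM x); rewrite ler_wpM2l ?exprn_ge0 ?add1_dot3_ge0//.
  by rewrite normrM ger0_norm ?gauss3_ge0// ler_piMr ?gauss3_ge0.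
have coord (c : space3 R -> R) f' k : (forall x, c x ^+ 2 <= dot3 x x) ->
    (forall k : nat, exists M, forall x : space3 R, (1 + dot3 x x) ^+ k * `|f' x| <= M) ->
    exists M, forall x : space3 R, (1 + dot3 x x) ^+ k * `|c x * f' x| <= M.
  move=> hc /(_ k.+1) [M HM]; exists M => x; apply: le_trans (HM x).
  rewrite exprSr -mulrA ler_wpM2l ?exprn_ge0 ?add1_dot3_ge0//.
  by rewrite normrM ler_wpM2r// abs_coord_le.
elim=> {f}.
- by move=> k; apply: base => x; exact: cos_norm_le1.
- by move=> k; apply: base => x; exact: sin_norm_le1.
- move=> f Sf IH k; apply: coord => // x; rewrite /dot3.
  by have := sqr_ge0 x.1.2; have := sqr_ge0 x.2; rewrite !expr2; lra.
- move=> f Sf IH k; apply: coord => // x; rewrite /dot3.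
  by have := sqr_ge0 x.1.1; have := sqr_ge0 x.2; rewrite !expr2; lra.
- move=> f Sf IH k; apply: coord => // x; rewrite /dot3.
  by have := sqr_ge0 x.1.1; have := sqr_ge0 x.1.2; rewrite !expr2; lra.
- move=> c f Sf IH k; have [M HM] := IH k; exists (`|c| * M) => x.
  by rewrite normrM mulrCA ler_wpM2l.
- move=> f1 f2 Sf1 IH1 Sf2 IH2 k; have [M1 H1] := IH1 k; have [M2 H2] := IH2 k.
  exists (M1 + M2) => x; apply: le_trans (lerD (H1 x) (H2 x)).
  by rewrite -mulrDr ler_wpM2l ?ler_normD// exprn_ge0// add1_dot3_ge0.
Qed.

Lemma packet_class_schwartz f : packet_class f -> real_schwartz f.
Proof.
move=> Sf; split.
  move=> s j x; have [g _ dg] := packet_class_derive (basis3 j) (packet_class_partials s Sf).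
  by have [] := dg x.
by move=> s k; apply: packet_class_rapid; exact: packet_class_partials.
Qed.

Lemma schwartz_packet : schwartz (fun x => (packet a l x)%:C)%C.
Proof.
split; first by apply: packet_class_schwartz; exact: packet_class_cos.
apply: packet_class_schwartz.
have -> : (fun x => complex.Im (packet a l x)%:C%C) = (fun x => 0 * packet a l x).
  by apply/funext => x; rewrite mul0r.
by apply: packet_class_Z; exact: packet_class_cos.
Qed.

End schwartz_packet.

(** * The Bessel symbol against Gaussians, and packets on the Fourier side *)

Section bessel.
Local Open Scope complex_scope.
Context {R : realType}.
Local Notation L3 := (@L3 R).
Variable alpha : R.
Hypothesis alpha0 : 0 < alpha.

(** [add1_expR_le] at rate [2 tau/alpha], raised to the power [alpha/2], leaves the exponential rate
    [tau] and this constant. *)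
Definition bessel_const (tau : R) := (1 + (2 * tau / alpha)^-1) `^ (alpha / 2).

Lemma bessel_symbol_ge0 xi : 0 <= bessel_symbol alpha xi.
Proof. exact: powR_ge0. Qed.

Lemma bessel_symbol_le tau xi : 0 < tau ->
  bessel_symbol alpha xi <= bessel_const tau * expR (tau * dot3 xi xi).
Proof.
move=> t0; have b0 : 0 < 2 * tau / alpha by rewrite divr_gt0// mulr_gt0.
apply: (@le_trans _ _ (((1 + (2 * tau / alpha)^-1) * expR (2 * tau / alpha * dot3 xi xi)) `^ (alpha / 2))).
  rewrite ge0_ler_powR ?nnegrE ?add1_dot3_ge0//.
  - by rewrite divr_ge0// ltW.
  - by rewrite mulr_ge0 ?expR_ge0// addr_ge0// invr_ge0 ltW.
  - exact: add1_expR_le (dot3_ge0 xi).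
rewrite powRM ?expR_ge0//; last by rewrite addr_ge0// invr_ge0 ltW.
rewrite ler_wpM2l ?powR_ge0// -expRM.
by rewrite ler_expR le_eqVlt; apply/orP; left; apply/eqP; field; rewrite gt_eqF.
Qed.

Lemma measurable_bessel_symbol : measurable_fun setT (@bessel_symbol R alpha).
Proof.
rewrite /bessel_symbol; apply: (measurableT_comp (measurable_powR _)).
apply: measurable_funD => //; rewrite /dot3.
apply: measurable_funD; [apply: measurable_funD|]; apply: measurable_funM;
  repeat first [exact: measurable_snd | exact: measurable_fst | apply: (measurableT_comp measurable_fst) |
  apply: (measurableT_comp measurable_snd)].
Qed.

Lemma dot3_parallelogram (x v : space3 R) :
  dot3 x x <= 2 * dot3 v v + 2 * dot3 (x - v) (x - v).
Proof.
have h (y w : R) : y * y <= 2 * (w * w) + 2 * ((y - w) * (y - w)).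
  by have := sqr_ge0 (y - 2 * w); rewrite expr2; lra.
have := h x.1.1 v.1.1; have := h x.1.2 v.1.2; have := h x.2 v.2.
by rewrite /dot3/=; lra.
Qed.

(** The symbol grows at most like [exp(tau |xi|^2)]. As [|xi|^2 <= 2 |v|^2 + 2 |xi - v|^2] and
    [2 tau <= c/2], half of the Gaussian exponent pays for it, up to the constant
    [exp(2 tau |v|^2)]. *)
Lemma bessel_gauss3_le tau c v xi : 0 < tau -> tau <= c / 4 ->
  bessel_symbol alpha xi * gauss3 c v xi <=
  bessel_const tau * expR (2 * tau * dot3 v v) * gauss3 (c / 2) v xi.
Proof.
move=> t0 tc; apply: (@le_trans _ _ (bessel_const tau * expR (tau * dot3 xi xi) * gauss3 c v xi)).
  by rewrite ler_wpM2r ?gauss3_ge0// bessel_symbol_le.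
rewrite -!mulrA ler_wpM2l ?powR_ge0// !gauss3E -!expRD ler_expR.
have h := dot3_parallelogram xi v.
have : tau * dot3 xi xi <= tau * (2 * dot3 v v + 2 * dot3 (xi - v) (xi - v)) by rewrite ler_pM2l.
have : tau * dot3 (xi - v) (xi - v) <= c / 4 * dot3 (xi - v) (xi - v) by rewrite ler_wpM2r// dot3_ge0.
set A := dot3 xi xi; set B := dot3 v v; set D := dot3 (xi - v) (xi - v).
lra.
Qed.

Lemma intg_bessel_gauss3 c v : 0 < c ->
  L3.-intg (fun xi => bessel_symbol alpha xi * gauss3 c v xi).
Proof.
move=> c0; have c20 : 0 < c / 2 by rewrite divr_gt0.
apply: (intg_dominated _ (intgZl (bessel_const (c / 4) * expR (2 * (c / 4) * dot3 v v)) (intg_gauss3 v c20))).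
  apply: measurable_funM; first exact: measurable_bessel_symbol.
  exact: intg_measurable (intg_gauss3 v c0).
move=> xi; rewrite ger0_norm; last by rewrite mulr_ge0 ?powR_ge0 ?gauss3_ge0.
by apply: bessel_gauss3_le => //; rewrite divr_gt0.
Qed.

Lemma intg_bessel_packet_hat a l : 0 < a ->
  L3.-intg (fun xi => bessel_symbol alpha xi * packet_hat a l xi).
Proof.
move=> a0; have c0 : 0 < (4 * a)^-1 by rewrite invr_gt0 mulr_gt0.
have := intgZl (Num.sqrt (pi / a) ^+ 3 / 2)
  (intgD (intg_bessel_gauss3 (0, 0, l) c0) (intg_bessel_gauss3 (0, 0, - l) c0)).
by apply: eq_intg => xi; rewrite /packet_hat; field.
Qed.

End bessel.

Section fourier_packet.
Local Open Scope complex_scope.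
Context {R : realType}.
Local Notation L3 := (@L3 R).
Variable alpha a l : R.
Hypotheses (alpha0 : 0 < alpha) (a0 : 0 < a).

Lemma ReM (x y : R[i]) :
  complex.Re (x * y) = complex.Re x * complex.Re y - complex.Im x * complex.Im y.
Proof. by case: x y => [? ?] [? ?]. Qed.

Lemma ImM (x y : R[i]) :
  complex.Im (x * y) = complex.Re x * complex.Im y + complex.Im x * complex.Re y.
Proof. by case: x y => [? ?] [? ?]. Qed.

Lemma inv_fourier_packet xi :
  inv_fourier (fun x => (packet a l x)%:C) xi =
  ((2 * pi) ^- 3 * packet_hat a l xi)%:C.
Proof.
have eRe : \int[leb3 R]_x complex.Re (cexpi (dot3 xi x) * (packet a l x)%:C) = packet_hat a l xi.
  rewrite Rintegral_leb3 -[RHS]mulr1 -cos0 -[0 in RHS]/(0 : R).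
  rewrite -[in RHS](_ : dot3 0 xi + 0 = 0); last by rewrite /dot3/= !mul0r !addr0.
  rewrite -Rintegral_packet_cos//; apply: eq_Rintegral => x _.
  by rewrite ReM/= mulr0 subr0 subr0 addr0 dot3C mulrC.
have eIm : \int[leb3 R]_x complex.Im (cexpi (dot3 xi x) * (packet a l x)%:C) = 0.
  rewrite Rintegral_leb3 -[RHS](mulr0 (packet_hat a l xi)).
  (* The sine integral is the cosine integral with phase [-pi/2], and the closed form then contains
     this vanishing factor. *)
  have : cos (dot3 0 xi + (- (pi / 2))) = 0.
    by rewrite /dot3/= !mul0r !add0r cosN cos_pihalf.
  move=> <-; rewrite -Rintegral_packet_cos//; apply: eq_Rintegral => x _.
  by rewrite ImM/= mulr0 add0r subr0 dot3C cosB cos_pihalf sin_pihalf mulr0 add0r mulr1 mulrC.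
rewrite /inv_fourier /cintegral.
by rewrite eRe eIm; apply/eqP; rewrite eq_complex ReM ImM/= !mulr0 !mul0r subr0 addr0 !eqxx.
Qed.

(** The frequency weight produced when the Bessel potential is moved from the averaged function onto
    the packet; [(2 pi)^-3] comes from the inverse transform. *)
Definition bessel_packet (xi : space3 R) : R :=
  (2 * pi) ^- 3 * (bessel_symbol alpha xi * packet_hat a l xi).

Lemma intg_bessel_packet : L3.-intg bessel_packet.
Proof. by apply: intgZl; exact: intg_bessel_packet_hat. Qed.

Lemma Re_fourier_bessel_packet x :
  complex.Re (fourier (fun xi => (bessel_symbol alpha xi)%:C *
    inv_fourier (fun x => (packet a l x)%:C) xi) x) =
  \int[L3]_xi (bessel_packet xi * cos (dot3 xi x)).
Proof.
rewrite /fourier /cintegral [LHS]/complex.Re Rintegral_leb3; apply: eq_Rintegral => xi _.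
rewrite inv_fourier_packet !ReM ImM/= !mulr0 !mul0r !subr0 addr0 mulr0 subr0.
by rewrite /bessel_packet cosN mulrC; congr (_ * _); ring.
Qed.

End fourier_packet.

(** * Testing boundedness against packets *)

Section lp_norms.
Local Open Scope complex_scope.
Context {R : realType}.
Local Notation L3 := (@L3 R).

Lemma measurable_normc (f : space3 R -> R[i]) :
  measurable_fun [set: space3 R] (fun x => complex.Re (f x)) ->
  measurable_fun [set: space3 R] (fun x => complex.Im (f x)) ->
  measurable_fun [set: space3 R] (fun x => Normc.normc (f x)).
Proof.
move=> m1 m2.
have -> : (fun x => Normc.normc (f x)) =
    (fun x => Num.sqrt (complex.Re (f x) ^+ 2 + complex.Im (f x) ^+ 2)).
  by apply/funext => x; case: (f x).
apply: measurableT_comp; first by apply: continuous_measurable_fun; exact: sqrt_continuous.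
by apply: measurable_funD; apply: measurable_funX.
Qed.

Lemma normc_real (r : R) : Normc.normc r%:C = `|r|.
Proof. by rewrite /Normc.normc/= expr0n addr0 sqrtr_sqr. Qed.

Lemma abs_Re_le (z : R[i]) : `|complex.Re z| <= Normc.normc z.
Proof.
case: z => u v /=; rewrite -sqrtr_sqr ler_wsqrtr// lerDl sqr_ge0 //.
Qed.

Lemma Lp_norm_real_le (p B : R) (f : space3 R -> R) : 0 < p ->
  L3.-intg (fun x => `|f x| `^ p) -> \int[L3]_x (`|f x| `^ p) <= B ->
  (Lp_norm p (fun x => (f x)%:C) <= (B `^ p^-1)%:E)%E.
Proof.
move=> p0 If fB; rewrite /Lp_norm unlock/=.
have -> : (\int[leb3 R]_x `|(Normc.normc (f x)%:C)%:E| `^ p = (\int[L3]_x (`|f x| `^ p))%:E)%E.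
  rewrite /Rintegral fineK; last exact: (integrable_fin_num _ If).
  apply: eq_integral => x _; rewrite normc_real abse_EFin normr_id.
  by rewrite poweR_EFin.
rewrite poweR_EFin lee_fin ge0_ler_powR ?nnegrE//.
- by rewrite invr_ge0 ltW.
- by apply: Rintegral_ge0 => x _; exact: powR_ge0.
- by apply: le_trans fB; apply: Rintegral_ge0 => x _; exact: powR_ge0.
Qed.

Lemma pairing_le (p q : R) (g : space3 R -> R[i]) (phi : space3 R -> R) (N M : R) :
  0 < p -> 0 < q -> p^-1 + q^-1 = 1 -> in_Lp p g -> (Lp_norm p g <= N%:E)%E ->
  measurable_fun [set: space3 R] phi ->
  (Lp_norm q (fun x => (phi x)%:C) <= M%:E)%E -> 0 <= N -> 0 <= M ->
  `|complex.Re (pairing g (fun x => (phi x)%:C))| <= N * M.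
Proof.
move=> p0 q0 pq [mr mi _] gN mphi pM N0 M0.
have mn := measurable_normc mr mi.
have mphi' : measurable_fun [set: space3 R] (fun x => Normc.normc (phi x)%:C).
  by under eq_fun do rewrite normc_real; apply: measurableT_comp.
have H := @hoelder _ _ _ (leb3 R) (fun x => Normc.normc (g x)) (fun x => Normc.normc (phi x)%:C) p q mn mphi' p0 q0 pq.
have {}H : ('N[leb3 R]_1[EFin \o ((fun x => Normc.normc (g x)) \* (fun x => Normc.normc (phi x)%:C))%R] <= (N * M)%:E)%E.
  apply: le_trans H _; rewrite EFinM; apply: lee_pmul => //; exact: Lnorm_ge0.
rewrite Lnorm1 in H.
rewrite /pairing /cintegral [X in `|X|]/complex.Re Rintegral_leb3.
set F := fun x => complex.Re (g x * (phi x)%:C).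
have FE x : F x = complex.Re (g x) * phi x by rewrite /F ReM/= mulr0 subr0.
have mF : measurable_fun [set: space3 R] F.
  by rewrite (funext FE); apply: measurable_funM.
have mG : measurable_fun [set: space3 R] (fun x => Normc.normc (g x) * Normc.normc (phi x)%:C).
  exact: measurable_funM.
have IG : L3.-intg (fun x => Normc.normc (g x) * Normc.normc (phi x)%:C).
  apply/integrableP; split; first exact/measurable_EFinP.
  by apply: le_lt_trans H _; rewrite ltry.
have nG x : 0 <= Normc.normc (g x) * Normc.normc (phi x)%:C.
  by rewrite mulr_ge0// (le_trans _ (abs_Re_le _)).
apply: (@le_trans _ _ (\int[L3]_x (Normc.normc (g x) * Normc.normc (phi x)%:C))).
  apply: (Rint_norm_le _ IG) => [|x]; first exact: mF.
  rewrite -/(F x) FE normrM normc_real ler_wpM2r//.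
  exact: abs_Re_le.
rewrite -lee_fin; apply: le_trans H.
rewrite /Rintegral fineK; last exact: (integrable_fin_num _ IG).
rewrite le_eqVlt; apply/orP; left; apply/eqP.
by apply: eq_integral => x _ /=; rewrite ger0_norm.
Qed.

(** The Sobolev norm is an infimum. Enlarging the constant to [|C| + 1], with [N > 0], makes the
    inequality strict, and strictness yields an actual Bessel derivative below the bound. *)
Lemma bounded_Lp_SobolevE (p alpha : R) A : bounded_Lp_Sobolev p alpha A ->
  exists2 C : R, 0 < C & forall (f : space3 R -> R[i]) (N : R), in_Lp p f -> 0 < N ->
    (Lp_norm p f <= N%:E)%E ->
    exists g, [/\ in_Lp p g, is_bessel_derivative alpha (A f) g &
      (Lp_norm p g <= (C * N)%:E)%E].
Proof.
move=> [C HC]; exists (`|C| + 1); first by rewrite ltr_wpDl.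
move=> f N fLp N0 fN; have [_ Hf] := HC f fLp.
have : (Sobolev_norm p alpha (A f) < ((`|C| + 1) * N)%:E)%E.
  apply: le_lt_trans Hf _.
  apply: (@le_lt_trans _ _ (`|C| * N)%:E); last by rewrite lte_fin ltr_pM2r// ltrDl.
  rewrite EFinM; apply: (@le_trans _ _ (`|C|%:E * Lp_norm p f)%E).
    by rewrite lee_wpmul2r ?lee_fin ?ler_norm// Lnorm_ge0.
  by rewrite lee_wpmul2l ?lee_fin.
by move=> /ereal_inf_lt[_ [g [gLp gB] <-]] /ltW; exists g.
Qed.

Lemma Lp_norm_packet (q a l : R) : 0 < q -> 0 < a ->
  (Lp_norm q (fun x => (packet a l x)%:C) <=
   ((Num.sqrt (pi / (q * a)) ^+ 3) `^ q^-1)%:E)%E.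
Proof.
move=> q0 a0; have qa0 : 0 < q * a by rewrite mulr_gt0.
have le1 x : `|packet a l x| `^ q <= gauss3 (q * a) 0 x.
  apply: (@le_trans _ _ (gauss3 a 0 x `^ q)).
    by rewrite ge0_ler_powR ?nnegrE ?gauss3_ge0 ?packet_le// ltW.
  by rewrite !gauss3E -expRM ler_expR mulrC mulrN mulrA.
have mp : measurable_fun setT (fun x : space3 R => `|packet a l x| `^ q).
  apply: (measurableT_comp (measurable_powR q)); apply: measurableT_comp => //.
  have := intg_measurable (intg_packet l 0 a0).
  by under eq_fun do rewrite subr0.
have Ip : L3.-intg (fun x => `|packet a l x| `^ q).
  by apply: (intg_dominated _ (intg_gauss3 0 qa0)) => [|x]; [exact: mp|rewrite ger0_norm ?powR_ge0].
apply: Lp_norm_real_le => //; rewrite -(Rintegral_gauss3 0 qa0).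
by apply: Rint_le => //; exact: intg_gauss3.
Qed.

(** Hölder bounds the pairing of the Bessel derivative with a packet, and its definition rewrites
    that pairing. Since [A f] is real, the real part involves only the cosine transform of
    [bessel_packet]. *)
Lemma test_inequality (p q alpha : R) A : 0 < alpha -> 0 < p -> 0 < q -> p^-1 + q^-1 = 1 ->
  bounded_Lp_Sobolev p alpha A ->
  exists2 C : R, 0 < C & forall (f : space3 R -> R[i]) (U : space3 R -> R) (N a l : R),
    in_Lp p f -> 0 < N -> (Lp_norm p f <= N%:E)%E -> (forall x, A f x = (U x)%:C) -> 0 < a ->
    `|\int[L3]_x (U x * \int[L3]_xi (bessel_packet alpha a l xi * cos (dot3 xi x)))| <=
    C * N * (Num.sqrt (pi / (q * a)) ^+ 3) `^ q^-1.
Proof.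
move=> alpha0 p0 q0 pq /bounded_Lp_SobolevE[C C0 HC]; exists C => // f U N a l fLp N0 fN AfU a0.
have [g [gLp gB gN]] := HC f N fLp N0 fN.
have E := gB _ (schwartz_packet l a0).
have CN0 : 0 <= C * N by rewrite mulr_ge0 ?ltW.
have mp : measurable_fun [set: space3 R] (packet a l).
  have := intg_measurable (intg_packet l 0 a0).
  by under eq_fun do rewrite subr0.
have := pairing_le p0 q0 pq gLp gN mp (Lp_norm_packet l q0 a0) CN0 (powR_ge0 _ _).
rewrite E /pairing /cintegral [X in `|X|]/complex.Re Rintegral_leb3.
have -> // : \int[L3]_x complex.Re (A f x * fourier
    (fun xi => (bessel_symbol alpha xi)%:C * inv_fourier (fun x => (packet a l x)%:C) xi) x) =
  \int[L3]_x (U x * \int[L3]_xi (bessel_packet alpha a l xi * cos (dot3 xi x))).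
apply: eq_Rintegral => x _.
by rewrite AfU ReM Re_fourier_bessel_packet//= mul0r subr0.
Qed.

End lp_norms.

(** * The torus average as a weighted integral over the plane *)

Section torus.
Context {R : realType}.
Local Notation L1 := (@L1 R).
Local Notation L2 := (@L2 R).
Variables s t : R.

Definition angles : set R := `[0, 2 * pi[%classic.
Definition box : set (R * R) := angles `*` angles.
(** A product of indicators instead of the indicator of a product, so that it separates under
    Fubini. *)
Definition box1 (w : R * R) : R := \1_angles w.1 * \1_angles w.2.

Lemma box1E w : box1 w = \1_box w.
Proof. by rewrite /box1 !indicE -natrM mulnb /box in_setX. Qed.

Lemma box1_ge0 w : 0 <= box1 w.
Proof. by rewrite /box1 !indicE mulr_ge0. Qed.

Lemma intg_angles : L1.-intg (\1_angles : R -> R).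
Proof.
apply/integrableP; split.
  by apply/measurable_EFinP; apply: measurable_indic; exact: measurable_itv.
under eq_integral do rewrite /= ger0_norm//.
rewrite integral_indic//; last exact: measurable_itv.
by rewrite setIT /angles [X in (X < _)%E]lebesgue_measure_itv/=; case: ifP => _; rewrite ?ltry// -EFinB ltry.
Qed.

Lemma Rintegral_angles : \int[L1]_x (\1_angles x : R) = 2 * pi.
Proof.
rewrite /Rintegral integral_indic//; last exact: measurable_itv.
rewrite setIT /angles [X in fine X]lebesgue_measure_itv/= lte_fin.
rewrite mulr_gt0 ?pi_gt0//= ; by rewrite oppr0 addr0.
Qed.

Lemma intg_box1 : L2.-intg box1.
Proof. by apply: (@intg_tensor _ _ _ _ _ L1 L1); exact: intg_angles. Qed.

Lemma Rintegral_box1 : \int[L2]_w box1 w = (2 * pi) ^+ 2.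
Proof.
rewrite (@Rintegral_prod12 _ _ _ _ _ L1 L1); [|exact: intg_box1|]; last first.
  by move=> x; exact: (intgZl (\1_angles x) intg_angles).
transitivity (\int[L1]_x (\1_angles x * (2 * pi) : R)).
  by apply: eq_Rintegral => x _; rewrite /box1/= RintegralZl ?Rintegral_angles//; exact: intg_angles.
by rewrite RintegralZr ?Rintegral_angles//; exact: intg_angles.
Qed.

Lemma torus_average_real (f : space3 R -> R) x :
  torus_average s t (fun x => (f x)%:C%C) x =
  (\int[L2]_w (box1 w * f (x - torus s t w)))%:C%C.
Proof.
rewrite /torus_average /cintegral/=; congr (_ +i* _)%C.
  rewrite Rintegral_mkcond; apply: eq_Rintegral => w _.
  by rewrite box1E patchE indicE /box /angles; case: (w \in _); rewrite ?mul1r ?mul0r.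
by rewrite /Rintegral integral0.
Qed.

Lemma measurable_torus : measurable_fun setT (torus s t).
Proof.
have mc : measurable_fun setT (@cos R) by exact: measurable_cosT.
have ms : measurable_fun setT (@sin R) by apply: continuous_measurable_fun; exact: continuous_sin.
have c1 : measurable_fun setT (fun w : R * R => cos w.1) by exact: (measurableT_comp mc).
have c2 : measurable_fun setT (fun w : R * R => cos w.2) by exact: (measurableT_comp mc).
have s1 : measurable_fun setT (fun w : R * R => sin w.1) by exact: (measurableT_comp ms).
have s2 : measurable_fun setT (fun w : R * R => sin w.2) by exact: (measurableT_comp ms).
have r1 : measurable_fun setT (fun w : R * R => t + s * cos w.1).
  by apply: measurable_funD => //; exact: measurable_funM.
rewrite /torus; apply: measurable_fun_pair; last exact: measurable_funM.
by apply: measurable_fun_pair; exact: measurable_funM.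
Qed.

Lemma dot3_torus_le w : 0 <= s -> 0 <= t ->
  dot3 (torus s t w) (torus s t w) <= (s + t) ^+ 2 + s ^+ 2.
Proof.
move=> s0 t0; rewrite /dot3/=.
have := cos2Dsin2 w.1; have := cos2Dsin2 w.2.
have := cos_le1 w.1; have := cos_geN1 w.1.
set c := cos w.1; set c' := cos w.2; set d := sin w.1; set d' := sin w.2.
move=> c1 c2 e2 e1.
have -> : (t + s * c) * c' * ((t + s * c) * c') + (t + s * c) * d' * ((t + s * c) * d') + s * d * (s * d)
  = (t + s * c) ^+ 2 * (c' ^+ 2 + d' ^+ 2) + s ^+ 2 * d ^+ 2 by ring.
rewrite e2 mulr1 -[d ^+ 2](addKr (c ^+ 2)) e1.
have : s * t * c <= s * t * 1 by rewrite ler_wpM2l// mulr_ge0.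
have : 0 <= s * t by rewrite mulr_ge0.
have := sqr_ge0 s; have := sqr_ge0 (s * c).
rewrite !expr2; nra.
Qed.

End torus.

(** * The energy inequality that boundedness implies *)

Section key_inequality.
Context {R : realType}.
Local Notation L3 := (@L3 R).
Variables (s t p q alpha : R).

Lemma packet_hat_ge0 a l (xi : space3 R) : 0 <= packet_hat a l xi.
Proof.
by rewrite /packet_hat mulr_ge0 ?exprn_ge0 ?sqrtr_ge0// divr_ge0// addr_ge0 ?gauss3_ge0.
Qed.

Lemma gauss3_le1 a (v x : space3 R) : 0 <= a -> gauss3 a v x <= 1.
Proof. by move=> a0; rewrite gauss3E -expR0 ler_expR oppr_le0 mulr_ge0 ?dot3_ge0. Qed.

Lemma packet_hat_le a l (xi : space3 R) : 0 < a ->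
  packet_hat a l xi <= Num.sqrt (pi / a) ^+ 3.
Proof.
move=> a0; rewrite /packet_hat ler_piMr ?exprn_ge0 ?sqrtr_ge0//.
have c0 : 0 <= (4 * a)^-1 by rewrite invr_ge0 mulr_ge0 ?ltW.
rewrite ler_pdivrMr// mul1r.
have := gauss3_le1 (0, 0, l) xi c0; have := gauss3_le1 (0, 0, - l) xi c0.
lra.
Qed.

Lemma intg_bessel_packet_multiplier d (V : measurableType d)
    (mu : {sigma_finite_measure set V -> \bar R}) (k : V -> R) (Psi : V -> space3 R) a l :
  0 < alpha -> 0 < a -> mu.-intg k -> measurable_fun setT Psi ->
  L3.-intg (fun xi => bessel_symbol alpha xi * packet_hat a l xi ^+ 2 * multiplier mu k Psi xi).
Proof.
move=> alpha0 a0 Ik mPsi; have Ib := intg_bessel_packet_hat alpha0 l a0.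
have mh : measurable_fun setT (@packet_hat R a l).
  have c0 : 0 < (4 * a)^-1 by rewrite invr_gt0 mulr_gt0.
  apply: measurable_funM => //; apply: measurable_funM => //.
  apply: measurable_funD; exact: intg_measurable (intg_gauss3 _ c0).
apply: (intg_dominated _ (intgZr (Num.sqrt (pi / a) ^+ 3 * \int[mu]_v `|k v|) Ib)).
  apply: measurable_funM; last exact: measurable_multiplier.
  apply: measurable_funM; first exact: measurable_bessel_symbol.
  exact: measurable_funX.
move=> xi; have b0 := bessel_symbol_ge0 alpha xi; have h0 := packet_hat_ge0 a l xi.
rewrite normrM ger0_norm; last by rewrite mulr_ge0 ?exprn_ge0.
have bh0 := mulr_ge0 b0 h0.
rewrite expr2 [X in X * _ <= _]mulrA [leRHS]mulrA.
apply: ler_pM; [exact: mulr_ge0|exact: normr_ge0| |exact: multiplier_le].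
by rewrite ler_wpM2l// packet_hat_le.
Qed.

(** The factor [(2 pi)^-3] goes into the constant, and [q >= 1] lets the rate [q a] in the packet
    norm be replaced by [a], so that the same normalisation appears on both sides later. *)
Lemma key_inequality : 0 < alpha -> 1 < p -> p^-1 + q^-1 = 1 ->
  bounded_Lp_Sobolev p alpha (torus_average s t) ->
  exists2 C : R, 0 < C & forall (f : space3 R -> R) (N a l : R)
    d (V : measurableType d) (mu : {sigma_finite_measure set V -> \bar R})
    (k : V -> R) (Psi : V -> space3 R),
    in_Lp p (fun x => (f x)%:C%C) -> 0 < N -> (Lp_norm p (fun x => (f x)%:C%C) <= N%:E)%E ->
    0 < a -> mu.-intg k -> measurable_fun setT Psi ->
    (forall x, \int[@L2 R]_w (box1 w * f (x - torus s t w)) = superpos mu k Psi a l x) ->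
    `|\int[L3]_xi (bessel_symbol alpha xi * packet_hat a l xi ^+ 2 * multiplier mu k Psi xi)| <=
    C * N * (Num.sqrt (pi / a) ^+ 3) `^ q^-1.
Proof.
move=> alpha0 p1 pq B; have p0 : 0 < p by apply: lt_trans p1.
have q0 : 0 < q.
  by rewrite -invr_gt0 (_ : q^-1 = 1 - p^-1) ?subr_gt0 ?invf_lt1// -pq addrC addKr.
have q1 : 1 <= q.
  rewrite -invf_le1//; rewrite (_ : q^-1 = 1 - p^-1); last by rewrite -pq addrC addKr.
  by rewrite gerBl invr_ge0 ltW.
have [C C0 HC] := test_inequality alpha0 p0 q0 pq B.
have pi3 : 0 < (2 * pi) ^+ 3 :> R by rewrite exprn_gt0// mulr_gt0// pi_gt0.
exists ((2 * pi) ^+ 3 * C); first by rewrite mulr_gt0.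
move=> f N a l d V mu k Psi fLp N0 fN a0 Ik mPsi fE.
have AfU x : torus_average s t (fun x => (f x)%:C%C) x = (superpos mu k Psi a l x)%:C%C.
  by rewrite torus_average_real fE.
have := HC _ _ N a l fLp N0 fN AfU a0.
rewrite superpos_pairing//; last exact: intg_bessel_packet.
have -> : \int[L3]_xi (bessel_packet alpha a l xi * packet_hat a l xi * multiplier mu k Psi xi) =
  (2 * pi) ^- 3 * \int[L3]_xi (bessel_symbol alpha xi * packet_hat a l xi ^+ 2 * multiplier mu k Psi xi).
  rewrite -RintegralZl//; last exact: intg_bessel_packet_multiplier.
  by apply: eq_Rintegral => xi _; rewrite /bessel_packet; ring.
rewrite normrM ger0_norm; last by rewrite invr_ge0 ltW.
rewrite ler_pdivrMl// => H.
apply: le_trans H _.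
rewrite -(mulrA _ C N) -(mulrA _ (C * N)) ler_pM2l// ler_pM2l ?mulr_gt0//.
apply: ge0_ler_powR; rewrite ?nnegrE ?exprn_ge0 ?sqrtr_ge0//.
  by rewrite invr_ge0 ltW.
rewrite lerXn2r ?nnegrE ?sqrtr_ge0// ler_wsqrtr//.
rewrite ler_pM2l ?pi_gt0// lef_pV2 ?posrE ?mulr_gt0//.
by rewrite ler_peMl// ltW.
Qed.

End key_inequality.

(** * The bound alpha <= 1/2 *)

Section lipschitz.
Context {R : realType}.

Lemma cos_lipschitz (u v : R) : `|cos u - cos v| <= `|u - v|.
Proof.
wlog uv : u v / v <= u.
  move=> H; have [/H//|/ltW/H] := leP v u.
  by rewrite distrC [in X in _ -> X](distrC u).
have [c _ ->] : exists2 c, c \in `[v, u] & cos u - cos v = - sin c * (u - v).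
  apply: MVT_segment => //.
  by apply: continuous_subspaceT; exact: continuous_cos.
by rewrite normrM normrN ler_piMl// sin_norm_le1.
Qed.

Lemma dot3_AMGM (r : R) (x y : space3 R) : 0 < r ->
  `|dot3 x y| <= (r * dot3 x x + dot3 y y / r) / 2.
Proof.
move=> r0.
have h (u w : R) : `|u * w| <= (r * (u * u) + w * w / r) / 2.
  have e : (r * (u * u) + w * w / r) / 2 = ((r * u) ^+ 2 + w ^+ 2) / (2 * r).
    by field; rewrite gt_eqF.
  rewrite e ler_pdivlMr ?mulr_gt0//.
  have := sqr_ge0 (r * u - w); have := sqr_ge0 (r * u + w).
  rewrite sqrrB sqrrD; case: (ler0P (u * w)) => _; lra.
rewrite {1}/dot3; apply: le_trans (ler_normD _ _) _.
apply: le_trans (lerD (ler_normD _ _) (lexx _)) _.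
apply: le_trans (lerD (lerD (h _ _) (h _ _)) (h _ _)) _.
by rewrite le_eqVlt; apply/orP; left; apply/eqP; rewrite /dot3; field; rewrite gt_eqF.
Qed.

Context d (V : measurableType d) (mu : {sigma_finite_measure set V -> \bar R}).
Variables (k : V -> R) (Psi : V -> space3 R) (rho : R).
Hypotheses (Ik : mu.-intg k) (mPsi : measurable_fun setT Psi).
Hypothesis Psi_le : forall v, dot3 (Psi v) (Psi v) <= rho.

(** Lipschitz continuity of the cosine combined with Young's inequality of free weight [r]: no
    Euclidean norm appears, and [|xi - eta|^2] is what a Gaussian factor can absorb. *)
Lemma multiplier_lipschitz (r : R) xi eta : 0 < r ->
  `|multiplier mu k Psi xi - multiplier mu k Psi eta| <=
  (\int[mu]_v `|k v|) * ((r * rho + dot3 (xi - eta) (xi - eta) / r) / 2).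
Proof.
move=> r0; rewrite /multiplier -RintegralB//; [|exact: intg_mult..].
rewrite -RintegralZr//; last exact: intg_norm.
apply: Rint_norm_le.
- apply: measurable_funB; exact: intg_measurable (intg_mult Ik mPsi _).
- by apply: intgZr; exact: intg_norm.
move=> v; rewrite -mulrBr normrM ler_wpM2l//.
apply: le_trans (cos_lipschitz _ _) _.
have -> : dot3 (Psi v) xi - dot3 (Psi v) eta = dot3 (Psi v) (xi - eta) by rewrite /dot3/=; ring.
apply: le_trans (dot3_AMGM _ _ r0) _.
by rewrite ler_pM2r ?invr_gt0// lerD2r ler_pM2l.
Qed.

End lipschitz.

(** * Energy of a packet narrow in frequency *)

Section localisation.
Context {R : realType}.
Variable alpha : R.
Hypothesis alpha0 : 0 < alpha.

Lemma gauss3_sqr c (v x : space3 R) : gauss3 c v x ^+ 2 = gauss3 (2 * c) v x.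
Proof. by rewrite !gauss3E expr2 -expRD; congr expR; ring. Qed.

Lemma dot3_gauss3_sqr_le c (v x : space3 R) : 0 < c ->
  dot3 (x - v) (x - v) * gauss3 c v x ^+ 2 <= c^-1 * gauss3 c v x.
Proof.
move=> c0; rewrite expr2 mulrA ler_pM2r ?expR_gt0//; last first.
  by rewrite gauss3E expR_gt0.
set D := dot3 _ _; rewrite gauss3E -/D.
have D0 : 0 <= c * D by rewrite mulr_ge0 ?dot3_ge0// ltW.
apply: (@le_trans _ _ (D * (1 + c * D)^-1)).
  by rewrite ler_wpM2l ?dot3_ge0// expRN_le.
rewrite ler_pdivrMr ?ltr_pwDl//.
have : 0 <= c^-1 by rewrite invr_ge0 ltW.
by rewrite mulrDr mulr1 mulKf ?gt_eqF//; lra.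
Qed.

Lemma bessel_symbol_ge (l : R) (xi : space3 R) : 0 <= l -> l <= `|xi.2| ->
  l `^ alpha <= bessel_symbol alpha xi.
Proof.
move=> l0 lxi; rewrite /bessel_symbol.
have -> : l `^ alpha = (l ^+ 2) `^ (alpha / 2).
  by rewrite -powR_mulrn// -powRrM; congr (_ `^ _); field.
rewrite ge0_ler_powR ?nnegrE ?sqr_ge0 ?add1_dot3_ge0//; first by rewrite divr_ge0// ltW.
have : l ^+ 2 <= xi.2 ^+ 2 by rewrite -[leRHS]real_normK ?num_real// lerXn2r ?nnegrE.
have := sqr_ge0 xi.1.1; have := sqr_ge0 xi.1.2.
by rewrite /dot3 !expr2; lra.
Qed.

(** If [|xi_3| >= l/2], the symbol is at least [(l/2)^alpha]. Otherwise [|xi - l e_3| >= l/2] and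
    the subtracted term makes the left side nonpositive. That term tends to 0 as [c] grows, and the
    minorant is a combination of Gaussians with known integrals. *)
Lemma bessel_gauss3_ge c (l : R) (xi : space3 R) : 0 < c -> 0 < l ->
  (l / 2) `^ alpha * (gauss3 (2 * c) (0, 0, l) xi - 4 / (c * l ^+ 2) * gauss3 c (0, 0, l) xi)
  <= bessel_symbol alpha xi * gauss3 c (0, 0, l) xi ^+ 2.
Proof.
move=> c0 l0; set v : space3 R := (0, 0, l); set G := gauss3 c v xi.
have G0 : 0 <= G by exact: gauss3_ge0.
rewrite -gauss3_sqr -/G.
have l20 : 0 < l ^+ 2 by rewrite exprn_gt0.
have P0 : 0 <= (l / 2) `^ alpha by exact: powR_ge0.
have H : dot3 (xi - v) (xi - v) * G ^+ 2 <= c^-1 * G by exact: dot3_gauss3_sqr_le.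
have [h|h] := leP (l / 2) `|xi.2|.
  apply: (@le_trans _ _ ((l / 2) `^ alpha * G ^+ 2)).
    rewrite ler_wpM2l// lerBlDr lerDl mulr_ge0//.
    by rewrite divr_ge0// ltW// mulr_gt0.
  by rewrite ler_wpM2r ?sqr_ge0// bessel_symbol_ge// divr_ge0// ltW.
apply: (@le_trans _ _ 0); last by rewrite mulr_ge0 ?powR_ge0 ?sqr_ge0.
rewrite mulr_ge0_le0// subr_le0.
have -> : 4 / (c * l ^+ 2) * G = 4 / l ^+ 2 * (c^-1 * G).
  by field; rewrite !gt_eqF.
apply: le_trans (ler_wpM2l _ H); last by rewrite divr_ge0// ltW.
rewrite mulrA ler_peMl ?sqr_ge0//.
rewrite mulrAC ler_pdivlMr// mul1r.
have hh : l / 2 <= `|xi.2 - l|.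
  move: h; rewrite ltr_norml => /andP[h1 h2].
  rewrite ler_normr; apply/orP; right; lra.
have : (l / 2) ^+ 2 <= (xi.2 - l) ^+ 2.
  by rewrite -[leRHS]real_normK ?num_real// lerXn2r ?nnegrE// divr_ge0// ltW.
have := sqr_ge0 xi.1.1; have := sqr_ge0 xi.1.2.
rewrite /dot3 /v/= !subr0 !expr2; lra.
Qed.

End localisation.

(** The limit [r -> 0] without limits: if [X > B], some admissible [r] has [r Y <= (X - B)/2]. *)
Lemma le_of_small (R : realType) (X B Y r0 : R) : 0 < r0 ->
  (forall r, 0 < r -> r <= r0 -> X <= B + r * Y) -> X <= B.
Proof.
move=> r00 H; rewrite leNgt; apply/negP => BX.
pose r := Num.min r0 ((X - B) / (2 * (`|Y| + 1))).
have D0 : 0 < 2 * (`|Y| + 1) by rewrite mulr_gt0// ltr_wpDl.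
have r_gt0 : 0 < r by rewrite lt_min r00 divr_gt0// subr_gt0.
have rr0 : r <= r0 by rewrite ge_min lexx.
have := H r r_gt0 rr0.
have : r * Y <= (X - B) / 2.
  apply: (@le_trans _ _ ((X - B) / (2 * (`|Y| + 1)) * (`|Y| + 1))).
    apply: (@le_trans _ _ (r * (`|Y| + 1))).
      by rewrite ler_pM2l// (le_trans (ler_norm Y))// lerDl.
    by rewrite ler_pM2r ?ltr_wpDl// ge_min lexx orbT.
  rewrite le_eqVlt; apply/orP; left; apply/eqP; field.
  by rewrite gt_eqF// ltr_wpDl.
lra.
Qed.

Section axial.
Context {R : realType}.

Lemma sqrt3M (x y : R) : 0 <= x -> Num.sqrt (x * y) ^+ 3 = Num.sqrt x ^+ 3 * Num.sqrt y ^+ 3.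
Proof. by move=> x0; rewrite sqrtrM// exprMn. Qed.

Lemma le_sqrt3 (x y : R) : x <= y -> Num.sqrt x ^+ 3 <= Num.sqrt y ^+ 3.
Proof. by move=> xy; rewrite lerXn2r ?nnegrE ?sqrtr_ge0// ler_wsqrtr. Qed.

Section lower.
Variables (alpha : R) (d : measure_display) (V : measurableType d).
Variable mu : {sigma_finite_measure set V -> \bar R}.
Variables (k : V -> R) (Psi : V -> space3 R) (rho l m0 : R).
Hypotheses (alpha0 : 0 < alpha) (Ik : mu.-intg k) (mPsi : measurable_fun setT Psi).
Hypothesis Psi_le : forall v, dot3 (Psi v) (Psi v) <= rho.
Hypotheses (l0 : 0 < l) (m00 : 0 <= m0).
Local Notation M := (multiplier mu k Psi).
Hypotheses (Mp : M (0, 0, l) = m0) (Mm : M (0, 0, - l) = m0).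
(** With [c^-1 = 4 r^2], Young's bound with weight [r] becomes
    [r rho/2 + 4 r^2/(2r) = r (rho + 4)/2]. *)
Let K1 := (\int[mu]_v `|k v|) * ((rho + 4) / 2).

Lemma K1_ge0 : 0 <= rho -> 0 <= K1.
Proof. by move=> h; rewrite mulr_ge0 ?Rintegral_ge0// divr_ge0// addr_ge0. Qed.

Let multiplier_gauss3_le (r : R) v xi : 0 < r -> r <= 1 -> 0 <= rho -> M v = m0 ->
  `|M xi - m0| * gauss3 (4 * r ^+ 2)^-1 v xi ^+ 2 <= r * K1 * gauss3 (4 * r ^+ 2)^-1 v xi.
Proof.
move=> r0 r1 rho0 Mv; set c := (4 * r ^+ 2)^-1; set G := gauss3 c v xi.
have c0 : 0 < c by rewrite invr_gt0 mulr_gt0// exprn_gt0.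
have G0 : 0 <= G by exact: gauss3_ge0.
have G1 : G ^+ 2 <= G.
  by rewrite expr2 ler_piMl// gauss3_le1// ltW.
have H := dot3_gauss3_sqr_le v xi c0; rewrite -/G in H.
have I0 : 0 <= \int[mu]_v `|k v| by exact: Rintegral_ge0.
rewrite -Mv; apply: le_trans (ler_wpM2r (sqr_ge0 _) (multiplier_lipschitz Ik mPsi Psi_le xi v r0)) _.
rewrite -[leLHS]mulrA /K1 [leRHS](_ : _ = (\int[mu]_v `|k v|) * (r * ((rho + 4) / 2) * G)); last by ring.
rewrite ler_wpM2l//.
set D := dot3 _ _ in H *.
have cE : c^-1 = 4 * r ^+ 2 by rewrite /c invrK.
rewrite cE in H.
have -> : (r * rho + D / r) / 2 * G ^+ 2 = r * rho / 2 * G ^+ 2 + (D * G ^+ 2) / (2 * r).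
  by field; rewrite gt_eqF.
have -> : r * ((rho + 4) / 2) * G = r * rho / 2 * G + (4 * r ^+ 2 * G) / (2 * r).
  by field; rewrite gt_eqF.
apply: lerD.
  by rewrite ler_wpM2l// divr_ge0// mulr_ge0// ltW.
by rewrite ler_pM2r// invr_gt0 mulr_gt0.
Qed.

(** The energy is bounded below by integrating Gaussians. The two errors are the symbol below height
    [l/2], of order [r^2/l^2], and the variation of the multiplier across a bump, of order [r]. The
    factor 32 is [16 * 8/4], and 64 bounds the cube of [sqrt 8]. *)
Lemma packet_energy_ge (r : R) : 0 < r -> r <= 1 / 4 -> 0 <= rho ->
  (Num.sqrt (pi / r ^+ 2) ^+ 3) ^+ 2 * Num.sqrt (pi * r ^+ 2) ^+ 3 *
  (m0 / 4 * (l / 2) `^ alpha - r * (32 * m0 * (l / 2) `^ alpha / l ^+ 2 +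
     64 * K1 * (bessel_const alpha 1 * expR (2 * 1 * l ^+ 2)))) <=
  \int[L3]_xi (bessel_symbol alpha xi * packet_hat (r ^+ 2) l xi ^+ 2 * M xi).
Proof.
move=> r0 r4 rho0; set a := r ^+ 2.
have a0 : 0 < a by rewrite exprn_gt0.
have r1 : r <= 1 by lra.
have ar : a <= r by rewrite /a expr2 ler_piMl// ltW.
set c := (4 * a)^-1.
have c0 : 0 < c by rewrite invr_gt0 mulr_gt0.
have c20 : 0 < c / 2 by rewrite divr_gt0.
have c20' : 0 < 2 * c by rewrite mulr_gt0.
(* Here [r <= 1/4] is used: [bessel_gauss3_le] will be applied with [tau = 1], and
   [c/4 = 1/(16 r^2)]. *)
have tau_le : 1 <= c / 4.
  rewrite /c -invfM -[leLHS]invr1 lef_pV2 ?posrE ?mulr_gt0//.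
  have : a <= (1 / 4) ^+ 2 by rewrite /a lerXn2r ?nnegrE ?divr_ge0// ltW.
  by rewrite expr2; lra.
set T := Num.sqrt (pi / a) ^+ 3.
have T0 : 0 <= T by rewrite exprn_ge0 ?sqrtr_ge0.
have TE : Num.sqrt (pi / a) ^+ 3 = T by [].
clearbody T.
set vp : space3 R := (0, 0, l); set vm : space3 R := (0, 0, - l).
set P := (l / 2) `^ alpha.
have P0 : 0 <= P by exact: powR_ge0.
set Kb := bessel_const alpha 1 * expR (2 * 1 * l ^+ 2).
have Kb0 : 0 <= Kb by rewrite mulr_ge0 ?expR_ge0 ?powR_ge0.
have K10 := K1_ge0 rho0.
have rK0 : 0 <= r * K1 by rewrite mulr_ge0// ltW.
have dv : dot3 vp vp = l ^+ 2 by rewrite /dot3/= !mulr0 !add0r expr2.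
have dvm : dot3 vm vm = l ^+ 2 by rewrite /dot3/= !mulr0 !add0r mulrNN expr2.
pose low xi := T ^+ 2 * (m0 / 4 * (P * (gauss3 (2 * c) vp xi - 4 / (c * l ^+ 2) * gauss3 c vp xi)) -
  r * K1 / 2 * Kb * (gauss3 (c / 2) vp xi + gauss3 (c / 2) vm xi)).
have Ilow : L3.-intg low.
  apply: intgZl; apply: intgB.
    apply: intgZl; apply: intgZl; apply: intgB; first exact: intg_gauss3.
    by apply: intgZl; exact: intg_gauss3.
  by apply: intgZl; apply: intgD; exact: intg_gauss3.
have low_le xi : low xi <= bessel_symbol alpha xi * packet_hat a l xi ^+ 2 * M xi.
  rewrite /low /packet_hat TE -/c -/vp -/vm.
  have E1 := bessel_gauss3_ge alpha0 xi c0 l0; rewrite -/vp -/P in E1.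
  have E2 := multiplier_gauss3_le (v := vp) xi r0 r1 rho0 Mp; rewrite -/a -/c in E2.
  have E3 := multiplier_gauss3_le (v := vm) xi r0 r1 rho0 Mm; rewrite -/a -/c in E3.
  have E4 := bessel_gauss3_le alpha0 vp xi ltr01 tau_le; rewrite dv -/Kb in E4.
  have E5 := bessel_gauss3_le alpha0 vm xi ltr01 tau_le; rewrite dvm -/Kb in E5.
  have b0 := bessel_symbol_ge0 alpha xi.
  move: E1 E2 E3 E4 E5 b0.
  have := gauss3_ge0 c vp xi; have := gauss3_ge0 c vm xi.
  set b := bessel_symbol alpha xi; set Gp := gauss3 c vp xi; set Gm := gauss3 c vm xi.
  set gp := gauss3 (c / 2) vp xi; set gm := gauss3 (c / 2) vm xi.
  set Q := gauss3 (2 * c) vp xi - _; set m := M xi => Gm0 Gp0 E1 E2 E3 E4 E5 b0.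
  rewrite [leRHS](_ : _ = T ^+ 2 * (b * ((Gp + Gm) / 2) ^+ 2 * m)); last by ring.
  rewrite ler_wpM2l ?sqr_ge0//.
  have h0 : 0 <= ((Gp + Gm) / 2) ^+ 2 by exact: sqr_ge0.
  (* For the main term the bump at [l e_3] suffices, at the price of the factor 1/4; the error term
     needs both bumps. *)
  have h1 : Gp ^+ 2 / 4 <= ((Gp + Gm) / 2) ^+ 2.
    by rewrite !expr2; have := mulr_ge0 Gp0 Gm0; have := mulr_ge0 Gm0 Gm0; lra.
  have h2 : ((Gp + Gm) / 2) ^+ 2 <= (Gp ^+ 2 + Gm ^+ 2) / 2.
    by have := sqr_ge0 (Gp - Gm); rewrite !expr2; lra.
  set H := ((Gp + Gm) / 2) ^+ 2 in h0 h1 h2 *.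
  have A1 : m0 / 4 * (P * Q) <= m0 * (b * H).
    apply: (@le_trans _ _ (m0 / 4 * (b * Gp ^+ 2))).
      by rewrite ler_wpM2l// divr_ge0.
    rewrite [leLHS](_ : _ = m0 * (b * (Gp ^+ 2 / 4))); last by ring.
    by rewrite ler_wpM2l// ler_wpM2l.
  have A2 : b * H * `|m - m0| <= r * K1 / 2 * Kb * (gp + gm).
    apply: (@le_trans _ _ (b * (`|m - m0| * Gp ^+ 2 + `|m - m0| * Gm ^+ 2) / 2)).
      rewrite [leLHS](_ : _ = b * `|m - m0| * H); last by ring.
      rewrite [leRHS](_ : _ = b * `|m - m0| * ((Gp ^+ 2 + Gm ^+ 2) / 2)); last by ring.
      by rewrite ler_wpM2l// mulr_ge0.
    apply: (@le_trans _ _ (b * (r * K1 * Gp + r * K1 * Gm) / 2)).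
      by rewrite ler_pM2r ?invr_gt0// ler_wpM2l// lerD.
    rewrite [leLHS](_ : _ = r * K1 / 2 * (b * Gp + b * Gm)); last by ring.
    by rewrite -[leRHS]mulrA ler_wpM2l ?divr_ge0// mulrDr lerD.
  have A3 : - (b * H * `|m - m0|) <= b * H * (m - m0).
    rewrite -mulrN ler_wpM2l//; first exact: mulr_ge0.
    by have := ler_norm (- (m - m0)); rewrite normrN; lra.
  rewrite [leRHS](_ : _ = m0 * (b * H) + b * H * (m - m0)); last by ring.
  lra.
apply: le_trans (Rint_le Ilow (intg_bessel_packet_multiplier l alpha0 a0 Ik mPsi) low_le).
rewrite /low RintegralZl//; last first.
  apply: intgB.
    apply: intgZl; apply: intgZl; apply: intgB; first exact: intg_gauss3.
    by apply: intgZl; exact: intg_gauss3.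
  by apply: intgZl; apply: intgD; exact: intg_gauss3.
rewrite -mulrA ler_wpM2l ?sqr_ge0//.
have Ip c' (v : space3 R) : 0 < c' -> L3.-intg (gauss3 c' v) by exact: intg_gauss3.
have IQ : L3.-intg (fun xi => gauss3 (2 * c) vp xi - 4 / (c * l ^+ 2) * gauss3 c vp xi).
  by apply: intgB; [exact: Ip|apply: intgZl; exact: Ip].
have IQ2 : L3.-intg (fun xi => gauss3 (c / 2) vp xi + gauss3 (c / 2) vm xi).
  by apply: intgD; exact: Ip.
rewrite RintegralB//; [|by apply: intgZl; exact: intgZl|by apply: intgZl].
rewrite !RintegralZl//; [|exact: intgZl].
rewrite RintegralB//; [|exact: Ip|by apply: intgZl; exact: Ip].
rewrite RintegralD//; [|exact: Ip..].
rewrite RintegralZl//; last exact: Ip.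
rewrite !Rintegral_gauss3//.
have pa0 : 0 <= pi * a by rewrite mulr_ge0 ?pi_ge0// ltW.
have -> : pi / (2 * c) = pi * a * 2 by rewrite /c; field; rewrite gt_eqF.
have -> : pi / c = pi * a * 4 by rewrite /c; field; rewrite gt_eqF.
have -> : pi / (c / 2) = pi * a * 8 by rewrite /c; field; rewrite gt_eqF.
rewrite !(sqrt3M _ pa0); set Q := Num.sqrt (pi * a) ^+ 3.
have Q0 : 0 <= Q by rewrite exprn_ge0 ?sqrtr_ge0.
clearbody Q.
have s4 : Num.sqrt 4 ^+ 3 = 8 :> R.
  by rewrite (_ : 4 = 2 ^+ 2) ?sqrtr_sqr ?ger0_norm//; ring.
have s2 : 1 <= Num.sqrt 2 ^+ 3 :> R.
  rewrite -[leLHS](expr1n _ 3) lerXn2r ?nnegrE ?sqrtr_ge0//.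
  by rewrite -[leLHS]sqrtr1 ler_wsqrtr// ler1n.
have s8 : Num.sqrt 8 ^+ 3 <= 64 :> R.
  rewrite [leRHS](_ : 64 = 4 ^+ 3); last by ring.
  rewrite lerXn2r ?nnegrE ?sqrtr_ge0//.
  rewrite [leRHS](_ : 4 = Num.sqrt (4 ^+ 2)); last by rewrite sqrtr_sqr ger0_norm.
  by rewrite ler_wsqrtr//; lra.
rewrite s4; set S2 := Num.sqrt 2 ^+ 3 in s2 *; set S8 := Num.sqrt 8 ^+ 3 in s8 *.
clearbody S2 S8.
have -> : 4 / (c * l ^+ 2) = 16 * a / l ^+ 2.
  by rewrite /c; field; rewrite !gt_eqF.
have il0 : 0 <= m0 * P / l ^+ 2 by rewrite divr_ge0 ?mulr_ge0// ltW// exprn_gt0.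
have F1 : m0 * P * Q * 1 <= m0 * P * Q * S2 by rewrite ler_wpM2l// !mulr_ge0.
have F2 : m0 * P / l ^+ 2 * Q * a <= m0 * P / l ^+ 2 * Q * r by rewrite ler_wpM2l// mulr_ge0.
have F3 : r * K1 * Kb * Q * S8 <= r * K1 * Kb * Q * 64.
  by rewrite ler_wpM2l//; apply: mulr_ge0 => //; exact: mulr_ge0.
clear -F1 F2 F3.
set li := (l ^+ 2)^-1 in F2 *; clearbody li.
clearbody a P Kb K1.
lra.
Qed.

End lower.
End axial.

(** * Decay on the axis forced by boundedness *)

Section axial_decay.
Context {R : realType}.
Local Notation L2 := (@L2 R).
Local Notation L3 := (@L3 R).
Variables (s t p q alpha : R).
Hypotheses (s0 : 0 < s) (st : s < t) (alpha0 : 0 < alpha) (p1 : 1 < p).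
Hypothesis pq : p^-1 + q^-1 = 1.

(* The Fourier transform of the torus at (0, 0, l), real by symmetry. *)
Definition axial (s l : R) : R := \int[L2]_w (box1 w * cos (l * (s * sin w.1))).

(** The normalisations in space and in frequency are reciprocal, so [a] disappears from the
    inequality once one factor [sqrt(pi/a)^3] is cancelled. *)
Lemma sqrt3_pi (a : R) : 0 < a ->
  Num.sqrt (pi / a) ^+ 3 * Num.sqrt (pi * a) ^+ 3 = pi ^+ 3.
Proof.
move=> a0; rewrite -exprMn -sqrtrM; last by rewrite divr_ge0 ?pi_ge0// ltW.
rewrite (_ : pi / a * (pi * a) = pi ^+ 2); last by field; rewrite gt_eqF.
by rewrite sqrtr_sqr ger0_norm ?pi_ge0.
Qed.

(** The reason a single packet does not see [p]: its bounds in [L^p] and [L^q] multiply to the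
    Gaussian mass [T]. *)
Lemma conj_powR (T : R) : 0 < T -> T `^ p^-1 * T `^ q^-1 = T.
Proof. by move=> T0; rewrite -powRD ?pq ?powRr1 ?ltW// gt_eqF// implybT. Qed.

Lemma in_Lp_real (f : space3 R -> R) (N : R) : measurable_fun setT f ->
  (Lp_norm p (fun x => (f x)%:C%C) <= N%:E)%E -> in_Lp p (fun x => (f x)%:C%C).
Proof.
move=> mf fN; split => //.
by apply: le_lt_trans fN _; rewrite ltry.
Qed.

Lemma axial_decay : bounded_Lp_Sobolev p alpha (torus_average s t) ->
  exists B : R, forall l, 0 < l -> `|axial s l| * (l / 2) `^ alpha <= B.
Proof.
move=> /(key_inequality alpha0 p1 pq)[C C0 HC].
have p0 : 0 < p by apply: lt_trans p1.
(* The 4 undoes [m0 / 4] in [packet_energy_ge], and [pi^3] is the value in [sqrt3_pi]. *)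
exists (4 * (C / pi ^+ 3)) => l l0.
(* The sign makes the multiplier at [l e_3] and [-l e_3] equal to [|axial s l|], since
   [packet_energy_ge] asks for a nonnegative value there. *)
pose sg : R := if 0 <= axial s l then 1 else -1.
have sg1 : `|sg| = 1 by rewrite /sg; case: ifP => _; rewrite ?normrN normr1.
have sgS : sg * axial s l = `|axial s l|.
  by rewrite /sg; case: ifPn; [move/ger0_norm ->; rewrite mul1r|rewrite -ltNge => /ltr0_norm ->; rewrite mulN1r].
pose k := fun w : R * R => sg * box1 w.
have Ik : L2.-intg k by apply: intgZl; exact: intg_box1.
have mT := measurable_torus s t.
have Mval l' : (l' = l \/ l' = - l) -> multiplier L2 k (torus s t) (0, 0, l') = `|axial s l|.
  move=> hl; rewrite -sgS /multiplier /axial -RintegralZl//; last first.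
    apply: (intg_dominated _ intg_box1); last first.
      by move=> w; rewrite normrM ger0_norm ?box1_ge0// ler_piMr ?box1_ge0// cos_norm_le1.
    apply: measurable_funM; first exact: intg_measurable intg_box1.
    apply: (measurableT_comp measurable_cosT); apply: measurable_funM => //; apply: measurable_funM => //.
    apply: measurableT_comp => //; apply: continuous_measurable_fun; exact: continuous_sin.
  apply: eq_Rintegral => w _; rewrite /k mulrA; congr (_ * _).
  rewrite /dot3/= !mulr0 !add0r mulrC; case: hl => -> //.
  by rewrite mulNr cosN.
have Mp := Mval l (or_introl erefl); have Mm := Mval (- l) (or_intror erefl).
have rhoP (w : R * R) : dot3 (torus s t w) (torus s t w) <= (s + t) ^+ 2 + s ^+ 2.
  by apply: dot3_torus_le; rewrite ltW// (lt_trans s0 st).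
have rho0 : 0 <= (s + t) ^+ 2 + s ^+ 2 by rewrite addr_ge0 ?sqr_ge0.
rewrite -ler_pdivrMl// mulrA (mulrC 4^-1).
pose Y := 32 * `|axial s l| * (l / 2) `^ alpha / l ^+ 2 +
  64 * (\int[L2]_v `|k v| * (((s + t) ^+ 2 + s ^+ 2 + 4) / 2)) *
  (bessel_const alpha 1 * expR (2 * 1 * l ^+ 2)).
apply: (@le_of_small _ _ _ Y (1 / 4)); first by rewrite divr_gt0.
move=> r r0 r4; rewrite -lerBlDr.
have a0 : 0 < r ^+ 2 by rewrite exprn_gt0.
have E := packet_energy_ge alpha0 Ik mT rhoP l0 (normr_ge0 _) Mp Mm r0 r4 rho0.
set T := Num.sqrt (pi / r ^+ 2) ^+ 3 in E.
have T0 : 0 < T by rewrite exprn_gt0// sqrtr_gt0 divr_gt0// pi_gt0.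
pose f x := sg * packet (r ^+ 2) l x.
have fN : (Lp_norm p (fun x => (f x)%:C%C) <= (T `^ p^-1)%:E)%E.
  have -> : Lp_norm p (fun x => (f x)%:C%C) = Lp_norm p (fun x => (packet (r ^+ 2) l x)%:C%C).
    by apply: eq_Lnorm => x; rewrite /comp !normc_real /f normrM sg1 mul1r.
  apply: le_trans (Lp_norm_packet l p0 a0) _; rewrite lee_fin.
  apply: ge0_ler_powR; rewrite ?nnegrE ?exprn_ge0 ?sqrtr_ge0//.
    by rewrite invr_ge0 ltW.
  apply: le_sqrt3; rewrite ler_pM2l ?pi_gt0// lef_pV2 ?posrE ?mulr_gt0//.
  by rewrite ler_peMl// ltW.
have mf : measurable_fun setT f.
  apply: measurable_funM => //; have := intg_measurable (intg_packet l 0 a0).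
  by under eq_fun do rewrite subr0.
have H := HC f (T `^ p^-1) (r ^+ 2) l _ _ L2 k (torus s t) (in_Lp_real mf fN)
  (powR_gt0 _ T0) fN a0 Ik mT.
have {}H : `|\int[L3]_xi (bessel_symbol alpha xi * packet_hat (r ^+ 2) l xi ^+ 2 *
    multiplier L2 k (torus s t) xi)| <= C * T.
  rewrite -[X in _ <= C * X](conj_powR T0) mulrA; apply: H => x.
  by apply: eq_Rintegral => w _; rewrite /f /k mulrCA mulrA.
have {}E := le_trans E (le_trans (ler_norm _) H).
rewrite ler_pdivlMr ?exprn_gt0 ?pi_gt0//.
rewrite -(sqrt3_pi a0) -/T -(ler_pM2l T0).
rewrite [leRHS]mulrC; apply: le_trans E.
rewrite le_eqVlt; apply/orP; left; apply/eqP; rewrite /Y.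
set Q := Num.sqrt (pi * _) ^+ 3; clearbody Q T.
set P := (l / 2) `^ alpha; set Ax := `|axial s l|.
set B1 := 32 * Ax * P / l ^+ 2; set B2 := _ * (bessel_const _ _ * _).
by field.
Qed.

End axial_decay.

(** * Gaussian means of the axial transform *)

Section axial_lower.
Context {R : realType}.
Local Notation L1 := (@L1 R).
Local Notation L2 := (@L2 R).

Lemma abs_sin_le (y : R) : `|sin y| <= `|y|.
Proof.
have := cos_lipschitz (y - pi / 2) (- (pi / 2)).
by rewrite cosN cos_pihalf subr0 cosB cos_pihalf sin_pihalf mulr0 add0r mulr1 opprK subrK.
Qed.

(** Half-angle formula. This second-order contact with the horizontal plane at [theta = pi/2] is the
    source of the exponent 1/2. *)
Lemma one_sub_sin_le (x : R) : 1 - sin x <= (x - pi / 2) ^+ 2 / 2.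
Proof.
set u := x - pi / 2.
have -> : sin x = cos u by rewrite /u cosB cos_pihalf sin_pihalf mulr0 add0r mulr1.
have -> : cos u = 1 - 2 * sin (u / 2) ^+ 2.
  rewrite [in LHS](splitr u) cosD -!expr2.
  by have := cos2Dsin2 (u / 2); lra.
have : sin (u / 2) ^+ 2 <= (u / 2) ^+ 2.
  rewrite -real_normK ?num_real// -[leRHS]real_normK ?num_real//.
  by rewrite lerXn2r ?nnegrE// abs_sin_le.
rewrite [in X in _ <= X -> _]expr2 [in X in _ -> _ <= X]expr2; lra.
Qed.

Variable s : R.
Hypothesis s0 : 0 < s.

Let my : measurable_fun setT (fun w : R * R => s * sin w.1).
Proof.
apply: measurable_funM => //; apply: measurableT_comp => //.
by apply: continuous_measurable_fun; exact: continuous_sin.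
Qed.

Let intg_ax l : L2.-intg (fun w => box1 w * cos (l * (s * sin w.1))).
Proof.
apply: (intg_dominated _ intg_box1); last first.
  by move=> w; rewrite normrM ger0_norm ?box1_ge0// ler_piMr ?box1_ge0// cos_norm_le1.
apply: measurable_funM; first exact: intg_measurable intg_box1.
by apply: (measurableT_comp measurable_cosT); apply: measurable_funM.
Qed.

Lemma axialN l : axial s (- l) = axial s l.
Proof. by apply: eq_Rintegral => w _; rewrite mulNr cosN. Qed.

Lemma axial_le l : `|axial s l| <= (2 * pi) ^+ 2.
Proof.
rewrite -Rintegral_box1; apply: (Rint_norm_le _ intg_box1).
  exact: intg_measurable (intg_ax l).
by move=> w; rewrite normrM ger0_norm ?box1_ge0// ler_piMr ?box1_ge0// cos_norm_le1.
Qed.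

Let mbox1 : measurable_fun setT (fun z : R * (R * R) => box1 z.2).
Proof. exact: (measurableT_comp (intg_measurable intg_box1)). Qed.

Let mF : measurable_fun setT (fun z : R * (R * R) => box1 z.2 * cos (z.1 * (s * sin z.2.1))).
Proof.
apply: measurable_funM => //; apply: (measurableT_comp measurable_cosT).
apply: measurable_funM => //.
exact: (measurableT_comp my).
Qed.

Lemma measurable_axial : measurable_fun setT (axial s).
Proof.
exact: (@measurable_Rintegral2 _ _ _ _ _ L2 (fun z : R * (R * R) => box1 z.2 * cos (z.1 * (s * sin z.2.1)))).
Qed.

Lemma intg_axial tau : 0 < tau -> L1.-intg (fun l => `|axial s l| * gauss1 tau 0 l).
Proof.
move=> t0; apply: (intg_dominated _ (intgZl ((2 * pi) ^+ 2) (intg_gauss1 0 t0))).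
  apply: measurable_funM; last exact: measurable_gauss1.
  by apply: measurableT_comp => //; exact: measurable_axial.
by move=> l; rewrite normrM normr_id (ger0_norm (gauss1_ge0 _ _ _)) ler_wpM2r ?gauss1_ge0 ?axial_le.
Qed.

(** The factor [cos (l * s)] shifts the phases [l s sin theta] by [l s] and [-l s]. Integrating
    first in [l] then turns an oscillatory integral into positive Gaussians in the distance from the
    height to [-s] and [s]. *)
Lemma axial_gauss_mean tau : 0 < tau ->
  \int[L1]_l (axial s l * (cos (l * s) * gauss1 tau 0 l)) =
  \int[L2]_w (box1 w * (Num.sqrt (pi / tau) / 2 *
    (expR (- ((s * sin w.1 + s) ^+ 2 / (4 * tau))) + expR (- ((s * sin w.1 - s) ^+ 2 / (4 * tau)))))).
Proof.
move=> t0.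
pose F (z : R * (R * R)) := box1 z.2 * cos (z.1 * (s * sin z.2.1)) * (cos (z.1 * s) * gauss1 tau 0 z.1).
have mg : measurable_fun setT (fun l : R => cos (l * s) * gauss1 tau 0 l).
  apply: measurable_funM; last exact: measurable_gauss1.
  by apply: (measurableT_comp measurable_cosT); apply: measurable_funM.
have IF : (sigma_finite_prod L1 L2).-intg F.
  apply: (intg_dominated _ (@intg_tensor _ _ _ _ _ L1 L2 _ _ (intg_gauss1 0 t0) intg_box1)).
    apply: measurable_funM => //.
    exact: (measurableT_comp mg).
  move=> z; rewrite /F normrM [X in X * _ <= _]normrM [X in _ * X <= _]normrM.
  rewrite (ger0_norm (gauss1_ge0 _ _ _)) (ger0_norm (box1_ge0 _)).
  rewrite [leRHS]mulrC; apply: ler_pM; rewrite ?mulr_ge0 ?gauss1_ge0 ?box1_ge0//.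
    by rewrite ler_piMr ?box1_ge0// cos_norm_le1.
  by rewrite ler_piMl ?gauss1_ge0// cos_norm_le1.
have Iw l : L2.-intg (fun w => F (l, w)).
  exact: (intgZr (cos (l * s) * gauss1 tau 0 l) (intg_ax l)).
have FE w l : F (l, w) = box1 w / 2 * (gauss1 tau 0 l * cos (l * (s * sin w.1 + s) + 0)
    + gauss1 tau 0 l * cos (l * (s * sin w.1 - s) + 0)).
  rewrite /F/= !addr0 (mulrDr l) (mulrBr l) cosD cosB.
  by set A := cos _; set B := cos _; set D := sin _; set E := sin _; field.
have Ig y : L1.-intg (fun l : R => gauss1 tau 0 l * cos (l * y + 0)) by exact: intg_gauss1_cos.
have Il w : L1.-intg (fun l => F (l, w)).
  under eq_fun do rewrite FE.
  by apply: intgZl; apply: intgD.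
transitivity (\int[sigma_finite_prod L1 L2]_z F z).
  rewrite Rintegral_prod12//; apply: eq_Rintegral => l _.
  by rewrite -RintegralZr.
rewrite Rintegral_prod21//; apply: eq_Rintegral => w _.
under eq_Rintegral do rewrite FE.
rewrite RintegralZl//; last exact: intgD.
rewrite RintegralD// !Rintegral_gauss1_cos// !mul0r !addr0 cos0 !mulr1.
by field.
Qed.

(** For [|theta - pi/2| <= rho] the height is within [s rho^2/2] of [s], so by assumption the
    exponential is at least [e^(-1)]; the other Gaussian is dropped. The best choice, [rho] of order
    [tau^(1/4)], gives a mean of order [tau^(-1/4)]. *)
Lemma axial_gauss_lower tau rho : 0 < tau -> 0 < rho -> rho <= 1 ->
  (s * (rho ^+ 2 / 2)) ^+ 2 <= 4 * tau ->
  Num.sqrt (pi / tau) * (pi * expR (- 1)) * (2 * rho) <=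
  \int[L1]_l (`|axial s l| * gauss1 tau 0 l).
Proof.
move=> t0 r0 r1 hr.
have mcos : measurable_fun setT (fun l : R => cos (l * s)).
  by apply: (measurableT_comp measurable_cosT); apply: measurable_funM.
have le1 l : `|axial s l * (cos (l * s) * gauss1 tau 0 l)| <= `|axial s l| * gauss1 tau 0 l.
  rewrite !normrM ler_wpM2l// (ger0_norm (gauss1_ge0 _ _ _)).
  by rewrite ler_piMl ?gauss1_ge0// cos_norm_le1.
apply: (@le_trans _ _ (\int[L1]_l (axial s l * (cos (l * s) * gauss1 tau 0 l)))); last first.
  apply: le_trans (ler_norm _) _; apply: (Rint_norm_le _ (intg_axial t0) le1).
  apply: measurable_funM; first exact: measurable_axial.
  by apply: measurable_funM => //; exact: measurable_gauss1.
rewrite axial_gauss_mean//.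
pose I : set R := `[pi / 2 - rho, pi / 2 + rho]%classic.
have mI : measurable I by exact: measurable_itv.
have lI : L1 I = (2 * rho)%:E.
  rewrite /I [LHS]lebesgue_measure_itv/= lte_fin ifT; last by lra.
  by rewrite -EFinB; congr _%:E; ring.
have II : L1.-intg (\1_I : R -> R).
  apply/integrableP; split; first by apply/measurable_EFinP; exact: measurable_indic.
  under eq_integral do rewrite /= ger0_norm//.
  by rewrite integral_indic// setIT [X in (X < _)%E]lI ltry.
have intI : \int[L1]_x (\1_I x : R) = 2 * rho.
  by rewrite /Rintegral integral_indic// setIT [X in fine X]lI.
set K := Num.sqrt (pi / tau).
have K0 : 0 <= K by exact: sqrtr_ge0.
have It := @intg_tensor _ _ _ _ _ L1 L1 _ _ II intg_angles.
have -> : K * (pi * expR (- 1)) * (2 * rho) =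
    \int[L2]_w (K / 2 * expR (- 1) * (\1_I w.1 * \1_angles w.2)).
  rewrite RintegralZl// (@Rintegral_prod12 _ _ _ _ _ L1 L1)//; last first.
    by move=> x; exact: (intgZl (\1_I x) intg_angles).
  transitivity (K / 2 * expR (-1) * \int[L1]_x (\1_I x * (2 * pi) : R)).
    by rewrite RintegralZr// intI; field.
  congr (_ * _); apply: eq_Rintegral => x _ /=.
  by rewrite RintegralZl ?Rintegral_angles//; exact: intg_angles.
apply: Rint_le.
- exact: intgZl.
- apply: (intg_dominated _ (intgZr (K / 2 * 2) intg_box1)); last first.
    move=> w; rewrite normrM (ger0_norm (box1_ge0 _)) ler_wpM2l ?box1_ge0//.
    rewrite normrM ger0_norm ?divr_ge0// ler_wpM2l ?divr_ge0//.
    rewrite ger0_norm ?addr_ge0 ?expR_ge0//.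
    have e1 y : expR (- (y ^+ 2 / (4 * tau))) <= 1.
      by rewrite -expR0 ler_expR oppr_le0 divr_ge0 ?sqr_ge0// mulr_ge0// ltW.
    by have := e1 (s * sin w.1 + s); have := e1 (s * sin w.1 - s); lra.
  apply: measurable_funM; first exact: intg_measurable intg_box1.
  apply: measurable_funM => //; apply: measurable_funD; apply: measurableT_comp => //;
   apply: measurableT_comp => //; apply: measurable_funM => //; apply: measurable_funX;
   [exact: measurable_funD|exact: measurable_funB].
- move=> w; have [wI|wI] := boolP (w.1 \in I); last first.
    rewrite [\1_I _]indicE (negbTE wI) mul0r mulr0 mulr_ge0 ?box1_ge0//.
    by rewrite mulr_ge0 ?divr_ge0 ?addr_ge0 ?expR_ge0.
  (* With [rho <= 1], this keeps the interval around [pi/2] inside the range of angles. *)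
  have pi1 : 2 <= pi :> R by exact: pi_ge2.
  have wI' : pi / 2 - rho <= w.1 <= pi / 2 + rho by move: wI; rewrite inE /I/= in_itv.
  have wa : w.1 \in (angles : set R).
    by rewrite inE /angles/= in_itv/=; move: wI' => /andP[h1 h2]; apply/andP; split; lra.
  rewrite /box1 [\1_I _]indicE wI [\1_angles w.1]indicE wa !mul1r mulrC.
  rewrite ler_wpM2l ?indicE// ler_wpM2l ?divr_ge0//.
  apply: (@le_trans _ _ (expR (- ((s * sin w.1 - s) ^+ 2 / (4 * tau))))); last first.
    by rewrite lerDr expR_ge0.
  rewrite ler_expR lerN2 ler_pdivrMr ?mulr_gt0// mul1r.
  apply: le_trans hr.
  have h1 : 0 <= 1 - sin w.1 by rewrite subr_ge0 sin_le1.
  have h2 : 1 - sin w.1 <= rho ^+ 2 / 2.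
    apply: le_trans (one_sub_sin_le _) _; rewrite ler_pM2r ?invr_gt0//.
    rewrite -real_normK ?num_real// lerXn2r ?nnegrE ?(ltW r0)//.
    by rewrite ler_norml; move: wI' => /andP[? ?]; apply/andP; split; lra.
  rewrite (_ : s * sin w.1 - s = - (s * (1 - sin w.1))); last by ring.
  rewrite sqrrN; apply: lerXn2r; last by rewrite ler_pM2l.
    by rewrite nnegrE mulr_ge0// ltW.
  by rewrite nnegrE mulr_ge0 ?divr_ge0 ?sqr_ge0// ltW.
Qed.

End axial_lower.

Section growth.
Context {R : realType}.

Lemma expn_dominates (c D x : R) : 0 < c -> 1 < x -> exists n, D < c * x ^+ n.
Proof.
move=> c0 x1; have x10 : 0 < c * (x - 1) by rewrite mulr_gt0// subr_gt0.
exists (Num.bound `|D / (c * (x - 1))|).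
set n := Num.bound _.
have : D / (c * (x - 1)) < n%:R.
  by apply: le_lt_trans (ler_norm _) _; exact: archi_boundP.
rewrite ltr_pdivrMr// => h; apply: lt_le_trans h _.
rewrite mulrCA ler_pM2l//.
have bern : forall m, m%:R * (x - 1) + 1 <= x ^+ m.
  elim => [|m IH]; first by rewrite mul0r add0r expr0.
  rewrite exprS; apply: (@le_trans _ _ (x * (m%:R * (x - 1) + 1))).
    rewrite -natr1; have : 0 <= m%:R * (x - 1) * (x - 1).
      by rewrite !mulr_ge0// subr_ge0 ltW.
    lra.
  by rewrite ler_pM2l// (lt_trans _ x1).
by have := bern n; lra.
Qed.

Lemma powR_lt (a x y : R) : 1 < a -> x < y -> a `^ x < a `^ y.
Proof.
move=> a1 xy; rewrite /powR gt_eqF ?(lt_trans _ a1)//.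
by rewrite ltr_expR ltr_pM2r// ln_gt0.
Qed.

Lemma powR_le_add1 (x g : R) : 0 <= x -> 0 <= g -> g <= 1 -> x `^ g <= 1 + x.
Proof.
move=> x0 g0 g1; have [x1|x1] := leP x 1.
  apply: (@le_trans _ _ 1); last by rewrite lerDl.
  apply: (@le_trans _ _ (1 `^ g)); last by rewrite powR1.
  by rewrite ge0_ler_powR ?nnegrE.
apply: (@le_trans _ _ (x `^ 1)); last by rewrite powRr1// lerDr.
by rewrite ler_powR// ltW.
Qed.

End growth.

(** * Incompatibility of the means with decay faster than [l^(-1/2)] *)

Section axial_no_decay.
Context {R : realType}.
Local Notation L1 := (@L1 R).
Variables (s alpha B : R).
Hypotheses (s0 : 0 < s) (alpha2 : 1 / 2 < alpha).
Hypothesis HB : forall l, 0 < l -> `|axial s l| * (l / 2) `^ alpha <= B.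

(* With 1/2 < beta < 1 the ratio q = 2^(1 - beta) of consecutive dyadic scales below satisfies
   1 < q < sqrt 2, and sqrt 2 is the ratio forced by axial_gauss_lower. *)
Let beta := Num.min alpha (3 / 4).

Let beta_gt : 1 / 2 < beta.
Proof. by rewrite lt_min alpha2/=; lra. Qed.

Let beta_lt : beta < 1.
Proof. by rewrite gt_min; apply/orP; right; lra. Qed.

Let C0 := 2 * (`|B| + (2 * pi) ^+ 2).

Let C00 : 0 < C0.
Proof. by rewrite mulr_gt0// ltr_wpDl// exprn_gt0// mulr_gt0// pi_gt0. Qed.

(** Beyond [l = 2] the assumed decay is weakened from [alpha] to [beta]; below, the trivial bound
    [(2 pi)^2] suffices. The factor 2 in [C0] bounds [2^beta], from rescaling [l/2] to [l], and
    evenness gives negative [l]. *)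
Lemma axial_powR_le l : `|axial s l| * `|l| `^ beta <= C0.
Proof.
have beta0 : 0 < beta by apply: lt_trans beta_gt; lra.
wlog l0 : l / 0 <= l.
  move=> H; have [/H//|/ltW l0] := leP 0 l.
  by rewrite -axialN -(normrN l); apply: H; rewrite oppr_ge0.
have [->|lN0] := eqVneq l 0.
  by rewrite normr0 powR0 ?mulr0 ?ltW// gt_eqF.
have {l0 lN0} l0 : 0 < l by rewrite lt_def lN0.
rewrite (gtr0_norm l0).
have l20 : 0 <= l / 2 by rewrite divr_ge0// ltW.
have -> : l `^ beta = 2 `^ beta * (l / 2) `^ beta.
  by rewrite -powRM//; congr (_ `^ _); field.
have h2 : 2 `^ beta <= 2 :> R.
  apply: (@le_trans _ _ (2 `^ 1)); last by rewrite powRr1.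
  by apply: ler_powR; [rewrite ler1n|exact: ltW].
have A0 := axial_le s l.
have h : `|axial s l| * (l / 2) `^ beta <= `|B| + (2 * pi) ^+ 2.
  have [l1|l1] := leP (l / 2) 1.
    apply: (@le_trans _ _ (`|axial s l| * 1)).
      rewrite ler_wpM2l//; apply: (@le_trans _ _ (1 `^ beta)); last by rewrite powR1.
      by rewrite ge0_ler_powR ?nnegrE// ltW.
    by rewrite mulr1 (le_trans A0)// lerDr.
  apply: (@le_trans _ _ (`|axial s l| * (l / 2) `^ alpha)).
    by rewrite ler_wpM2l// ler_powR ?(ltW l1)// ge_min lexx.
  apply: le_trans (HB l0) _; apply: le_trans (ler_norm B) _.
  by rewrite lerDl sqr_ge0.
by rewrite mulrCA /C0; apply: ler_pM => //; rewrite ?mulr_ge0 ?powR_ge0.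
Qed.

Let J tau := \int[L1]_l (`|axial s l| * gauss1 tau 0 l).

(* Comparing two dyadic scales avoids integrating the singularity of |l|^(-beta) at 0. *)
Lemma gauss_mean_step tau : 0 < tau ->
  J tau - J (4 * tau) <= 6 * C0 * tau `^ (beta / 2) * Num.sqrt (pi / (tau / 2)).
Proof.
move=> t0; have t40 : 0 < 4 * tau by rewrite mulr_gt0.
have t20 : 0 < tau / 2 by rewrite divr_gt0.
rewrite /J -RintegralB//; [|exact: intg_axial..].
rewrite -(Rintegral_gauss1 0 t20) -RintegralZl//; last exact: intg_gauss1.
apply: Rint_le.
- by apply: intgB; exact: intg_axial.
- by apply: intgZl; exact: intg_gauss1.
move=> l; rewrite -mulrBr.
set y := `|l|; set A := `|axial s l|.
have y0 : 0 <= y by exact: normr_ge0.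
have y2 : l ^+ 2 = y ^+ 2 by rewrite /y real_normK ?num_real.
have ty0 : 0 <= tau * y ^+ 2 by rewrite mulr_ge0 ?sqr_ge0// ltW.
have gE c : gauss1 c 0 l = expR (- (c * y ^+ 2)) by rewrite /gauss1 subr0 y2.
have d1 : gauss1 tau 0 l - gauss1 (4 * tau) 0 l <= 3 * (tau * y ^+ 2) * gauss1 tau 0 l.
  have -> : gauss1 (4 * tau) 0 l = gauss1 tau 0 l * expR (- (3 * (tau * y ^+ 2))).
    by rewrite !gE -expRD; congr expR; ring.
  rewrite -[X in X - _]mulr1 -mulrBr mulrC ler_pM2r ?expR_gt0//.
  by have := expR_ge1Dx (- (3 * (tau * y ^+ 2))); lra.
have d2 : (1 + tau * y ^+ 2) * gauss1 tau 0 l <= 2 * gauss1 (tau / 2) 0 l.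
  have -> : gauss1 tau 0 l = expR (- (tau / 2 * y ^+ 2)) * gauss1 (tau / 2) 0 l.
    by rewrite !gE -expRD; congr expR; field.
  rewrite mulrA ler_pM2r ?expR_gt0//.
  rewrite expRN ler_pdivrMr ?expR_gt0//.
  by have := expR_ge1Dx (tau / 2 * y ^+ 2); lra.
(* Splitting [tau y^2 = y^beta tau^(beta/2) (tau y^2)^(1 - beta/2)]: the decay bound takes the first
   factor, and [x^g <= 1 + x] the last. *)
have d3 : A * (tau * y ^+ 2) <= C0 * tau `^ (beta / 2) * (1 + tau * y ^+ 2).
  have -> : A * (tau * y ^+ 2) = A * y `^ beta * (tau `^ (beta / 2) * (tau * y ^+ 2) `^ (1 - beta / 2)).
    have [->|yN0] := eqVneq y 0.
      by rewrite expr0n/= mulr0 mulr0 (@powR0 _ beta) ?mulr0 ?mul0r// gt_eqF// (lt_trans _ beta_gt)// divr_gt0.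
    rewrite -[RHS]mulrA; congr (_ * _).
    have -> : y `^ beta = (y ^+ 2) `^ (beta / 2).
      by rewrite -powR_mulrn// -powRrM; congr (_ `^ _); field.
    rewrite [RHS]mulrCA [RHS]mulrA -powRM ?sqr_ge0 ?(ltW t0)// -powRD.
      by rewrite addrC subrK powRr1.
    by apply/implyP => _; rewrite mulf_neq0 ?expf_neq0// gt_eqF.
  have g0 : 0 <= 1 - beta / 2 by have := beta_lt; lra.
  have g1 : 1 - beta / 2 <= 1 by have := beta_gt; lra.
  rewrite -(mulrA C0); apply: ler_pM.
  - by apply: mulr_ge0; [exact: normr_ge0|exact: powR_ge0].
  - by apply: mulr_ge0; exact: powR_ge0.
  - exact: axial_powR_le.
  - by rewrite ler_wpM2l ?powR_ge0// powR_le_add1.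
apply: (@le_trans _ _ (A * (3 * (tau * y ^+ 2) * gauss1 tau 0 l))).
  by rewrite ler_wpM2l ?normr_ge0.
have -> : A * (3 * (tau * y ^+ 2) * gauss1 tau 0 l) = 3 * (A * (tau * y ^+ 2)) * gauss1 tau 0 l by ring.
apply: (@le_trans _ _ (3 * (C0 * tau `^ (beta / 2) * (1 + tau * y ^+ 2)) * gauss1 tau 0 l)).
  by rewrite ler_wpM2r ?gauss1_ge0// ler_pM2l.
have -> : 3 * (C0 * tau `^ (beta / 2) * (1 + tau * y ^+ 2)) * gauss1 tau 0 l =
  3 * C0 * tau `^ (beta / 2) * ((1 + tau * y ^+ 2) * gauss1 tau 0 l) by ring.
have -> : 6 * C0 * tau `^ (beta / 2) * gauss1 (tau / 2) 0 l =
  3 * C0 * tau `^ (beta / 2) * (2 * gauss1 (tau / 2) 0 l) by ring.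
by rewrite ler_wpM2l// mulr_ge0 ?powR_ge0// mulr_ge0// ltW.
Qed.

Let q := (2 : R) `^ (1 - beta).

Let q_gt1 : 1 < q.
Proof.
rewrite -[ltLHS](powRr0 2) /q; apply: powR_lt; first by rewrite ltr1n.
by have := beta_lt; lra.
Qed.

Let q_lt : q < Num.sqrt 2.
Proof.
rewrite -powR12_sqrt// /q; apply: powR_lt; first by rewrite ltr1n.
by have := beta_gt; lra.
Qed.

(** Equal to [4^(-n)]: consecutive scales differ by the factor 4 of [gauss_mean_step], and the
    Gaussian has width of order [2^n]. *)
Let tau n : R := (2 ^- n) ^+ 2.

Let tau_gt0 n : 0 < tau n.
Proof. by rewrite exprn_gt0// invr_gt0 exprn_gt0. Qed.

Let tauS n : 4 * tau n.+1 = tau n.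
Proof.
rewrite /tau (exprS 2 n) invfM exprMn mulrA (_ : 4 * 2^-1 ^+ 2 = 1) ?mul1r//.
by field.
Qed.

(** The increments are at most [C1 q^(n+1)], and [C1 q^(n+1) = (C1 q/(q - 1)) (q^(n+1) - q^n)]
    telescopes, which dictates the constant. *)
Lemma gauss_mean_upper : exists2 D : R, 0 < D & forall n, J (tau n) <= D * q ^+ n.
Proof.
pose C1 := 6 * C0 * Num.sqrt (pi * 2).
have C10 : 0 < C1.
  by apply: mulr_gt0; [exact: mulr_gt0|rewrite sqrtr_gt0 mulr_gt0// pi_gt0].
have q10 : 0 < q - 1 by rewrite subr_gt0.
exists (`|J (tau 0)| + C1 * q / (q - 1)).
  by rewrite ltr_wpDl// divr_gt0// mulr_gt0// (lt_trans _ q_gt1).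
elim=> [|n IH].
  rewrite expr0 mulr1; apply: le_trans (ler_norm _) _; rewrite lerDl.
  by apply: divr_ge0; [apply: mulr_ge0; [exact: ltW|exact: powR_ge0]|exact: ltW].
have := gauss_mean_step (tau_gt0 n.+1); rewrite tauS.
have -> : 6 * C0 * tau n.+1 `^ (beta / 2) * Num.sqrt (pi / (tau n.+1 / 2)) = C1 * q ^+ n.+1.
  have -> : pi / (tau n.+1 / 2) = pi * 2 * (2 ^+ n.+1) ^+ 2.
    by rewrite /tau; field; rewrite expf_neq0.
  have p20 : 0 <= pi * 2 :> R by rewrite mulr_ge0 ?pi_ge0.
  rewrite sqrtrM// sqrtr_sqr ger0_norm ?exprn_ge0//.
  have -> : tau n.+1 `^ (beta / 2) = (2 ^+ n.+1) `^ (- beta).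
    have X0 : 0 <= 2 ^+ n.+1 :> R by exact: exprn_ge0.
    rewrite /tau; move: (2 ^+ n.+1) X0 => X X0.
    rewrite -powR_mulrn ?invr_ge0// -powRrM -powR_inv1//.
    by rewrite -powRrM; congr (_ `^ _); field.
  have -> : q ^+ n.+1 = (2 ^+ n.+1) `^ (- beta) * 2 ^+ n.+1.
    rewrite /q -powR_mulrn ?powR_ge0// -powRrM mulrC powRrM powR_mulrn//.
    rewrite [1 - beta]addrC powRD ?powRr1 ?exprn_ge0//.
    by rewrite expf_neq0 ?implybT.
  by rewrite /C1; ring.
have h : C1 * q ^+ n.+1 = C1 * q / (q - 1) * (q ^+ n.+1 - q ^+ n).
  by rewrite exprS; field; rewrite gt_eqF.
have h' : `|J (tau 0)| * q ^+ n <= `|J (tau 0)| * q ^+ n.+1.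
  by rewrite ler_wpM2l// exprS ler_peMl ?exprn_ge0 ?powR_ge0// ltW.
move: IH; rewrite h !mulrDl mulrBr; lra.
Qed.

Lemma axial_no_decay : False.
Proof.
have [D D0 HD] := gauss_mean_upper.
(* Chosen so that [rho = kappa 2^(-n/2)] is admissible in [axial_gauss_lower] at scale [tau n]:
   [kappa <= 1] gives [rho <= 1], and [s kappa^2 <= 4] gives the condition on the height. *)
pose kappa := Num.min 1 (2 / Num.sqrt s).
have ss0 : 0 < Num.sqrt s by rewrite sqrtr_gt0.
have k0 : 0 < kappa by rewrite lt_min ltr01 divr_gt0.
have k1 : kappa <= 1 by rewrite ge_min lexx.
have ks : s * kappa ^+ 2 <= 4.
  have : kappa <= 2 / Num.sqrt s by rewrite ge_min lexx orbT.
  move=> h; have : kappa ^+ 2 <= (2 / Num.sqrt s) ^+ 2.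
    by rewrite lerXn2r ?nnegrE ?divr_ge0 ?(ltW k0) ?sqrtr_ge0.
  rewrite exprMn exprVn sqr_sqrtr ?(ltW s0)// ler_pdivlMr// mulrC => h'.
  by apply: le_trans h' _; rewrite expr2; lra.
pose w := Num.sqrt (2^-1 : R).
have w0 : 0 < w by rewrite sqrtr_gt0 invr_gt0.
have w2 : w ^+ 2 = 2^-1 by rewrite sqr_sqrtr// invr_ge0.
have w1 : w <= 1.
  by rewrite -sqrtr1 ler_wsqrtr// invf_le1// ler1n.
pose c := Num.sqrt pi * (pi * expR (- 1)) * (2 * kappa) : R.
have c0 : 0 < c by rewrite !mulr_gt0 ?sqrtr_gt0 ?pi_gt0 ?expR_gt0.
have low n : c * (2 * w) ^+ n <= J (tau n).
  have r0 : 0 < kappa * w ^+ n by rewrite mulr_gt0// exprn_gt0.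
  have r1 : kappa * w ^+ n <= 1.
    by rewrite mulr_ile1 ?exprn_ile1 ?(ltW k0) ?exprn_ge0 ?(ltW w0).
  have hr : (s * ((kappa * w ^+ n) ^+ 2 / 2)) ^+ 2 <= 4 * tau n.
    have -> : s * ((kappa * w ^+ n) ^+ 2 / 2) = s * kappa ^+ 2 / 2 * 2 ^- n.
      by rewrite exprMn -exprM mulnC exprM w2 exprVn; field; rewrite expf_neq0.
    rewrite exprMn -/(tau n) ler_pM2r ?tau_gt0//.
    rewrite [leRHS](_ : 4 = 2 ^+ 2); last by ring.
    apply: lerXn2r; rewrite ?nnegrE//; last by lra.
    by rewrite divr_ge0// mulr_ge0 ?sqr_ge0// ltW.
  apply: le_trans (axial_gauss_lower s0 (tau_gt0 n) r0 r1 hr).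
  rewrite le_eqVlt; apply/orP; left; apply/eqP.
  have -> : pi / tau n = pi * (2 ^+ n) ^+ 2.
    by rewrite /tau; field; rewrite expf_neq0.
  rewrite sqrtrM ?pi_ge0// sqrtr_sqr ger0_norm ?exprn_ge0// /c exprMn; ring.
(* The lower bound grows like [(sqrt 2)^n] and the upper one like [q^n] with [q < sqrt 2]. *)
have W : 2 * w = Num.sqrt 2.
  have : (2 * w) ^+ 2 = 2 by rewrite exprMn w2; field.
  by move=> /(congr1 Num.sqrt); rewrite sqrtr_sqr ger0_norm ?mulr_ge0 ?(ltW w0).
have q0 : 0 < q by apply: lt_trans q_gt1.
have x1 : 1 < 2 * w / q by rewrite ltr_pdivlMr// mul1r W q_lt.
have [n Hn] := expn_dominates D c0 x1.
have := le_trans (low n) (HD n).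
apply/negP; rewrite -ltNge -ltr_pdivlMr ?exprn_gt0//.
by apply: lt_le_trans Hn _; rewrite expr_div_n mulrA.
Qed.

End axial_no_decay.

(** * Gaussian mass of the torus *)

Section gauss_pullback.
Context {R : realType}.
Local Notation L1 := (@L1 R).

Lemma continuous_gauss1 (c v : R) : continuous (gauss1 c v).
Proof.
move=> x; apply: differentiable_continuous; apply/derivable1_diffP.
rewrite /gauss1; exact: ex_derive.
Qed.

Lemma gauss1_primitive (c v : R) : 0 < c -> exists G : R -> R,
  (forall x : R, is_derive x 1 G (gauss1 c v x)) /\
  (forall x, 0 <= G x <= Num.sqrt (pi / c)).
Proof.
move=> c0; have I := intg_gauss1 v c0.
exists (fun x : R => \int[lebesgue_measure]_(t in [set` Interval -oo%O (BRight x)]) gauss1 c v t); split.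
  move=> x.
  have xu : x < x + 1 by rewrite ltrDl.
  have Ix : (@lebesgue_measure R).-integrable [set` Interval -oo%O (BRight (x + 1))] (EFin \o gauss1 c v).
    by apply: (integrableS _ _ _ I).
  have [d e] : derivable (fun x : R => \int[lebesgue_measure]_(t in [set` Interval -oo%O (BRight x)]) gauss1 c v t) x 1 /\
     (fun x : R => \int[lebesgue_measure]_(t in [set` Interval -oo%O (BRight x)]) gauss1 c v t)^`()%classic x = gauss1 c v x.
    by apply: (continuous_FTC1 xu Ix); rewrite ?ltNyr//=; exact: continuous_gauss1.
  by split; [exact: d|rewrite -derive1E e].
move=> x; apply/andP; split; first by apply: Rintegral_ge0 => y _; exact: gauss1_ge0.
rewrite -(Rintegral_gauss1 v c0) Rintegral_mkcond.
have I' : L1.-intg (gauss1 c v \_ [set` Interval -oo%O (BRight x)]).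
  apply: (intg_dominated _ I).
    apply/(measurable_restrictT _ _).1 => //; apply: measurable_funTS; exact: measurable_gauss1.
  by move=> y; rewrite patchE; case: ifP => _; rewrite ?normr0 ?gauss1_ge0// ger0_norm ?gauss1_ge0.
by apply: (Rint_le I' I) => y; rewrite patchE; case: ifP => _; rewrite ?gauss1_ge0.
Qed.

(** Where [h] is monotone, [|h'| gauss1(h)] is, up to a sign, the derivative of [G o h] with [G] a
    primitive of the Gaussian. The integral is a difference of two values of [G]: a substitution
    without inverse function, with a bound independent of [h] and of the interval. *)
Lemma gauss_pullback_itv (h h' : R -> R) (c v a b : R) : 0 < c -> a < b ->
  (forall x : R, is_derive x 1 h (h' x)) -> continuous h' ->
  ((forall x, a <= x <= b -> 0 <= h' x) \/ (forall x, a <= x <= b -> h' x <= 0)) ->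
  L1.-intg (fun x => (\1_`[a, b] x : R) * (`|h' x| * gauss1 c v (h x))) /\
  \int[L1]_x ((\1_`[a, b] x : R) * (`|h' x| * gauss1 c v (h x))) <= Num.sqrt (pi / c).
Proof.
move=> c0 ab dh ch' sgn.
have [G [dG Gb]] := gauss1_primitive v c0.
have [sg [sg1 sgE]] : exists sg : R, `|sg| = 1 /\ forall x, a <= x <= b -> `|h' x| = sg * h' x.
  case: sgn => H; [exists 1|exists (-1)]; rewrite ?normrN normr1; split => // x /H h0.
    by rewrite ger0_norm// mul1r.
  by rewrite ler0_norm// mulN1r.
pose F x := sg * G (h x).
pose f x := sg * (h' x * gauss1 c v (h x)).
have dF (x : R) : is_derive x 1 F (f x).
  have d1 := dh x; have d2 := dG (h x).
  rewrite /F /f; apply: is_derive_eq.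
  by rewrite /GRing.scale/=; ring.
have ch : continuous h.
  by move=> x; apply: differentiable_continuous; apply/derivable1_diffP; have [] := dh x.
have cF : continuous F.
  by move=> x; apply: differentiable_continuous; apply/derivable1_diffP; have [] := dF x.
have cf : continuous f.
  move=> x; rewrite /f; apply: cvgM; first exact: cvg_cst.
  apply: cvgM; first exact: ch'.
  by apply: (cvg_comp h (gauss1 c v)); [exact: ch|exact: continuous_gauss1].
have FTC : (\int[L1]_(x in `[a, b]) (f x)%:E)%E = ((F b)%:E - (F a)%:E)%E.
  apply: continuous_FTC2 => //.
  - exact: continuous_subspaceT.
  - split.
    + by move=> x _; have [] := dF x.
    + by apply: cvg_at_right_filter; exact: cF.
    + by apply: cvg_at_left_filter; exact: cF.
  - by move=> x _; rewrite derive1E; have [_ ->] := dF x.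
have E : (fun x => (\1_`[a, b] x : R) * (`|h' x| * gauss1 c v (h x))) = f \_ `[a, b].
  apply/funext => x; rewrite patchE indicE; case: ifPn => xab; last by rewrite mul0r.
  rewrite mul1r /f sgE; first by rewrite mulrA.
  by move: xab; rewrite inE/= in_itv.
rewrite E; split.
  have : L1.-integrable `[a, b] (EFin \o f).
    apply: continuous_compact_integrable; first exact: segment_compact.
    exact: continuous_subspaceT.
  by move=> H; rewrite -restrict_EFin; apply/(integrable_mkcond _ _).1.
rewrite -Rintegral_mkcond /Rintegral FTC -EFinB/=.
apply: le_trans (ler_norm _) _.
rewrite /F -mulrBr normrM sg1 mul1r ler_norml.
by have /andP[? ?] := Gb (h a); have /andP[? ?] := Gb (h b); apply/andP; split; lra.
Qed.

End gauss_pullback.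

(** * Gaussians along a circle *)

Section circle.
Context {R : realType}.
Local Notation L1 := (@L1 R).

Definition circ_gauss (c q1 q2 rho x : R) : R :=
  gauss1 c q1 (rho * cos x) * gauss1 c q2 (rho * sin x).

Lemma abs_sin_add_abs_cos (x : R) : 1 <= `|sin x| + `|cos x|.
Proof.
have h (y : R) : `|y| <= 1 -> y ^+ 2 <= `|y|.
  by move=> y1; rewrite -real_normK ?num_real// expr2 ler_piMl.
have := h _ (sin_norm_le1 x); have := h _ (cos_norm_le1 x).
by have := cos2Dsin2 x; lra.
Qed.

Lemma gauss1_le1 (a v x : R) : 0 <= a -> gauss1 a v x <= 1.
Proof. by move=> a0; rewrite /gauss1 -expR0 ler_expR oppr_le0 mulr_ge0 ?sqr_ge0. Qed.

(* As |sin| + |cos| >= 1, up to a factor rho one of the two Gaussians is integrated against its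
   own speed, which allows a change of variables on monotone arcs. *)
Lemma circ_gauss_le (c q1 q2 rho x : R) : 0 <= c -> 0 <= rho ->
  rho * circ_gauss c q1 q2 rho x <=
  `|- (rho * sin x)| * gauss1 c q1 (rho * cos x) + `|rho * cos x| * gauss1 c q2 (rho * sin x).
Proof.
move=> c0 r0; rewrite normrN !normrM (ger0_norm r0) -!(mulrA rho) -mulrDr ler_wpM2l//.
rewrite /circ_gauss.
have := abs_sin_add_abs_cos x.
have := gauss1_le1 q1 (rho * cos x) c0; have := gauss1_le1 q2 (rho * sin x) c0.
have := gauss1_ge0 c q1 (rho * cos x); have := gauss1_ge0 c q2 (rho * sin x).
set A := gauss1 _ _ _; set B := gauss1 _ _ _; set S := `|sin x|; set C := `|cos x|.
move=> A0 B0 A1 B1 SC.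
have S0 : 0 <= S by exact: normr_ge0.
have C0 : 0 <= C by exact: normr_ge0.
have h1 : B * A <= (S + C) * (B * A) by rewrite ler_peMl// mulr_ge0.
have h2 : S * (B * A) <= S * B by rewrite ler_wpM2l// ler_piMr.
have h3 : C * (B * A) <= C * A by rewrite ler_wpM2l// ler_piMl.
move: h1; rewrite mulrDl; lra.
Qed.

Lemma measurable_circ_gauss (c q1 q2 rho : R) : measurable_fun setT (circ_gauss c q1 q2 rho).
Proof.
apply: measurable_funM; apply: (measurableT_comp (measurable_gauss1 _ _)); apply: measurable_funM => //.
  exact: measurable_cosT.
by apply: continuous_measurable_fun; exact: continuous_sin.
Qed.

Lemma intg_circ_gauss (c q1 q2 rho : R) : 0 <= c ->
  L1.-intg (fun x => (\1_angles x : R) * circ_gauss c q1 q2 rho x).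
Proof.
move=> c0; apply: (intg_dominated _ intg_angles).
  by apply: measurable_funM; [exact: intg_measurable intg_angles|exact: measurable_circ_gauss].
move=> x; rewrite normrM ger0_norm ?indicE//.
rewrite ler_piMr// /circ_gauss normrM !ger0_norm ?gauss1_ge0//.
by rewrite mulr_ile1 ?gauss1_ge0 ?gauss1_le1.
Qed.

(** On [[0, 2 pi]] the cosine is monotone on two arcs and the sine on three; each arc contributes at
    most the full Gaussian mass [sqrt(pi/c)], wherever the centre lies. *)
Lemma Rintegral_circ_gauss (c q1 q2 rho : R) : 0 < c -> 0 < rho ->
  \int[L1]_x ((\1_angles x : R) * circ_gauss c q1 q2 rho x) <= 5 * Num.sqrt (pi / c) / rho.
Proof.
move=> c0 r0.
have dc (x : R) : is_derive x 1 (fun x : R => rho * cos x) (- (rho * sin x)).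
  by apply: is_derive_eq; rewrite /GRing.scale/=; ring.
have ds (x : R) : is_derive x 1 (fun x : R => rho * sin x) (rho * cos x).
  by apply: is_derive_eq; rewrite /GRing.scale/=; ring.
have cc : continuous (fun x : R => - (rho * sin x)).
  move=> x; apply: differentiable_continuous; apply/derivable1_diffP; exact: ex_derive.
have cs : continuous (fun x : R => rho * cos x).
  move=> x; apply: differentiable_continuous; apply/derivable1_diffP; exact: ex_derive.
have p0 : 0 < pi :> R by exact: pi_gt0.
have sinpi (x : R) : sin x = - sin (x - pi) by rewrite sinB cospi sinpi; ring.
have cospi' (x : R) : cos x = - cos (x - pi) by rewrite cosB cospi trigo.sinpi; ring.
have cos2pi (x : R) : cos x = cos (x - 2 * pi).
  by rewrite cospi' (cospi' (x - pi)) opprK; congr cos; ring.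
have [I1 E1] : L1.-intg (fun x => (\1_`[0, pi] x : R) * (`|- (rho * sin x)| * gauss1 c q1 (rho * cos x))) /\
   \int[L1]_x ((\1_`[0, pi] x : R) * (`|- (rho * sin x)| * gauss1 c q1 (rho * cos x))) <= Num.sqrt (pi / c).
  apply: gauss_pullback_itv => //; right => x hx.
  by rewrite oppr_le0 mulr_ge0 ?(ltW r0)// sin_ge0_pi.
have [I2 E2] : L1.-intg (fun x => (\1_`[pi, 2 * pi] x : R) * (`|- (rho * sin x)| * gauss1 c q1 (rho * cos x))) /\
   \int[L1]_x ((\1_`[pi, 2 * pi] x : R) * (`|- (rho * sin x)| * gauss1 c q1 (rho * cos x))) <= Num.sqrt (pi / c).
  apply: gauss_pullback_itv => //; first by clear -p0; lra.
  left => x hx; rewrite sinpi mulrN opprK mulr_ge0 ?(ltW r0)// sin_ge0_pi//; clear -p0 hx; lra.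
have [I3 E3] : L1.-intg (fun x => (\1_`[0, pi / 2] x : R) * (`|rho * cos x| * gauss1 c q2 (rho * sin x))) /\
   \int[L1]_x ((\1_`[0, pi / 2] x : R) * (`|rho * cos x| * gauss1 c q2 (rho * sin x))) <= Num.sqrt (pi / c).
  apply: gauss_pullback_itv => //; first by clear -p0; lra.
  left => x hx; rewrite mulr_ge0 ?(ltW r0)// cos_ge0_pihalf//; clear -p0 hx; lra.
have [I4 E4] : L1.-intg (fun x => (\1_`[pi / 2, 3 * pi / 2] x : R) * (`|rho * cos x| * gauss1 c q2 (rho * sin x))) /\
   \int[L1]_x ((\1_`[pi / 2, 3 * pi / 2] x : R) * (`|rho * cos x| * gauss1 c q2 (rho * sin x))) <= Num.sqrt (pi / c).
  apply: gauss_pullback_itv => //; first by clear -p0; lra.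
  right => x hx; rewrite cospi' mulrN oppr_le0 mulr_ge0 ?(ltW r0)// cos_ge0_pihalf//; clear -p0 hx; lra.
have [I5 E5] : L1.-intg (fun x => (\1_`[3 * pi / 2, 2 * pi] x : R) * (`|rho * cos x| * gauss1 c q2 (rho * sin x))) /\
   \int[L1]_x ((\1_`[3 * pi / 2, 2 * pi] x : R) * (`|rho * cos x| * gauss1 c q2 (rho * sin x))) <= Num.sqrt (pi / c).
  apply: gauss_pullback_itv => //; first by clear -p0; lra.
  left => x hx; rewrite cos2pi mulr_ge0 ?(ltW r0)// cos_ge0_pihalf//; clear -p0 hx; lra.
rewrite ler_pdivlMr// mulrC -RintegralZl//; last by apply: intg_circ_gauss; exact: ltW.
have I12 := intgD I1 I2; have I34 := intgD I3 I4; have I345 := intgD I34 I5.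
apply: (@le_trans _ _ (\int[L1]_x (
   ((\1_`[0, pi] x : R) * (`|- (rho * sin x)| * gauss1 c q1 (rho * cos x)) +
    (\1_`[pi, 2 * pi] x : R) * (`|- (rho * sin x)| * gauss1 c q1 (rho * cos x))) +
   ((\1_`[0, pi / 2] x : R) * (`|rho * cos x| * gauss1 c q2 (rho * sin x)) +
    (\1_`[pi / 2, 3 * pi / 2] x : R) * (`|rho * cos x| * gauss1 c q2 (rho * sin x)) +
    (\1_`[3 * pi / 2, 2 * pi] x : R) * (`|rho * cos x| * gauss1 c q2 (rho * sin x)))))).
  apply: Rint_le; [by apply: intgZl; apply: intg_circ_gauss; exact: ltW|exact: intgD|].
  move=> x; rewrite mulrCA.
  have G := circ_gauss_le q1 q2 x (ltW c0) (ltW r0).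
  set A := `|- _| * _ in G *; set B := `|rho * cos x| * _ in G *.
  have A0 : 0 <= A by rewrite mulr_ge0 ?gauss1_ge0.
  have B0 : 0 <= B by rewrite mulr_ge0 ?gauss1_ge0.
  have ge0 (I : set R) : 0 <= \1_I x :> R by rewrite indicE.
  have [xa|xa] := boolP (x \in (angles : set R)); last first.
    rewrite [\1_angles x]indicE (negbTE xa) mul0r.
    by rewrite !addr_ge0// mulr_ge0.
  rewrite [\1_angles x]indicE xa mul1r; apply: le_trans G _.
  have xa' : 0 <= x < 2 * pi by move: xa; rewrite inE /angles/= in_itv.
  have one (u v : R) : u <= x <= v -> \1_`[u, v] x = 1 :> R.
    by move=> uv; rewrite indicE mem_set//= in_itv.
  apply: lerD.
    rewrite -mulrDl ler_peMl//.
    have [xp|xp] := leP x pi.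
      have -> : \1_`[0, pi] x = 1 :> R by apply: one; clear -p0 xa' xp; lra.
      by rewrite lerDl.
    have -> : \1_`[pi, 2 * pi] x = 1 :> R by apply: one; clear -p0 xa' xp; lra.
    by rewrite lerDr.
  rewrite -!mulrDl ler_peMl//.
  have [xp|xp] := leP x (pi / 2).
    have -> : \1_`[0, pi / 2] x = 1 :> R by apply: one; clear -p0 xa' xp; lra.
    by rewrite -addrA lerDl addr_ge0.
  have [xq|xq] := leP x (3 * pi / 2).
    have -> : \1_`[pi / 2, 3 * pi / 2] x = 1 :> R by apply: one; clear -p0 xa' xp xq; lra.
    by rewrite -addrA addrCA lerDl addr_ge0.
  have -> : \1_`[3 * pi / 2, 2 * pi] x = 1 :> R by apply: one; clear -p0 xa' xp xq; lra.
  by rewrite lerDr addr_ge0.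
rewrite RintegralD// RintegralD// RintegralD// RintegralD//.
apply: le_trans (lerD (lerD E1 E2) (lerD (lerD E3 E4) E5)) _.
by rewrite le_eqVlt; apply/orP; left; apply/eqP; ring.
Qed.

End circle.

(** * A uniform bound for Gaussians on the torus *)

Section torus_gauss.
Context {R : realType}.
Local Notation L1 := (@L1 R).
Local Notation L2 := (@L2 R).
Variables s t : R.
Hypotheses (s0 : 0 < s) (st : s < t).

(* The horizontal distance to x is at least |rho - |(x1, x2)||, so half of the exponent can be
   spent on theta alone, leaving the other half for phi. *)
Lemma gauss3_torus_le a (x : space3 R) (w : R * R) : 0 < a ->
  gauss3 a x (torus s t w) <=
  circ_gauss (a / 2) (Num.sqrt (x.1.1 ^+ 2 + x.1.2 ^+ 2) - t) x.2 s w.1 *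
  circ_gauss (a / 2) x.1.1 x.1.2 (t + s * cos w.1) w.2.
Proof.
move=> a0; rewrite /gauss3 /circ_gauss /gauss1 /torus/= -!expRD ler_expR.
set rho := t + s * cos w.1.
have rho0 : 0 <= rho.
  have h : s * -1 <= s * cos w.1 by rewrite ler_pM2l// cos_geN1.
  rewrite mulrN1 in h; apply: (@le_trans _ _ (t - s)); last by rewrite /rho lerD2l.
  by rewrite subr_ge0 ltW.
set r := Num.sqrt _.
have r2 : r ^+ 2 = x.1.1 ^+ 2 + x.1.2 ^+ 2 by rewrite sqr_sqrtr// addr_ge0 ?sqr_ge0.
have CS : x.1.1 * cos w.2 + x.1.2 * sin w.2 <= r.
  apply: le_trans (ler_norm _) _; rewrite -sqrtr_sqr ler_wsqrtr//.
  have e := cos2Dsin2 w.2; have := sqr_ge0 (x.1.1 * sin w.2 - x.1.2 * cos w.2).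
  have -> : x.1.1 ^+ 2 + x.1.2 ^+ 2 = (x.1.1 ^+ 2 + x.1.2 ^+ 2) * (cos w.2 ^+ 2 + sin w.2 ^+ 2).
    by rewrite e mulr1.
  move: (cos w.2) (sin w.2) => c d; rewrite -subr_ge0 => h; rewrite -subr_ge0.
  by apply: le_trans h _; rewrite le_eqVlt; apply/orP; left; apply/eqP; ring.
have E1 : s * cos w.1 - (r - t) = rho - r by rewrite /rho; ring.
rewrite E1.
have U : (rho - r) ^+ 2 <= (rho * cos w.2 - x.1.1) ^+ 2 + (rho * sin w.2 - x.1.2) ^+ 2.
  have -> : (rho * cos w.2 - x.1.1) ^+ 2 + (rho * sin w.2 - x.1.2) ^+ 2 =
    rho ^+ 2 * (cos w.2 ^+ 2 + sin w.2 ^+ 2) - 2 * (rho * (x.1.1 * cos w.2 + x.1.2 * sin w.2)) + r ^+ 2.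
    by rewrite r2; ring.
  rewrite cos2Dsin2 mulr1 sqrrB.
  have : rho * (x.1.1 * cos w.2 + x.1.2 * sin w.2) <= rho * r by rewrite ler_wpM2l.
  by move: (rho * (_ + _)) => z; clear; lra.
move: U; move: (rho * cos w.2 - x.1.1) (rho * sin w.2 - x.1.2) (rho - r) (s * sin w.1 - x.2) => u v y z U.
have aU : a / 2 * y ^+ 2 <= a / 2 * (u ^+ 2 + v ^+ 2) by rewrite ler_pM2l// divr_gt0.
have az : 0 <= a / 2 * z ^+ 2 by rewrite mulr_ge0 ?sqr_ge0// divr_ge0// ltW.
by clear -aU az; lra.
Qed.

Lemma measurable_gauss3_torus a (x : space3 R) : 0 < a ->
  measurable_fun setT (fun w => gauss3 a x (torus s t w)).
Proof.
move=> a0; have m1 : measurable_fun setT (gauss3 a x) by exact: intg_measurable (intg_gauss3 x a0).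
exact: (measurableT_comp m1 (measurable_torus s t)).
Qed.

(* 50 = 2 * 5 * 5, each angle contributing the five monotone arcs of Rintegral_circ_gauss. *)
Definition torus_const : R := 50 * pi / (s * (t - s)).

Lemma torus_const_gt0 : 0 < torus_const.
Proof. by rewrite divr_gt0 ?mulr_gt0 ?pi_gt0// subr_gt0. Qed.

Lemma intg_gauss3_torus a (x : space3 R) : 0 < a ->
  L2.-intg (fun w => box1 w * gauss3 a x (torus s t w)).
Proof.
move=> a0; apply: (intg_dominated _ intg_box1).
  apply: measurable_funM; first exact: intg_measurable intg_box1.
  exact: measurable_gauss3_torus.
move=> w; rewrite normrM !ger0_norm ?box1_ge0 ?gauss3_ge0// ler_piMr ?box1_ge0//.
by rewrite gauss3_le1// ltW.
Qed.

(** The inner integral runs over a horizontal circle of radius [t + s cos theta >= t - s > 0], which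
    is where [s < t] enters, and the outer one over a circle of radius [s]. Each gives a factor
    [a^(-1/2)], uniformly in the centre. *)
Lemma Rintegral_gauss3_torus a (x : space3 R) : 0 < a ->
  \int[L2]_w (box1 w * gauss3 a x (torus s t w)) <= torus_const / a.
Proof.
move=> a0; have a20 : 0 < a / 2 by rewrite divr_gt0.
have a2' := ltW a20.
have ts0 : 0 < t - s by rewrite subr_gt0.
pose F (w : R * R) := box1 w * gauss3 a x (torus s t w).
have IF : L2.-intg F by exact: intg_gauss3_torus.
have mFx th : measurable_fun setT (fun ph : R => F (th, ph)).
  exact: (measurableT_comp (intg_measurable IF) (@pair1_measurable _ _ _ _ th)).
have IFx th : L1.-intg (fun ph => F (th, ph)).
  apply: (intg_dominated _ intg_angles); first exact: mFx.
  move=> ph; rewrite /F /box1 normrM ger0_norm ?mulr_ge0 ?indicE//=.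
  rewrite ger0_norm ?gauss3_ge0// -mulrA.
  apply: (@le_trans _ _ (1 * ((ph \in (angles : set R))%:R * 1))); last by rewrite mul1r mulr1.
  apply: ler_pM => //.
  - by rewrite mulr_ge0 ?gauss3_ge0.
  - by case: (_ \in _).
  - by rewrite ler_wpM2l// gauss3_le1// ltW.
rewrite (@Rintegral_prod12 _ _ _ _ _ L1 L1 F)//.
set q1 := Num.sqrt (x.1.1 ^+ 2 + x.1.2 ^+ 2) - t.
pose B : R := 5 * Num.sqrt (pi / (a / 2)) / (t - s).
have inner th : \int[L1]_ph F (th, ph) <= \1_angles th * circ_gauss (a / 2) q1 x.2 s th * B.
  set A := \1_angles th * _.
  have A0 : 0 <= A by rewrite mulr_ge0 ?indicE// /circ_gauss mulr_ge0 ?gauss1_ge0.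
  set rho := t + s * cos th.
  have rhog : t - s <= rho.
    have h : s * -1 <= s * cos th by rewrite ler_pM2l// cos_geN1.
    by rewrite mulrN1 in h; rewrite /rho lerD2l.
  have rho0 : 0 < rho by apply: lt_le_trans rhog.
  have Ic := @intg_circ_gauss R (a / 2) x.1.1 x.1.2 rho a2'.
  apply: (@le_trans _ _ (\int[L1]_ph (A * (\1_angles ph * circ_gauss (a / 2) x.1.1 x.1.2 rho ph)))).
    apply: Rint_le => //; first exact: intgZl.
    move=> ph; rewrite /F /box1/= /A [leRHS]mulrACA ler_wpM2l ?mulr_ge0 ?indicE//.
    exact: (gauss3_torus_le x (th, ph) a0).
  rewrite RintegralZl// ler_wpM2l//.
  apply: le_trans (Rintegral_circ_gauss _ _ a20 rho0) _.
  rewrite /B ler_wpM2l ?mulr_ge0 ?sqrtr_ge0//.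
  by rewrite lef_pV2 ?posrE.
have Ic := @intg_circ_gauss R (a / 2) q1 x.2 s a2'.
apply: (@le_trans _ _ (\int[L1]_th (\1_angles th * circ_gauss (a / 2) q1 x.2 s th * B))).
  apply: Rint_le => //; last exact: intgZr.
  exact: (@intg_Rintegral2 _ _ _ _ _ L1 L1 F).
rewrite RintegralZr//.
have B0 : 0 <= B by rewrite divr_ge0 ?mulr_ge0 ?sqrtr_ge0// ltW.
apply: le_trans (ler_wpM2r B0 (Rintegral_circ_gauss _ _ a20 s0)) _.
have sq : Num.sqrt (pi / (a / 2)) * Num.sqrt (pi / (a / 2)) = 2 * pi / a.
  rewrite -expr2 sqr_sqrtr; first by field; rewrite gt_eqF.
  by rewrite divr_ge0 ?pi_ge0.
rewrite /B /torus_const le_eqVlt; apply/orP; left; apply/eqP.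
have -> : 5 * Num.sqrt (pi / (a / 2)) / s * (5 * Num.sqrt (pi / (a / 2)) / (t - s)) =
  25 * (Num.sqrt (pi / (a / 2)) * Num.sqrt (pi / (a / 2))) / (s * (t - s)).
  by field; rewrite !gt_eqF.
by rewrite sq; field; rewrite !gt_eqF.
Qed.

End torus_gauss.

(** * The bound alpha <= 2/p *)

Section gauss_multiplier.
Context {R : realType}.
Local Notation L3 := (@L3 R).
Context d (V : measurableType d) (mu : {sigma_finite_measure set V -> \bar R}).
Variables (k : V -> R) (Psi : V -> space3 R).
Hypotheses (Ik : mu.-intg k) (mPsi : measurable_fun setT Psi).

Let mk : measurable_fun setT k := intg_measurable Ik.

Lemma intg_gauss3_comp c v : 0 < c -> mu.-intg (fun w => k w * gauss3 c v (Psi w)).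
Proof.
move=> c0; apply: (intg_dominated _ (intg_norm Ik)).
  apply: measurable_funM => //.
  exact: (measurableT_comp (intg_measurable (intg_gauss3 v c0)) mPsi).
move=> w; rewrite normrM ler_piMr// ger0_norm ?gauss3_ge0// gauss3_le1// ltW//.
Qed.

Lemma intg_multiplier_gauss3 tau : 0 < tau ->
  L3.-intg (fun xi => multiplier mu k Psi xi * gauss3 tau 0 xi).
Proof.
move=> tau0; have Ig := @intg_gauss3 R tau 0 tau0.
apply: (intg_dominated _ (intgZl (\int[mu]_v `|k v|) Ig)).
  apply: measurable_funM; last exact: intg_measurable Ig.
  exact: (measurable_multiplier Ik mPsi).
move=> xi; rewrite normrM [X in _ * X]ger0_norm ?gauss3_ge0// ler_wpM2r ?gauss3_ge0//.
exact: (multiplier_le Ik mPsi).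
Qed.

(** The energy of the multiplier at frequencies up to order [tau^(-1/2)] becomes the [k]-mass of the
    parameters with [|Psi v|] up to order [tau^(1/2)]. For chords this counts close pairs of
    points. *)
Lemma Rintegral_multiplier_gauss3 tau : 0 < tau ->
  \int[L3]_xi (multiplier mu k Psi xi * gauss3 tau 0 xi) =
  Num.sqrt (pi / tau) ^+ 3 * \int[mu]_v (k v * gauss3 (4 * tau)^-1 0 (Psi v)).
Proof.
move=> tau0; have c0 : 0 < (4 * tau)^-1 by rewrite invr_gt0 mulr_gt0.
have Ig := @intg_gauss3 R tau 0 tau0.
pose F (z : space3 R * V) := gauss3 tau 0 z.1 * k z.2 * cos (dot3 (Psi z.2) z.1).
have I2 := @intg_tensor _ _ _ _ _ L3 mu _ _ Ig Ik.
have mPsiZ : measurable_fun setT (fun z : space3 R * V => Psi z.2).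
  exact: (measurableT_comp mPsi measurable_snd).
have mD : measurable_fun setT (fun z : space3 R * V => dot3 (Psi z.2) z.1).
  have m1 := measurableT_comp measurable_fst mPsiZ.
  have m2 := measurableT_comp measurable_snd mPsiZ.
  rewrite /dot3; apply: measurable_funD; [apply: measurable_funD|]; apply: measurable_funM => //.
  - exact: (measurableT_comp measurable_fst m1).
  - by apply: (measurableT_comp measurable_fst); apply: (measurableT_comp measurable_fst).
  - exact: (measurableT_comp measurable_snd m1).
  - by apply: (measurableT_comp measurable_snd); apply: (measurableT_comp measurable_fst).
  - by apply: (measurableT_comp measurable_snd).
have IF : (sigma_finite_prod L3 mu).-intg F.
  apply: (intg_dominated _ (intg_norm I2)).
    apply: measurable_funM; first exact: intg_measurable I2.
    exact: (measurableT_comp (@measurable_cosT R) mD).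
  by move=> z; rewrite [leLHS]normrM ler_piMr// cos_norm_le1.
transitivity (\int[sigma_finite_prod L3 mu]_z F z).
  rewrite Rintegral_prod12//; last first.
    move=> x; have := intgZl (gauss3 tau 0 x) (intg_mult Ik mPsi x).
    by apply: eq_intg => v; rewrite /F/= mulrA.
  apply: eq_Rintegral => x _; rewrite mulrC /multiplier -RintegralZl//; last exact: intg_mult.
  by apply: eq_Rintegral => v _; rewrite /F/= mulrA.
have E (v : V) x : F (x, v) = k v * (gauss3 tau 0 x * cos (dot3 x (Psi v) + 0)).
  by rewrite /F/= addr0 dot3C -mulrA mulrCA.
rewrite Rintegral_prod21//; last first.
  move=> v; have := intgZl (k v) (intg_gauss3_cos 0 (Psi v) 0 tau0).
  by apply: eq_intg => x; rewrite E.
rewrite -RintegralZl//; last exact: intg_gauss3_comp.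
apply: eq_Rintegral => v _; under eq_Rintegral do rewrite E.
rewrite RintegralZl//; last exact: intg_gauss3_cos.
rewrite Rintegral_gauss3_cos//.
have -> : dot3 0 (Psi v) + 0 = 0 by rewrite addr0 /dot3/= !mul0r !addr0.
by rewrite cos0 mulr1 mulrCA.
Qed.

End gauss_multiplier.

(** * Counting close pairs of points of the torus *)

Section pair.
Context {R : realType}.
Local Notation L2 := (@L2 R).
Variables s t : R.

Definition L2L2 := sigma_finite_prod L2 L2.
Definition box2 (z : (R * R) * (R * R)) : R := box1 z.1 * box1 z.2.
Definition chord (z : (R * R) * (R * R)) : space3 R := torus s t z.1 - torus s t z.2.
Local Notation D := (multiplier L2L2 box2 chord).

Lemma intg_box2 : L2L2.-intg box2.
Proof. by apply: (@intg_tensor _ _ _ _ _ L2 L2); exact: intg_box1. Qed.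

Lemma measurable_space3B d (V : measurableType d) (f g : V -> space3 R) :
  measurable_fun setT f -> measurable_fun setT g -> measurable_fun setT (fun v => f v - g v).
Proof.
move=> mf mg.
have f1 := measurableT_comp measurable_fst mf; have f2 := measurableT_comp measurable_snd mf.
have g1 := measurableT_comp measurable_fst mg; have g2 := measurableT_comp measurable_snd mg.
apply: (@measurable_fun_pair _ _ _ _ _ _ (fun v => (f v).1 - (g v).1) (fun v => (f v).2 - (g v).2)).
  have f11 := measurableT_comp measurable_fst f1; have f12 := measurableT_comp measurable_snd f1.
  have g11 := measurableT_comp measurable_fst g1; have g12 := measurableT_comp measurable_snd g1.
  by apply: (@measurable_fun_pair _ _ _ _ _ _ (fun v => (f v).1.1 - (g v).1.1)
    (fun v => (f v).1.2 - (g v).1.2)); exact: measurable_funB.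
exact: measurable_funB.
Qed.

Lemma measurable_chord : measurable_fun setT chord.
Proof.
have m := measurable_torus s t.
apply: measurable_space3B.
  exact: (measurableT_comp m measurable_fst).
exact: (measurableT_comp m measurable_snd).
Qed.

(* The multiplier is the squared modulus of the Fourier transform of the torus. *)
Lemma multiplier_chord_ge0 xi : 0 <= D xi.
Proof.
have mT := measurable_torus s t.
have mh := measurableT_comp (measurable_dot3 xi) mT.
have mb := intg_measurable (@intg_box1 R).
have Ic : L2.-intg (fun w => box1 w * cos (dot3 (torus s t w) xi)) by exact: intg_mult intg_box1 mT xi.
have Is : L2.-intg (fun w => box1 w * sin (dot3 (torus s t w) xi)).
  apply: (intg_dominated _ intg_box1).
    apply: measurable_funM => //.
    have ms : measurable_fun setT (@sin R) by apply: continuous_measurable_fun; exact: continuous_sin.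
    exact: (measurableT_comp ms mh).
  by move=> w; rewrite normrM ger0_norm ?box1_ge0// ler_piMr ?box1_ge0// sin_norm_le1.
pose c := \int[L2]_w (box1 w * cos (dot3 (torus s t w) xi)).
pose d := \int[L2]_w (box1 w * sin (dot3 (torus s t w) xi)).
have -> : D xi = c ^+ 2 + d ^+ 2; last by rewrite addr_ge0 ?sqr_ge0.
rewrite /multiplier.
rewrite (@Rintegral_prod12 _ _ _ _ _ L2 L2 (fun z => box2 z * cos (dot3 (chord z) xi))); last first.
- move=> w; have := intgD (intgZl (box1 w * cos (dot3 (torus s t w) xi)) Ic)
    (intgZl (box1 w * sin (dot3 (torus s t w) xi)) Is).
  apply: eq_intg => w' /=.
  have -> : dot3 (torus s t w - torus s t w') xi = dot3 (torus s t w) xi - dot3 (torus s t w') xi.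
    by rewrite /dot3/=; ring.
  by rewrite cosB /box2/=; ring.
- exact: intg_mult intg_box2 measurable_chord xi.
transitivity (\int[L2]_w (box1 w * cos (dot3 (torus s t w) xi) * c + box1 w * sin (dot3 (torus s t w) xi) * d)).
  apply: eq_Rintegral => w _; rewrite /c /d -!RintegralZl// -RintegralD//; [|exact: intgZl..].
  apply: eq_Rintegral => w' _.
  have -> : dot3 (chord (w, w')) xi = dot3 (torus s t w) xi - dot3 (torus s t w') xi.
    by rewrite /dot3/=; ring.
  by rewrite cosB /box2/=; ring.
by rewrite RintegralD// ?RintegralZr// ?expr2//; exact: intgZr.
Qed.


Lemma gauss3_sub a (x y : space3 R) : gauss3 a 0 (x - y) = gauss3 a x y.
Proof. by rewrite !gauss3E; congr (expR (- (_ * _))); rewrite /dot3/=; ring. Qed.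

Let chordE c w w' : box2 (w, w') * gauss3 c 0 (chord (w, w')) =
  box1 w * (box1 w' * gauss3 c (torus s t w) (torus s t w')).
Proof. by rewrite /box2 /chord/= gauss3_sub mulrA. Qed.

Hypotheses (s0 : 0 < s) (st : s < t).

Lemma Rintegral_chord c : 0 < c ->
  \int[L2L2]_z (box2 z * gauss3 c 0 (chord z)) =
  \int[L2]_w (box1 w * \int[L2]_w' (box1 w' * gauss3 c (torus s t w) (torus s t w'))).
Proof.
move=> c0.
have I w := intg_gauss3_torus s t (torus s t w) c0.
rewrite (@Rintegral_prod12 _ _ _ _ _ L2 L2 (fun z => box2 z * gauss3 c 0 (chord z))).
- by apply: eq_Rintegral => w _; rewrite -RintegralZl//; apply: eq_Rintegral => w' _; rewrite chordE.
- exact: (@intg_gauss3_comp _ _ _ L2L2 _ _ intg_box2 measurable_chord c 0 c0).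
- by move=> w; apply: eq_intg (intgZl (box1 w) (I w)) => w'; rewrite chordE.
Qed.

Lemma intg_outer c : 0 < c -> L2.-intg (fun w => box1 w *
  \int[L2]_w' (box1 w' * gauss3 c (torus s t w) (torus s t w'))).
Proof.
move=> c0.
have I w := intg_gauss3_torus s t (torus s t w) c0.
have := @intg_Rintegral2 _ _ _ _ _ L2 L2 (fun z => box2 z * gauss3 c 0 (chord z))
  (intg_gauss3_comp intg_box2 measurable_chord 0 c0).
have h w : L2.-intg (fun w' => box2 (w, w') * gauss3 c 0 (chord (w, w'))).
  by apply: eq_intg (intgZl (box1 w) (I w)) => w'; rewrite chordE.
move=> /(_ h); apply: eq_intg => w; rewrite -RintegralZl//.
by apply: eq_Rintegral => w' _; rewrite chordE.
Qed.

Lemma Rintegral_chord_le c : 0 < c ->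
  \int[L2L2]_z (box2 z * gauss3 c 0 (chord z)) <= (2 * pi) ^+ 2 * (torus_const s t / c).
Proof.
move=> c0; rewrite Rintegral_chord// -Rintegral_box1 -RintegralZr//; last exact: intg_box1.
apply: Rint_le; [exact: intg_outer|apply: intgZr; exact: intg_box1|].
by move=> w; rewrite ler_wpM2l ?box1_ge0// Rintegral_gauss3_torus.
Qed.

End pair.

Section itv.
Context {R : realType}.
Local Notation L1 := (@L1 R).
Local Notation L2 := (@L2 R).

Lemma intg_itv (a b : R) : L1.-intg (\1_`[a, b] : R -> R).
Proof.
apply/integrableP; split.
  by apply/measurable_EFinP; apply: measurable_indic; exact: measurable_itv.
under eq_integral do rewrite /= ger0_norm//.
rewrite integral_indic//.
by rewrite setIT [X in (X < _)%E]lebesgue_measure_itv/=; case: ifP => _; rewrite ?ltry// -EFinB ltry.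
Qed.

Lemma Rintegral_itv (a b : R) : a <= b -> \int[L1]_x (\1_`[a, b] x : R) = b - a.
Proof.
move=> ab; rewrite /Rintegral integral_indic//.
rewrite setIT [X in fine X]lebesgue_measure_itv/= lte_fin.
case: ltgtP ab => [//|//|->] _; by rewrite ?subrr.
Qed.

Definition square1 (a b d : R) (w : R * R) : R := \1_`[a, a + d] w.1 * \1_`[b, b + d] w.2.

Lemma intg_square1 a b d : L2.-intg (square1 a b d).
Proof. by apply: (@intg_tensor _ _ _ _ _ L1 L1); exact: intg_itv. Qed.

Lemma Rintegral_square1 a b d : 0 <= d -> \int[L2]_w square1 a b d w = d ^+ 2.
Proof.
move=> d0; rewrite (@Rintegral_prod12 _ _ _ _ _ L1 L1); [|exact: intg_square1|]; last first.
  by move=> x; exact: (intgZl (\1_`[a, a + d] x) (intg_itv b (b + d))).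
have e x : x + d - x = d by rewrite addrAC subrr add0r.
transitivity (\int[L1]_x (\1_`[a, a + d] x * d : R)).
  apply: eq_Rintegral => x _; rewrite /square1/= RintegralZl; last exact: intg_itv.
    by rewrite Rintegral_itv ?e// lerDl.
  by [].
by rewrite RintegralZr ?Rintegral_itv ?lerDl ?e//; exact: intg_itv.
Qed.

Lemma square1_le (a b d : R) (w : R * R) (y : R) : 0 <= y ->
  (a <= w.1 <= a + d -> b <= w.2 <= b + d -> 1 <= y) -> square1 a b d w <= y.
Proof.
move=> y0 H; rewrite /square1 !indicE.
have [h1|h1] := boolP (w.1 \in _); last by rewrite mul0r.
have [h2|h2] := boolP (w.2 \in _); last by rewrite mulr0.
rewrite mulr1; apply: H.
  by move: h1; rewrite inE/= in_itv.
by move: h2; rewrite inE/= in_itv.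
Qed.

Lemma sin_lipschitz (u v : R) : `|sin u - sin v| <= `|u - v|.
Proof.
have e (x : R) : sin x = cos (x - pi / 2) by rewrite cosB cos_pihalf sin_pihalf; ring.
rewrite !e; apply: le_trans (cos_lipschitz _ _) _.
by rewrite opprB addrA subrK.
Qed.

End itv.

Section chord_lower.
Context {R : realType}.
Local Notation L2 := (@L2 R).
Variables s t : R.
Hypotheses (s0 : 0 < s) (st : s < t).

(** Each of the three coordinates of the parametrisation changes by at most [2 (t + s) d], whence
    [12 = 3 * 2^2]. *)
Lemma chord_le (d : R) (w w' : R * R) : `|w.1 - w'.1| <= d -> `|w.2 - w'.2| <= d ->
  dot3 (chord s t (w, w')) (chord s t (w, w')) <= 12 * (t + s) ^+ 2 * d ^+ 2.
Proof.
move=> h1 h2; have t0 : 0 < t by apply: lt_trans st.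
have d0 : 0 <= d by apply: le_trans h1.
have [s0' t0'] := (ltW s0, ltW t0).
have sq (z : R) : `|z| <= 2 * (t + s) * d -> z * z <= 4 * (t + s) ^+ 2 * d ^+ 2.
  move=> hz; rewrite -expr2 -real_normK ?num_real//.
  rewrite [leRHS](_ : _ = (2 * (t + s) * d) ^+ 2); last by ring.
  by rewrite lerXn2r ?nnegrE// !mulr_ge0// addr_ge0.
have rho : `|(t + s * cos w.1) - (t + s * cos w'.1)| <= s * d.
  rewrite (_ : _ - _ = s * (cos w.1 - cos w'.1)); last by ring.
  rewrite normrM gtr0_norm// ler_wpM2l//.
  exact: le_trans (cos_lipschitz _ _) h1.
have rho_le : `|t + s * cos w.1| <= t + s.
  apply: le_trans (ler_normD _ _) _; rewrite gtr0_norm// lerD2l normrM gtr0_norm//.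
  by rewrite ler_piMr// cos_norm_le1.
have third (r r' u u' : R) : `|r - r'| <= s * d -> `|r| <= t + s -> `|u - u'| <= d -> `|u'| <= 1 ->
    `|r * u - r' * u'| <= 2 * (t + s) * d.
  move=> a1 a2 a3 a4; rewrite (_ : _ - _ = r * (u - u') + (r - r') * u'); last by ring.
  apply: le_trans (ler_normD _ _) _; rewrite !normrM.
  apply: (@le_trans _ _ ((t + s) * d + s * d * 1)); first by apply: lerD; exact: ler_pM.
  by have := mulr_ge0 t0' d0; lra.
rewrite {1}/dot3/=.
have c1 : `|(t + s * cos w.1) * cos w.2 - (t + s * cos w'.1) * cos w'.2| <= 2 * (t + s) * d.
  by apply: third => //; [exact: le_trans (cos_lipschitz _ _) h2|exact: cos_norm_le1].
have c2 : `|(t + s * cos w.1) * sin w.2 - (t + s * cos w'.1) * sin w'.2| <= 2 * (t + s) * d.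
  by apply: third => //; [exact: le_trans (sin_lipschitz _ _) h2|exact: sin_norm_le1].
have c3 : `|s * sin w.1 - s * sin w'.1| <= 2 * (t + s) * d.
  rewrite -mulrBr normrM gtr0_norm//.
  apply: (@le_trans _ _ (s * d)).
    by rewrite ler_wpM2l//; exact: le_trans (sin_lipschitz _ _) h1.
  by have := mulr_ge0 t0' d0; have := mulr_ge0 s0' d0; lra.
have := sq _ c1; have := sq _ c2; have := sq _ c3.
move: (_ * _ - _) (_ * sin w.2 - _) (s * _ - _) => x y z; clear; lra.
Qed.

Definition chord_const : R := expR (- (12 * (t + s) ^+ 2)) * pi ^+ 2.

Lemma chord_const_gt0 : 0 < chord_const.
Proof. by rewrite mulr_gt0 ?expR_gt0// exprn_gt0// pi_gt0. Qed.

(** For [w] in [[0, pi]^2], a square of side [d = c^(-1/2) <= 1] with corner [w] stays in the box,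
    because [pi + 1 < 2 pi], and on it the Gaussian is at least [exp(-12 (t + s)^2)]. The areas
    [d^2 = 1/c] and [pi^2] supply the remaining factors. *)
Lemma Rintegral_chord_ge c : 1 <= c ->
  chord_const / c <= \int[L2L2]_z (box2 z * gauss3 c 0 (chord s t z)).
Proof.
move=> c1; have c0 : 0 < c by apply: lt_le_trans c1.
rewrite Rintegral_chord//.
pose d := (Num.sqrt c)^-1.
have sc1 : 1 <= Num.sqrt c by rewrite -[leLHS]sqrtr1 ler_wsqrtr.
have d0 : 0 < d by rewrite invr_gt0; apply: lt_le_trans sc1.
have d1 : d <= 1 by rewrite invf_le1//; apply: lt_le_trans sc1.
have dc : d ^+ 2 = c^-1 by rewrite /d exprVn sqr_sqrtr// ltW.
pose e := expR (- (12 * (t + s) ^+ 2)).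
have e0 : 0 <= e by exact: expR_ge0.
have pi2 : 2 <= pi :> R by exact: pi_ge2.
have box_in (w : R * R) : 0 <= w.1 <= pi + 1 -> 0 <= w.2 <= pi + 1 -> box1 w = 1.
  have ang (x : R) : 0 <= x <= pi + 1 -> \1_angles x = 1 :> R.
    move=> hx; rewrite indicE mem_set// /angles/= in_itv/=; clear -hx pi2; lra.
  by move=> h1 h2; rewrite /box1 !ang// mulr1.
have inner (w : R * R) : 0 <= w.1 <= pi -> 0 <= w.2 <= pi ->
    e / c <= \int[L2]_w' (box1 w' * gauss3 c (torus s t w) (torus s t w')).
  move=> h1 h2; rewrite -dc -(Rintegral_square1 w.1 w.2 (ltW d0)) -RintegralZl//; last exact: intg_square1.
  apply: Rint_le; [by apply: intgZl; exact: intg_square1|exact: intg_gauss3_torus|].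
  move=> w'; have B0 : 0 <= box1 w' * gauss3 c (torus s t w) (torus s t w').
    by rewrite mulr_ge0 ?box1_ge0 ?gauss3_ge0.
  have e1 : 0 < e by exact: expR_gt0.
  rewrite -ler_pdivlMl//; apply: square1_le; first by rewrite mulr_ge0// invr_ge0.
  move=> k1 k2; rewrite ler_pdivlMl// mulr1.
  rewrite box_in ?mul1r; [|clear -h1 k1 d1; lra|clear -h2 k2 d1; lra].
  rewrite -gauss3_sub gauss3E subr0 ler_expR lerN2.
  have H : dot3 (chord s t (w, w')) (chord s t (w, w')) <= 12 * (t + s) ^+ 2 * d ^+ 2.
    apply: chord_le; rewrite ler_norml; [clear -k1 d0|clear -k2 d0]; lra.
  rewrite /chord/= in H.
  by rewrite mulrC -ler_pdivlMr// -dc.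
rewrite /chord_const.
have -> : e * pi ^+ 2 / c = \int[L2]_w (square1 0 0 pi w * (e / c)).
  rewrite RintegralZr//; last exact: intg_square1.
  by rewrite Rintegral_square1 ?pi_ge0//; ring.
apply: Rint_le; [by apply: intgZr; exact: intg_square1|exact: intg_outer|].
move=> w; have ec0 : 0 < e / c by rewrite divr_gt0// expR_gt0.
have In0 : 0 <= \int[L2]_w' (box1 w' * gauss3 c (torus s t w) (torus s t w')).
  by apply: Rintegral_ge0 => w' _; rewrite mulr_ge0 ?box1_ge0 ?gauss3_ge0.
rewrite -ler_pdivlMr//; apply: square1_le.
  by apply: divr_ge0 (ltW ec0); rewrite mulr_ge0 ?box1_ge0.
rewrite !add0r => k1 k2; rewrite ler_pdivlMr// mul1r box_in ?mul1r ?inner//.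
  by case/andP: k1 => -> h; rewrite (le_trans h)// lerDl.
by case/andP: k2 => -> h; rewrite (le_trans h)// lerDl.
Qed.
End chord_lower.

(** * Energy of the chord multiplier at high frequency *)

Section thickened_torus.
Context {R : realType}.
Local Notation L3 := (@L3 R).
Local Notation L2L2 := (@L2L2 R).
Variables s t : R.
Hypotheses (s0 : 0 < s) (st : s < t).
Local Notation D := (multiplier L2L2 box2 (chord s t)).

Lemma packet0E a (x : space3 R) : packet a 0 x = gauss3 a 0 x.
Proof. by rewrite /packet mul0r cos0 mulr1. Qed.

Lemma packet_hat0E a (xi : space3 R) :
  packet_hat a 0 xi = Num.sqrt (pi / a) ^+ 3 * gauss3 (4 * a)^-1 0 xi.
Proof.
by rewrite /packet_hat oppr0 (_ : (0, 0, 0) = 0 :> space3 R)//; congr (_ * _); field.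
Qed.

(** A Gaussian stand-in for a sharp cutoff: for [|xi| < K] one has [e * exp(-|xi|^2/K^2) >= 1], so
    the left side is nonpositive there. *)
Lemma bessel_symbol_ge_cutoff alpha K (xi : space3 R) : 0 < alpha -> 0 < K ->
  K `^ alpha * (1 - expR 1 * gauss3 (K ^- 2) 0 xi) <= bessel_symbol alpha xi.
Proof.
move=> alpha0 K0; have P0 : 0 <= K `^ alpha by exact: powR_ge0.
have [h|h] := leP (K ^+ 2) (dot3 xi xi).
  apply: (@le_trans _ _ (K `^ alpha)).
    by rewrite ler_piMr// lerBlDr lerDl mulr_ge0 ?expR_ge0 ?gauss3_ge0.
  have -> : K `^ alpha = (K ^+ 2) `^ (alpha / 2).
    by rewrite -powR_mulrn ?(ltW K0)// -powRrM; congr (_ `^ _); field.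
  rewrite /bessel_symbol ge0_ler_powR ?nnegrE ?sqr_ge0 ?add1_dot3_ge0//; first by rewrite divr_ge0// ltW.
  by apply: le_trans h _; rewrite lerDr.
apply: (@le_trans _ _ 0); last exact: bessel_symbol_ge0.
rewrite mulr_ge0_le0// subr_le0 gauss3E subr0 -expRD -[leLHS]expR0 ler_expR.
by rewrite subr_ge0 mulrC ler_pdivrMr ?exprn_gt0// mul1r ltW.
Qed.

(* Frequencies below cutoff_const * sqrt a then carry at most half of the lower bound for the
   energy at scale sqrt a. *)
Definition cutoff_const : R :=
  chord_const s t / (4 * expR 1 * ((2 * pi) ^+ 2 * torus_const s t)).

Lemma cutoff_const_gt0 : 0 < cutoff_const.
Proof.
rewrite divr_gt0 ?chord_const_gt0//.
have tc0 := torus_const_gt0 s0 st.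
have pp0 : 0 < (2 * pi) ^+ 2 :> R by rewrite exprn_gt0// mulr_gt0// pi_gt0.
apply: mulr_gt0; last exact: mulr_gt0.
by rewrite mulr_gt0 ?expR_gt0.
Qed.

(** As the multiplier is nonnegative, the symbol may be replaced by its cutoff minorant. The lower
    count of pairs, at rate [a/2 >= 1], gives [2 chord_const/a] for the main term. The removed part
    has Gaussian volume of order [K^3] and pair count of order [K^(-2)], so one factor
    [cutoff_const] survives and brings it down to [chord_const/a]. *)
Lemma chord_energy_ge alpha a : 0 < alpha -> 2 <= a ->
  (cutoff_const * Num.sqrt a) `^ alpha * (Num.sqrt (pi / a) ^+ 3) ^+ 2 *
    (Num.sqrt (pi * a) ^+ 3 * (chord_const s t / a)) <=
  \int[L3]_xi (bessel_symbol alpha xi * packet_hat a 0 xi ^+ 2 * D xi).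
Proof.
move=> alpha0 a2; have a0 : 0 < a by apply: lt_le_trans a2.
have sa0 : 0 < Num.sqrt a by rewrite sqrtr_gt0.
have kap0 := cutoff_const_gt0.
set K := cutoff_const * Num.sqrt a.
have K0 : 0 < K by rewrite mulr_gt0.
have K2 : K ^+ 2 = cutoff_const ^+ 2 * a by rewrite exprMn sqr_sqrtr// ltW.
set T := Num.sqrt (pi / a) ^+ 3.
set tau := 2 * (4 * a)^-1.
have tau0 : 0 < tau by rewrite mulr_gt0// invr_gt0 mulr_gt0.
have tau0' : 0 < K ^- 2 by rewrite invr_gt0 exprn_gt0.
have Ib := @intg_box2 R; have mc := measurable_chord s t.
have I1 := intg_multiplier_gauss3 Ib mc tau0.
have I2 := intg_multiplier_gauss3 Ib mc tau0'.
pose low xi := K `^ alpha * T ^+ 2 * (D xi * gauss3 tau 0 xi - expR 1 * (D xi * gauss3 (K ^- 2) 0 xi)).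
have Il : L3.-intg low by apply: intgZl; apply: intgB => //; exact: intgZl.
have low_le xi : low xi <= bessel_symbol alpha xi * packet_hat a 0 xi ^+ 2 * D xi.
  rewrite packet_hat0E -/T exprMn gauss3_sqr -/tau /low.
  have H := bessel_symbol_ge_cutoff xi alpha0 K0.
  have D0 := multiplier_chord_ge0 s t xi.
  have g0 := gauss3_ge0 tau 0 xi; have g20 := gauss3_ge0 (K ^- 2) 0 xi.
  have g1 : gauss3 tau 0 xi <= 1 by apply: gauss3_le1; exact: ltW.
  have P0 : 0 <= K `^ alpha by exact: powR_ge0.
  move: H D0 g0 g20 g1 P0; set b := bessel_symbol _ _; set d := D xi.
  set g := gauss3 tau 0 xi; set h := gauss3 _ 0 xi; set P := K `^ alpha; set e := expR 1.
  move=> H D0 g0 h0 g1 P0.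
  have e0 : 0 <= e by exact: expR_ge0.
  apply: (@le_trans _ _ (P * (1 - e * h) * (T ^+ 2 * g) * d)); last first.
    by rewrite ler_wpM2r// ler_wpM2r// mulr_ge0// sqr_ge0.
  rewrite [leRHS](_ : _ = P * T ^+ 2 * (d * g - e * (d * h) * g)); last by ring.
  rewrite ler_wpM2l ?mulr_ge0 ?sqr_ge0// lerD2l lerN2 ler_piMr// mulr_ge0//.
  exact: mulr_ge0.
apply: le_trans (Rint_le Il (intg_bessel_packet_multiplier 0 alpha0 a0 Ib mc) low_le).
rewrite /low RintegralZl//; last by apply: intgB => //; exact: intgZl.
rewrite ler_wpM2l ?mulr_ge0 ?powR_ge0 ?sqr_ge0//.
rewrite RintegralB//; last exact: intgZl.
rewrite RintegralZl// !Rintegral_multiplier_gauss3//.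
have -> : (4 * tau)^-1 = a / 2 by rewrite /tau; field; rewrite gt_eqF.
have -> : pi / tau = pi * a * 2 by rewrite /tau; field; rewrite gt_eqF.
have -> : pi / K ^- 2 = pi * a * cutoff_const ^+ 2 by rewrite invrK K2; ring.
have -> : (4 * K ^- 2)^-1 = K ^+ 2 / 4 by rewrite invfM invrK mulrC.
have a21 : 1 <= a / 2 by rewrite ler_pdivlMr// mul1r.
have J1 := Rintegral_chord_ge s0 st a21.
have K40 : 0 < K ^+ 2 / 4 by rewrite divr_gt0// exprn_gt0.
have J2 := Rintegral_chord_le s0 st K40.
set j1 := \int[L2L2]_z _ in J1 *; set j2 := \int[L2L2]_z _ in J2 *.
have pa0 : 0 <= pi * a by rewrite mulr_ge0 ?pi_ge0// ltW.
rewrite !(sqrt3M _ pa0) sqrtr_sqr gtr0_norm//.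
set Q := Num.sqrt (pi * a) ^+ 3.
have Q0 : 0 <= Q by rewrite exprn_ge0 ?sqrtr_ge0.
have s2 : 1 <= Num.sqrt 2 ^+ 3 :> R.
  rewrite -[leLHS](expr1n _ 3) lerXn2r ?nnegrE ?sqrtr_ge0//.
  by rewrite -[leLHS]sqrtr1 ler_wsqrtr// ler1n.
rewrite [leRHS](_ : _ = Q * (Num.sqrt 2 ^+ 3 * j1 - expR 1 * (cutoff_const ^+ 3 * j2))); last by ring.
rewrite ler_wpM2l//.
have c20 := chord_const_gt0 s t; have tc0 := torus_const_gt0 s0 st.
have pp0 : 0 < (2 * pi) ^+ 2 :> R by rewrite exprn_gt0// mulr_gt0// pi_gt0.
have U : expR 1 * (cutoff_const ^+ 3 * j2) <= chord_const s t / a.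
  apply: (@le_trans _ _ (expR 1 * (cutoff_const ^+ 3 * ((2 * pi) ^+ 2 * (torus_const s t / (K ^+ 2 / 4)))))).
    by rewrite ler_wpM2l ?expR_ge0// ler_wpM2l// exprn_ge0// ltW.
  have e0 : 0 < expR 1 :> R by exact: expR_gt0.
  have kE : cutoff_const * (4 * expR 1 * ((2 * pi) ^+ 2 * torus_const s t)) = chord_const s t.
    rewrite /cutoff_const mulfVK// gt_eqF//.
    by apply: mulr_gt0; [rewrite mulr_gt0|exact: mulr_gt0].
  rewrite -kE K2 le_eqVlt; apply/orP; left; apply/eqP.
  move: kap0; move: (torus_const s t) cutoff_const ((2 * pi) ^+ 2) => c k P k0.
  by field; rewrite !gt_eqF.
have c21 : chord_const s t / (a / 2) = 2 * (chord_const s t / a) by field; rewrite gt_eqF.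
rewrite c21 in J1.
have ca0 : 0 <= chord_const s t / a by rewrite divr_ge0// ltW.
have J1' : j1 <= Num.sqrt 2 ^+ 3 * j1 by rewrite ler_peMl//; apply: le_trans J1; rewrite mulr_ge0.
move: U J1 J1'; move: (_ / a) (expR 1 * _) (_ * j1) => u v w; clear; lra.
Qed.

End thickened_torus.

(** * The smoothed torus as test function *)

Section thickened.
Context {R : realType}.
Local Notation L2 := (@L2 R).
Local Notation L3 := (@L3 R).
Local Notation L2L2 := (@L2L2 R).
Variables s t : R.
Hypotheses (s0 : 0 < s) (st : s < t).

Definition ntorus (w : R * R) : space3 R := - torus s t w.

Lemma measurable_ntorus : measurable_fun setT ntorus.
Proof.
have m0 : measurable_fun setT (fun _ : R * R => 0 : space3 R) by exact: measurable_cst.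
have := measurable_space3B m0 (measurable_torus s t).
by apply: eq_measurable_fun => w _; rewrite sub0r.
Qed.

(* The reflection makes its torus average a superposition over the chords of the torus. *)
Definition thick (a : R) : space3 R -> R := superpos L2 (@box1 R) ntorus a 0.

Lemma thickE a x : thick a x = \int[L2]_w (box1 w * gauss3 a (- x) (torus s t w)).
Proof.
apply: eq_Rintegral => w _; rewrite packet0E; congr (_ * _).
by rewrite !gauss3E; congr (expR (- (_ * _))); rewrite /dot3/=; ring.
Qed.

Lemma thick_ge0 a x : 0 <= thick a x.
Proof.
by rewrite thickE; apply: Rintegral_ge0 => w _; rewrite mulr_ge0 ?box1_ge0 ?gauss3_ge0.
Qed.

Lemma thick_le a x : 0 < a -> thick a x <= torus_const s t / a.
Proof. by move=> a0; rewrite thickE Rintegral_gauss3_torus. Qed.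

Lemma intg_thick a : 0 < a -> L3.-intg (thick a).
Proof. by move=> a0; exact: intg_superpos (@intg_box1 R) measurable_ntorus a0. Qed.

Lemma Rintegral_thick a : 0 < a ->
  \int[L3]_x thick a x = Num.sqrt (pi / a) ^+ 3 * (2 * pi) ^+ 2.
Proof.
move=> a0.
have d0 (x : space3 R) : dot3 x 0 = 0 by rewrite /dot3/= !mulr0 !addr0.
transitivity (\int[L3]_x (thick a x * cos (dot3 x 0))).
  by apply: eq_Rintegral => x _; rewrite d0 cos0 mulr1.
rewrite (superpos_fourier _ (@intg_box1 R) measurable_ntorus a0).
rewrite packet_hat0E gauss3E subr0 d0 mulr0 oppr0 expR0 mulr1; congr (_ * _).
rewrite -Rintegral_box1; apply: eq_Rintegral => w _.
by rewrite d0 cos0 mulr1.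
Qed.

(** Interpolation of the sup bound with the mass: [f^p <= (sup f)^(p - 1) f]. *)
Lemma Lp_norm_thick p a : 1 <= p -> 0 < a ->
  (Lp_norm p (fun x => (thick a x)%:C%C) <=
   (((torus_const s t / a) `^ (p - 1) * ((2 * pi) ^+ 2 * Num.sqrt (pi / a) ^+ 3)) `^ p^-1)%:E)%E.
Proof.
move=> p1 a0; have p0 : 0 < p by apply: lt_le_trans p1.
have M0 : 0 <= torus_const s t / a by rewrite divr_ge0// ltW// torus_const_gt0.
have It := intg_thick a0.
have dom x : `|thick a x| `^ p <= (torus_const s t / a) `^ (p - 1) * thick a x.
  have h0 := thick_ge0 a x; rewrite ger0_norm//.
  have -> : thick a x `^ p = thick a x `^ (p - 1) * thick a x.
    have [->|nz] := eqVneq (thick a x) 0; first by rewrite mulr0 powR0// gt_eqF.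
    by rewrite -[X in _ = _ * X]powRr1// -powRD ?subrK// nz implybT.
  rewrite ler_wpM2r//; apply: ge0_ler_powR; rewrite ?nnegrE ?subr_ge0//.
  exact: thick_le.
have Id := intgZl ((torus_const s t / a) `^ (p - 1)) It.
have Ip : L3.-intg (fun x => `|thick a x| `^ p).
  apply: (intg_dominated _ Id).
    apply: measurableT_comp (measurable_powR p) _.
    by apply: measurableT_comp => //; exact: intg_measurable It.
  by move=> x; rewrite ger0_norm ?powR_ge0.
apply: Lp_norm_real_le => //.
apply: le_trans (Rint_le Ip Id dom) _.
by rewrite RintegralZl// Rintegral_thick// (mulrC (_ ^+ 2)).
Qed.

Lemma torus_average_thick a x : 0 < a ->
  \int[L2]_w (box1 w * thick a (x - torus s t w)) = superpos L2L2 box2 (chord s t) a 0 x.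
Proof.
move=> a0.
have Ib := @intg_box2 R; have mc := measurable_chord s t.
have E w w' : box2 (w, w') * packet a 0 (x - chord s t (w, w')) =
   box1 w * (box1 w' * gauss3 a (- (x - torus s t w)) (torus s t w')).
  rewrite packet0E /box2/= -mulrA; congr (_ * (_ * _)).
  by rewrite !gauss3E; congr (expR (- (_ * _))); rewrite /dot3 /chord/=; ring.
have I w := intg_gauss3_torus s t (- (x - torus s t w)) a0.
have mg := intg_measurable (intg_gauss3 x a0).
rewrite /superpos (@Rintegral_prod12 _ _ _ _ _ L2 L2 (fun z => box2 z * packet a 0 (x - chord s t z))).
- apply: eq_Rintegral => w _; rewrite thickE -RintegralZl//.
  by apply: eq_Rintegral => w' _; rewrite E.
- apply: (eq_intg _ (@intg_gauss3_comp _ _ _ L2L2 _ _ Ib mc a x a0)) => z.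
  by rewrite packet0E !gauss3E; congr (_ * expR (- (_ * _))); rewrite /dot3/=; ring.
- by move=> w; apply: eq_intg (intgZl (box1 w) (I w)) => w'; rewrite E.
Qed.

Variables (p q alpha : R).
Hypotheses (alpha0 : 0 < alpha) (p1 : 1 < p) (pq : p^-1 + q^-1 = 1).

(** After one [T] cancels, the left side carries [a^(alpha/2) / a] and the right side
    [(1/a)^(1/q) = a^(1/p) / a]; here [(p - 1)/p = 1/q] turns the sup bound into its share of the
    norm. *)
Lemma thick_energy_bound : bounded_Lp_Sobolev p alpha (torus_average s t) ->
  exists B : R, forall a, 2 <= a -> a `^ (alpha / 2) <= B * a `^ p^-1.
Proof.
move=> /(key_inequality alpha0 p1 pq)[C C0 HC].
have p0 : 0 < p by apply: lt_trans p1.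
have tc0 := torus_const_gt0 s0 st.
have cc0 := cutoff_const_gt0 s0 st.
have c20 := chord_const_gt0 s t.
have pp0 : 0 < (2 * pi) ^+ 2 :> R by rewrite exprn_gt0// mulr_gt0// pi_gt0.
pose tc := torus_const s t.
pose X := cutoff_const s t `^ alpha * pi ^+ 3 * chord_const s t.
have X0 : 0 < X by rewrite mulr_gt0// mulr_gt0 ?powR_gt0// exprn_gt0// pi_gt0.
exists (X^-1 * (C * (tc `^ q^-1 * ((2 * pi) ^+ 2) `^ p^-1))) => a a2.
have a0 : 0 < a by apply: lt_le_trans a2.
pose T := Num.sqrt (pi / a) ^+ 3.
have T0 : 0 < T by rewrite exprn_gt0// sqrtr_gt0 divr_gt0// pi_gt0.
have tca : 0 < tc / a by rewrite divr_gt0.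
pose N := ((tc / a) `^ (p - 1) * ((2 * pi) ^+ 2 * T)) `^ p^-1.
have NE : N = (tc / a) `^ q^-1 * (((2 * pi) ^+ 2) `^ p^-1 * T `^ p^-1).
  rewrite /N powRM ?powR_ge0//; last by rewrite mulr_ge0 ?ltW.
  rewrite -powRrM (powRM _ (ltW pp0) (ltW T0)); congr (_ `^ _ * _).
  by rewrite mulrBl mulfV ?gt_eqF// mul1r -pq addrC addKr.
have N0 : 0 < N by rewrite /N powR_gt0// mulr_gt0 ?powR_gt0// mulr_gt0.
have fN : (Lp_norm p (fun x => (thick a x)%:C%C) <= N%:E)%E by exact: Lp_norm_thick (ltW p1) a0.
have fLp := in_Lp_real (intg_measurable (intg_thick a0)) fN.
have H := HC (thick a) N a 0 _ _ L2L2 box2 (chord s t) fLp N0 fN a0 (@intg_box2 R)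
  (measurable_chord s t) (fun x => torus_average_thick x a0).
have {H}H := le_trans (chord_energy_ge s0 st alpha0 a2) (le_trans (ler_norm _) H).
rewrite -/T NE in H.
have {}H : T * ((cutoff_const s t * Num.sqrt a) `^ alpha * pi ^+ 3 * (chord_const s t / a)) <=
   T * (C * ((tc / a) `^ q^-1 * ((2 * pi) ^+ 2) `^ p^-1)).
  apply: le_trans (le_trans H _); rewrite le_eqVlt; apply/orP; left; apply/eqP.
    by rewrite -(sqrt3_pi a0) -/T; ring.
  by rewrite -[in RHS](conj_powR pq T0); ring.
rewrite (ler_pM2l T0) in H.
have sa : (cutoff_const s t * Num.sqrt a) `^ alpha = cutoff_const s t `^ alpha * a `^ (alpha / 2).
  rewrite powRM ?sqrtr_ge0 ?(ltW cc0)//; congr (_ * _).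
  by rewrite -powR12_sqrt ?(ltW a0)// -powRrM; congr (_ `^ _); field.
have ta : (tc / a) `^ q^-1 = tc `^ q^-1 * (a `^ p^-1 / a).
  rewrite powRM ?(ltW tc0) ?invr_ge0 ?(ltW a0)//; congr (_ * _).
  rewrite -[X in _ = _ / X](powRr1 (ltW a0)) -pq powRD; last by rewrite (gt_eqF a0) implybT.
  rewrite invfM mulrA mulfV ?mul1r ?gt_eqF ?powR_gt0//.
  by rewrite -(powR_inv1 (ltW a0)) -powRrM mulN1r powRN.
rewrite sa ta in H.
rewrite -mulrA ler_pdivlMl// /X.
rewrite -(ler_pM2r (_ : 0 < a^-1)) ?invr_gt0//.
apply: le_trans (le_trans H _); rewrite le_eqVlt; apply/orP; left; apply/eqP; ring.
Qed.

Lemma thick_unbounded : p^-1 < alpha / 2 -> ~ bounded_Lp_Sobolev p alpha (torus_average s t).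
Proof.
move=> pa /thick_energy_bound[B HB].
pose b := alpha / 2 - p^-1.
have b0 : 0 < b by rewrite subr_gt0.
(* Large enough for [a^b >= |B| + 1], and at least 2, where the energy bound holds. *)
pose a := Num.max 2 ((`|B| + 1) `^ b^-1).
have a2 : 2 <= a by rewrite le_max lexx.
have a0 : 0 < a by apply: lt_le_trans a2.
have := HB _ a2; rewrite -(subrK p^-1 (alpha / 2)) -/b powRD; last by rewrite (gt_eqF a0) implybT.
rewrite ler_pM2r ?powR_gt0//; apply/negP; rewrite -ltNge.
apply: le_lt_trans (ler_norm B) _.
apply: (@lt_le_trans _ _ (`|B| + 1)); first by rewrite ltrDl.
have B0 : 0 <= `|B| + 1 by rewrite addr_ge0.
have -> : `|B| + 1 = ((`|B| + 1) `^ b^-1) `^ b by rewrite -powRrM mulVf ?gt_eqF// powRr1.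
apply: ge0_ler_powR; rewrite ?nnegrE ?powR_ge0 ?(ltW b0) ?(ltW a0)//.
by rewrite /a le_max lexx orbT.
Qed.

End thickened.

Theorem mainTheorem9 (R : realType) (s t p alpha : R) :
  0 < s -> s < t -> 2 <= p -> Num.min (1 / 2) (2 / p) < alpha ->
  ~ bounded_Lp_Sobolev p alpha (torus_average s t).
Proof.
move=> s0 st p2 halpha Hb.
have p1 : 1 < p by apply: lt_le_trans p2; rewrite ltr1n.
have p0 : 0 < p by apply: lt_trans p1.
pose q := (1 - p^-1)^-1.
have pq : p^-1 + q^-1 = 1 by rewrite /q invrK addrC subrK.
have alpha0 : 0 < alpha.
  by apply: lt_trans halpha; rewrite lt_min !divr_gt0.
move: halpha; rewrite gt_min => /orP[alpha2|alphap].
  have [B HB] := axial_decay s0 st alpha0 p1 pq Hb.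
  exact: (axial_no_decay s0 alpha2 HB).
apply: (thick_unbounded s0 st alpha0 p1 pq _ Hb).
by rewrite ltr_pdivlMr// mulrC.
Qed.
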